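(* Let $\psi:(-\infty,1)\to[0,\infty)$ be smooth with $\psi\equiv0$ on $(-\infty,0]$, $\psi>0,\psi'>0,\psi''>0,\psi'''>0$ on $(0,1)$, and $\lim_{s\to1}\psi(s)=+\infty$. Let $\Omega=\{x\in\mathbb{R}^n:x_n<1\}$ and let $u\in\mathrm{Lip}_{\mathrm{loc}}(\Omega)$ be a weak solution of the weighted IMCF $\operatorname{div}\big(e^{\psi(x_n)}\tfrac{\nabla u}{|\nabla u|}\big)=e^{\psi(x_n)}|\nabla u|$ in $\Omega$. Suppose there is a constant $C$ such that (1) $u\ge\psi(x_n)-C$ in $\Omega$, and (2) $|\nabla u(x)|\le C/|x_n|$ for a.e. $x\in\{x_n<0\}$. Then $u(x',x_n)=\psi(x_n)-C'$ for some constant $C'$.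
   Context: $n\ge2$, Euclidean metric, $x=(x',x_n)$. A function $u\in\mathrm{Lip}_{\mathrm{loc}}(\Omega)$ is a weak solution of the weighted IMCF $\operatorname{div}(e^{\psi}\nabla u/|\nabla u|)=e^{\psi}|\nabla u|$ in $\Omega$ if for all $v\in\mathrm{Lip}_{\mathrm{loc}}(\Omega)$ and every domain $K$ with $\{u\ne v\}\Subset K\Subset\Omega$ one has $\int_K e^{\psi}(|\nabla u|+u|\nabla u|)\le\int_K e^{\psi}(|\nabla v|+v|\nabla u|)$, where $\psi$ is evaluated at $x_n$. *)

(* Defs.v *)
From HB Require Import structures.
From mathcomp Require Import all_boot all_order all_algebra.
From mathcomp Require Import all_classical all_reals all_analysis.
Set Implicit Arguments. Unset Strict Implicit. Unset Printing Implicit Defensive.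
Import Order.TTheory GRing.Theory Num.Theory.
Import numFieldNormedType.Exports.
Local Open Scope classical_set_scope.
Local Open Scope ring_scope.

Section IMCF.
Variable R : realType.

Definition lastc (n : nat) : 'rV[R]_n -> R :=
  match n with 0 => fun _ => 0 | k.+1 => fun x => x 0 ord_max end.

Definition enorm n (x : 'rV[R]_n) : R := Num.sqrt (\sum_(i < n) (x 0 i) ^+ 2).

Definition grad n (u : 'rV[R]_n -> R) (x : 'rV[R]_n) : 'rV[R]_n :=
  \row_(i < n) ('D_(delta_mx 0 i) u x).

Definition loc_lipschitz n (Omega : set 'rV[R]_n) (u : 'rV[R]_n -> R) : Prop :=
  forall x, Omega x -> exists r : R, exists L : R, 0 < r /\
    forall y z, enorm (y - x) < r -> enorm (z - x) < r -> Omega y -> Omega z ->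
      `|u y - u z| <= L * enorm (y - z).

Definition compactly_contained n (A B : set 'rV[R]_n) : Prop :=
  compact (closure A) /\ closure A `<=` B.

Definition domain n (K : set 'rV[R]_n) : Prop :=
  K !=set0 /\ open K /\ connected K.

(* Lebesgue integral over R^n, written as an iterated one-dimensional
   Lebesgue integral (equal, by Fubini, to the n-dimensional Lebesgue
   integral for the bounded, compactly supported integrands used below). *)
Fixpoint iint (n : nat) : ('rV[R]_n -> R) -> R :=
  match n return ('rV[R]_n -> R) -> R with
  | 0 => fun f => f 0
  | k.+1 => fun f =>
      Rintegral (@lebesgue_measure R) setT
        (fun t : R => iint (fun y : 'rV[R]_k => f (row_mx (const_mx t : 'rV[R]_1) y)))
  end.

Definition integral_on n (K : set 'rV[R]_n) (f : 'rV[R]_n -> R) : R :=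
  iint (fun x => \1_K x * f x).

Definition box n (a b : 'rV[R]_n) : set 'rV[R]_n :=
  [set x | forall i, a 0 i <= x 0 i <= b 0 i].
Definition box_vol n (a b : 'rV[R]_n) : R := \prod_(i < n) (b 0 i - a 0 i).

Definition Rn_null_set n (N : set 'rV[R]_n) : Prop :=
  forall eps : R, 0 < eps -> exists a b : nat -> 'rV[R]_n,
    (forall k i, a k 0 i <= b k 0 i) /\
    N `<=` \bigcup_k box (a k) (b k) /\
    (forall m, \sum_(k < m) box_vol (a k) (b k) <= eps).

Definition weak_weighted_IMCF n (psi : R -> R) (Omega : set 'rV[R]_n)
    (u : 'rV[R]_n -> R) : Prop :=
  loc_lipschitz Omega u /\
  forall (v : 'rV[R]_n -> R) (K : set 'rV[R]_n),
    loc_lipschitz Omega v -> domain K ->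
    compactly_contained [set x | Omega x /\ u x <> v x] K ->
    compactly_contained K Omega ->
    integral_on K (fun x => expR (psi (lastc x)) *
                     (enorm (grad u x) + u x * enorm (grad u x)))
    <= integral_on K (fun x => expR (psi (lastc x)) *
                     (enorm (grad v x) + v x * enorm (grad u x))).

End IMCF.

(* Main.v *)
Require Import Defs.
From HB Require Import structures.
From mathcomp Require Import all_boot all_order all_algebra.
From mathcomp Require Import all_classical all_reals all_analysis.
From mathcomp Require Import measurable_realfun ring lra.
Import Order.TTheory GRing.Theory Num.Theory.
Import numFieldNormedType.Exports.
Local Open Scope classical_set_scope.
Local Open Scope ring_scope.
Set Implicit Arguments.
Unset Strict Implicit.

(** Two weak solutions u1, u2 on a slab b < x_n < 1, bounded below, with
    u1 >= psi - C and u2 <= u1 + c0 on x_n = b, satisfy u2 <= u1 + c0.  Indeed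
    t / (1 + th t) turns u2 + C + 1 into a bounded function whose gradient is
    shrunk by a factor < 1, so the positive part g of its difference with
    u1 + C + 1 + c0 vanishes above some height s0 < 1; subtracting a constant
    close to the supremum makes g as small as desired.  With eta a power of a
    horizontal cutoff zeta of radius r, testing u1 with eta g^m and u2 with
    - eta (g^m - la g^(m+1)) bounds the integral of
    eta g^m (|grad u1| + |grad u2|) by A/r times that of (zeta g)^m.  The former
    dominates the vertical derivative of (zeta g)^(m+1), so the Poincare
    inequality in the slab gives a bound on the integral of (zeta g)^(m+1), and
    Young's inequality shows that it is O(1/r) once m > n; hence g = 0, and
    th -> 0.

    By the gradient bound a horizontal translate of u by tau differs from u by
    O(|tau| / D) on x_n = - D.  Comparing the two and letting D tend to infinity,
    u depends on x_n only.  On x_n = - D it then agrees with psi + c, which is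
    itself a solution for the test functions used, and comparison in both
    directions concludes. *)

(** * One-dimensional integration *)

(** The functional has linear growth in the gradient and its second term freezes |grad u|, so two
    solutions yield no coercive term when compared; and since the slab is unbounded, their
    difference need not attain its supremum. The coercive term is manufactured as follows. Where g >
    0 one has grad g = [e grad U2 - grad U1], with e the derivative of the truncation. Adding eta
    g^m to U1, or subtracting its variant from U2, therefore replaces each gradient by a combination
    of both; smallness of g keeps the coefficients nonnegative, so the triangle inequality loses
    nothing to leading order. The leading terms of the two tests cancel and the sign is decided by
    terms of order g^m: the correction [la g^(m+1)] reverses the bad sign in front of |grad U1|, and
    the strict bound [e <= 1 - 3 sg] pays for this in front of |grad U2|. What is left is - sg eta
    g^m (|grad U1| + |grad U2|) against a cutoff error. With m = n + 1, Young's inequality gives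
    r^(-m-1) times the volume r^n, that is r^(-2). *)

Section OneDim.
Variable R : realType.
Local Notation mu := (@lebesgue_measure R).
Local Notation mR := (measurableTypeR R).

(** The bound and the radius are explicit because they pass uniformly to slices and to integrals
    depending on a parameter. *)
Definition bounded_compact (f : R -> R) (M r : R) :=
  [/\ measurable_fun setT f, forall x, `|f x| <= M & forall x, f x != 0 -> `|x| <= r].

Lemma lebesgue_measure_itvcc_lty (a b : R) : (mu `[a, b]%classic < +oo)%E.
Proof.
have := lebesgue_measure_itv `[a, b]%R => /= ->.
by case: ifPn => // _; rewrite -EFinD ltry.
Qed.

Lemma bounded_compact_integrable f M r :
  bounded_compact f M r -> mu.-integrable setT (EFin \o f).
Proof.
move=> [mf fM fr].
have -> : EFin \o f = (EFin \o f) \_ `[-r, r]%classic.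
  apply/funext => x; rewrite patchE; case: ifPn => // xr /=.
  have [-> //|/fr] := eqVneq (f x) 0.
  rewrite ler_norml => xr'; move: xr.
  by rewrite notin_setE /= in_itv /= xr'.
apply: (iffLR (integrable_mkcond (mu := mu) (EFin \o f) (D := `[-r, r]%classic) _)) => //.
apply: measurable_bounded_integrable => //.
- exact: lebesgue_measure_itvcc_lty.
- exact: measurable_funTS.
- exists M; split; first exact: num_real.
  by move=> N MN x _; apply: le_trans (fM x) (ltW MN).
Qed.

Lemma bounded_compact_ge f M r : bounded_compact f M r -> 0 <= M.
Proof. by move=> [_ /(_ 0) h _]; apply: le_trans h. Qed.

Lemma itv_bounded_compact (a b r : R) : `|a| <= r -> `|b| <= r ->
  bounded_compact (fun s => \1_(`[a, b]%classic) s : R) 1 r.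
Proof.
move=> ar br; split.
- by apply: measurable_indic.
- by move=> x; rewrite indicE; case: (_ \in _); rewrite ?normr1 ?normr0.
- move=> s; rewrite indicE mem_setE in_itv /=.
  have [/andP[? ?] _|] := boolP (a <= s <= b); last by rewrite eqxx.
  move: ar br; rewrite !ler_norml => /andP[? ?] /andP[? ?]; apply/andP; split; lra.
Qed.

Lemma Rintegral_itv (a b : R) : a <= b ->
  Rintegral mu setT (fun s => \1_(`[a, b]%classic) s) = b - a.
Proof.
rewrite le_eqVlt => ab; rewrite /Rintegral integral_indic //.
have := lebesgue_measure_itv `[a, b]%R; rewrite setIT /= => ->; rewrite lte_fin.
by case/orP: ab => [/eqP ->|->] //; rewrite ltxx subrr.
Qed.

Lemma bounded_compactZ c f M r : bounded_compact f M r ->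
  bounded_compact (fun x => c * f x) (`|c| * M) r.
Proof.
move=> [mf fM fr]; split.
- exact: measurable_funM.
- by move=> x; rewrite normrM ler_wpM2l.
- by move=> x; rewrite mulf_eq0 negb_or => /andP[_ /fr].
Qed.

Lemma bounded_compact_lt f M r t : bounded_compact f M r ->
  bounded_compact (fun x => f x * (x < t)%R%:R) M r.
Proof.
move=> hf; have [mf fM fr] := hf; split.
- apply: measurable_funM => //.
  have -> : (fun x => (x < t)%R%:R) = \1_(`]-oo, t[%classic) :> (R -> R).
    by apply/funext => x; rewrite indicE mem_setE in_itv.
  exact: measurable_indic.
- by move=> x; case: (x < t); rewrite ?mulr1 // mulr0 normr0 (bounded_compact_ge hf).
- by move=> x; rewrite mulf_eq0 negb_or => /andP[/fr].
Qed.

(** The pushforward of Lebesgue measure under a translation agrees with it on half-open intervals,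
    hence everywhere. *)
Lemma Rintegral_translate (f : R -> R) t : measurable_fun setT f ->
  mu.-integrable setT (EFin \o (fun x => f (x + t))) ->
  Rintegral mu setT (fun x => f (x + t)) = Rintegral mu setT f.
Proof.
move=> mf intf; rewrite /Rintegral; congr fine.
have mt : measurable_fun setT (fun x : mR => (x + t : mR)).
  by apply: measurable_funD => //.
have := @integral_pushforward _ _ mR mR R _ mt mu setT (EFin \o f).
move=> /(_ _ _ measurableT); rewrite preimage_setT => <- //; last first.
  exact/measurable_EFinP.
apply: eq_measure_integral => A mA _; symmetry.
apply: lebesgue_measure_unique => // X [[a b] _ <-] /=.
rewrite /pushforward.
have -> : (fun x : mR => (x + t : mR)) @^-1` (`]a, b]) = `]a - t, b - t]%classic.
  apply/seteqP; split => x /=; rewrite !in_itv /=; lra.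
rewrite !lebesgue_measure_itv /= !lte_fin.
have -> : (a - t < b - t) = (a < b) by apply/idP/idP; lra.
by case: ifP => // _; rewrite -!EFinD; congr EFin; lra.
Qed.

Lemma derivable_linear (L x : R) : derivable (fun y : R => L * y) x 1.
Proof. by have h : derivable (L \*: (id : R -> R)) x 1 by exact: derivableZ. Qed.

End OneDim.

(** * Lipschitz functions of one real variable *)

Section LipAE.
Variable R : realType.
Local Notation mu := (@lebesgue_measure R).
Local Notation mR := (measurableTypeR R).
Variables (F : R -> R) (L : R).
Hypothesis L0 : 0 < L.
Hypothesis FL : forall x y, `|F x - F y| <= L * `|x - y|.

Lemma lipschitz_fun_continuous : continuous F.
Proof.
move=> x; apply/(@cvgrPdist_lt _ R) => e e0; near=> y.
apply: (le_lt_trans (FL _ _)); rewrite -ltr_pdivlMl //.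
near: y; apply: (@cvgr_dist_lt R R^o _ _ _ id x) => //; rewrite ?mulr_gt0 ?invr_gt0 //; exact: cvg_id.
Unshelve. all: by end_near. Qed.

(* L x + F x and L x - F x are nondecreasing with Stieltjes measures summing to
   2 L dx, so both are absolutely continuous: Radon-Nikodym and the Lebesgue
   differentiation theorem then give Rademacher's theorem for F. *)
Definition Fplus x := L * x + F x.
Definition Fminus x := L * x - F x.

Let Fplus_nd : nondecreasing Fplus.
Proof.
move=> x y xy; rewrite /Fplus.
by have := FL x y; rewrite ler_norml [`|x - y|]ler0_norm; [move=> /andP[]; nra|lra].
Qed.
Let Fminus_nd : nondecreasing Fminus.
Proof.
move=> x y xy; rewrite /Fminus.
by have := FL x y; rewrite ler_norml [`|x - y|]ler0_norm; [move=> /andP[]; nra|lra].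
Qed.
Let Fplus_c : continuous Fplus.
Proof.
by move=> x; apply: cvgD; [apply: cvgMr; exact: cvg_id|exact: lipschitz_fun_continuous].
Qed.
Let Fminus_c : continuous Fminus.
Proof.
by move=> x; apply: cvgB; [apply: cvgMr; exact: cvg_id|exact: lipschitz_fun_continuous].
Qed.
HB.instance Definition _ := isCumulative.Build R _ R Fplus Fplus_nd
  (right_continuousW Fplus_c).
HB.instance Definition _ := isCumulative.Build R _ R Fminus Fminus_nd
  (right_continuousW Fminus_c).

Let nup := lebesgue_stieltjes_measure Fplus.
Let num := lebesgue_stieltjes_measure Fminus.

Lemma stieltjes_itvoc (f : cumulative R R) (a b : R) : a <= b ->
  lebesgue_stieltjes_measure f `]a, b]%classic = (f b - f a)%:E.
Proof.
move=> ab; rewrite /lebesgue_stieltjes_measure /measure_extension /=.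
by rewrite measurable_mu_extE /= ?wlength_itv_bnd //; exact: is_ocitv.
Qed.

Lemma stieltjes_dominated : nup `<< mu.
Proof.
apply/null_content_dominatesP => A mA A0.
have cge : 0 <= (2 * L)^-1 by rewrite invr_ge0 mulr_ge0 // ltW.
pose nu := @mscale _ mR R (NngNum cge) (measure_add nup num).
have nuE X : nu X = ((2 * L)^-1%:E * (nup X + num X))%E.
  by rewrite -measure_addE.
have : mu A = nu A.
  apply: lebesgue_measure_unique => // X [[a b] _ <-].
  apply: etrans (esym (nuE _)).
  have [ab|ba] := leP a b.
    have := lebesgue_measure_itv `]a, b]%R => /= ->.
    rewrite lte_fin.
    have -> : nup `]a, b]%classic = (Fplus b - Fplus a)%:E := stieltjes_itvoc _ ab.
    have -> : num `]a, b]%classic = (Fminus b - Fminus a)%:E := stieltjes_itvoc _ ab.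
    rewrite /Fplus /Fminus.
    case: ifPn => [_|].
      transitivity ((2 * L)^-1 * ((L * b + F b - (L * a + F a)) + (L * b - F b - (L * a - F a))))%:E; last by [].
      by congr EFin; field; rewrite gt_eqF.
    rewrite -leNgt => ba; have -> : b = a by apply/eqP; rewrite eq_le ab ba.
    by rewrite !subrr adde0 mule0.
  have -> : `]a, b]%classic = set0 :> set R.
    by apply/seteqP; split => x //=; rewrite in_itv /=; lra.
  have -> : nup set0 = 0%E by exact: measure0.
  have -> : num set0 = 0%E by exact: measure0.
  by rewrite adde0 mule0 measure0.
rewrite A0 => A0'; have /eqP := esym (etrans A0' (nuE A)).
rewrite mule_eq0 eqe invr_eq0 mulf_eq0 pnatr_eq0 /= gt_eqF //=.
rewrite padde_eq0 ?measure_ge0 // => /andP[/eqP //].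
Qed.

Lemma lipschitz_derivable_itv (a b : R) : a < b ->
  mu.-negligible [set x | a < x < b /\ ~ derivable F x 1].
Proof.
move=> ab.
have mab : measurable (`]a, b]%classic : set mR) by exact: measurable_itv.
have fab : (nup `]a, b]%classic < +oo)%E.
  by rewrite /nup stieltjes_itvoc ?ltW // ltry.
(* Restriction to a bounded interval makes the measure finite; countably many such intervals exhaust
   the line afterwards. *)
pose nu : {finite_measure set mR -> \bar R} := mfrestr mab fab.
have numu : nu `<< mu.
  apply/null_content_dominatesP => A mA A0.
  have /null_content_dominatesP h := stieltjes_dominated.
  rewrite /nu /= /mfrestr /mrestr /=.
  have mI : measurable (A `&` `]a, b]%classic) by exact: measurableI.
  apply: (h) => //; apply: (@subset_measure0 _ mR R mu _ A) => //.
have [rho [rho0 rhofin rhoint rhoE]] := radon_nikodym_sigma_finite numu.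
pose f : R -> R := fun x => fine (rho x).
have fE : EFin \o f = rho by apply/funext => x; rewrite /= /f fineK.
have intf : mu.-integrable setT (EFin \o f) by rewrite fE.
have := @FTC1 R f (BRight a) _ _.
move=> /(_ _ _)[].
- by move=> y; apply: integrableS intf.
- apply: (open_integrable_locally openT); exact: intf.
move=> N [mN N0 sN]; exists N; split => // x [/andP[ax xb] nd].
apply: sN => /= H; have [//|dF _] := H _.
apply: nd.
(* On the interval, F is a primitive of the density plus an affine function, so it is differentiable
   wherever the primitive is. *)
have E : forall y, a < y < b -> F y =
   (Rintegral mu [set` Interval (BRight a) (BRight y)] f) + Fplus a - L * y.
  move=> y /andP[ay yb].
  rewrite /Rintegral (_ : (fun x => (f x)%:E) = rho); last exact: fE.
  have := rhoE `]a, y]%classic => <- //; rewrite /nu /= /mfrestr /mrestr /=.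
  have -> : `]a, y]%classic `&` `]a, b]%classic = `]a, y]%classic.
    by apply/seteqP; split => z /=; rewrite !in_itv /=; lra.
  by rewrite /nup stieltjes_itvoc ?(ltW ay) //= /Fplus; lra.
have dG : derivable (fun y => (Rintegral mu [set` Interval (BRight a) (BRight y)] f) + Fplus a - L * y) x 1.
  apply: derivableB; first exact: (derivableD dF (derivable_cst _ _ _)).
  exact: derivable_linear.
apply: near_eq_derivable dG => //.
near=> y; rewrite E //; apply/andP; split; near: y.
  exact: lt_nbhsr.
exact: lt_nbhsl.
Unshelve. all: by end_near. Qed.

End LipAE.

Section LipFTC.
Variable R : realType.
Local Notation mu := (@lebesgue_measure R).
Local Notation mR := (measurableTypeR R).

Lemma lipschitz_derivable_ae (F : R -> R) (L : R) :
  (forall x y, `|F x - F y| <= L * `|x - y|) ->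
  mu.-negligible [set x | ~ derivable F x 1].
Proof.
move=> FL; have sub : [set x | ~ derivable F x 1] `<=`
    \bigcup_k [set x | - k.+1%:R < x < k.+1%:R /\ ~ derivable F x 1].
  move=> x /= nd; exists (Num.truncn `|x|) => //=.
  by split => //; rewrite -ltr_norml truncnS_gt.
suff [N [mN N0 sN]] : mu.-negligible (\bigcup_k [set x | - k.+1%:R < x < k.+1%:R /\ ~ derivable F x 1]).
  by exists N; split => //; apply: subset_trans sub sN.
apply: negligible_bigcup => k; apply: (@lipschitz_derivable_itv R F (`|L| + 1)).
- by rewrite ltr_wpDl.
- move=> x y; apply: le_trans (FL x y) _; apply: ler_wpM2r => //.
  by apply: le_trans (ler_norm _) _; rewrite lerDl.
- by have : (0:R) < k.+1%:R by []; lra.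
Qed.

Lemma Rintegral_dominated_cvg (f_ : nat -> R -> R) (f : R -> R) M r M' r' :
  (forall k, bounded_compact (f_ k) M r) -> bounded_compact f M' r' ->
  {ae mu, forall x, f_ k x @[k --> \oo] --> f x} ->
  Rintegral mu setT (f_ k) @[k --> \oo] --> Rintegral mu setT f.
Proof.
move=> hk hf cv.
have intg : mu.-integrable setT (EFin \o (fun x => M * \1_(`[-r, r]%classic) x)).
  apply: (@bounded_compact_integrable _ _ M r); split.
  - by apply: measurable_funM => //; apply: measurable_indic.
  - move=> x; rewrite indicE; case: (_ \in _); rewrite ?mulr1 ?mulr0 ?normr0.
      by rewrite ger0_norm // (bounded_compact_ge (hk 0%N)).
    exact: (bounded_compact_ge (hk 0%N)).
  - move=> x; rewrite indicE; have [xr _|xr] := boolP (x \in _); last by rewrite mulr0 eqxx.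
    by move: xr; rewrite inE /= in_itv /= ler_norml.
have mf_ k : measurable_fun setT (EFin \o f_ k) by have [m _ _] := hk k; exact/measurable_EFinP.
have mf : measurable_fun setT (EFin \o f) by have [m _ _] := hf; exact/measurable_EFinP.
have := @dominated_convergence _ mR R mu setT measurableT
  (fun k => EFin \o f_ k) (EFin \o f) (EFin \o (fun x => M * \1_(`[-r, r]%classic) x))
  mf_ mf _ intg _.
move=> /(_ _ _)[].
- move: cv; apply: filterS; first exact: (ae_filter_ringOfSetsType mu).
  by move=> x cx _; apply: cvg_EFin => //; exact: nearW.
- apply: (@nearW _ _ _ (ae_filter_ringOfSetsType mu)) => x k _; rewrite lee_fin; have [_ hM hr] := hk k.
  rewrite indicE; have [xr|xr] := boolP (x \in _); rewrite ?mulr1 ?mulr0 //.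
  move: xr; rewrite notin_setE /= in_itv /= -ler_norml => xr.
  by have [->|/hr] := eqVneq (f_ k x) 0; rewrite ?normr0.
have fin g N s : bounded_compact g N s -> (\int[mu]_x (g x)%:E)%E \is a fin_num.
  by move=> hg; apply: integrable_fin_num => //; exact: bounded_compact_integrable hg.
move=> _ _ H; rewrite /Rintegral; apply: fine_cvg; rewrite fineK; first exact: H.
exact: fin hf.
Qed.

Lemma Rintegral_bounded_compactZ (f : R -> R) c M r : bounded_compact f M r ->
  Rintegral mu setT (fun x => c * f x) = c * Rintegral mu setT f.
Proof. by move=> /bounded_compact_integrable h; apply: RintegralZl. Qed.

(* Difference quotients of x |-> F (min x s) have integral F s and converge
   dominatedly. *)
Lemma ftc_lipschitz (F D : R -> R) (L r M r' s : R) : (forall x y, `|F x - F y| <= L * `|x - y|) ->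
  (forall x, F x != 0 -> `|x| <= r) -> bounded_compact D M r' ->
  (forall x, derivable F x 1 -> D x = 'D_1 F x) ->
  Rintegral mu setT (fun x : R => D x * (x < s)%R%:R) = F s.
Proof.
move=> FL Fr hD DF.
have L0 : 0 <= L by have := FL 0 1; rewrite sub0r normrN1 mulr1; apply: le_trans.
have mF : measurable_fun setT F.
  apply: continuous_measurable_fun; apply: (@lipschitz_fun_continuous R F (L + 1)).
    by rewrite ltr_wpDl.
  by move=> x y; apply: le_trans (FL x y) _; apply: ler_wpM2r => //; rewrite lerDl.
pose G x := F (Num.min x s).
have [h hE] : {h : nat -> R | forall k, h k = k.+1%:R^-1} by exists (fun k => k.+1%:R^-1).
pose q (k : nat) x := k.+1%:R * (G (x + h k) - G x).
pose rho := `|r| + `|s| + 1.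
have k0 k : (0 : R) < k.+1%:R by [].
have ki0 k : 0 < h k by rewrite hE invr_gt0.
have ki1 k : h k <= 1 by rewrite hE invf_le1 // ler1n.
have r0 := normr_ge0 r.
have s0 := normr_ge0 s.
have rle : r <= `|r| by exact: ler_norm.
have sle : s <= `|s| by exact: ler_norm.
have F0 x : x < - `|r| -> F x = 0.
  move=> xr; have [//|/Fr] := eqVneq (F x) 0.
  rewrite ler_norml => /andP[]; lra.
have mG : measurable_fun setT G.
  by apply: measurableT_comp mF _; apply: measurable_minr.
have hc : h k @[k --> \oo] --> (0 : R).
  by rewrite (_ : h = fun k => k.+1%:R^-1); [exact: cvg_harmonic|exact/funext].
have hq k : bounded_compact (q k) L rho.
  split.
  - apply: measurable_funM => //; apply: measurable_funB => //.
    by apply: measurableT_comp mG _; apply: measurable_funD.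
  - move=> x; rewrite /q normrM ger0_norm // mulrC -ler_pdivlMr //.
    apply: le_trans (FL _ _) _; apply: ler_wpM2l => //.
    rewrite ler_norml -hE /Num.min; have h0 := ki0 k.
    case: ltP => ?; case: ltP => ?; apply/andP; split; lra.
  - move=> x; rewrite /q mulf_eq0 negb_or subr_eq0 => /andP[_].
    rewrite /G ler_norml => nG; rewrite /rho; have h0 := ki0 k; have h1 := ki1 k.
    apply: contraNT nG; rewrite negb_and -!ltNge => /orP[]h2; last first.
      by rewrite !min_r //; lra.
    by rewrite !F0 // gt_min; apply/orP; left; lra.
have hlim : {ae mu, forall x, q k x @[k --> \oo] --> D x * (x < s)%R%:R}.
  have [N [mN N0 sN]] := lipschitz_derivable_ae FL.
  (* The point s joins the exceptional set because min x s has a kink there. *)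
  exists (N `|` [set s]); split.
  - by apply: measurableU.
  - by rewrite measureU0 //; exact: lebesgue_measure_set1.
  - move=> x nx; have [xs|xs] := eqVneq x s; [by right|left].
    apply: sN => /= dx; apply: nx => /=.
    have [{}xs|sx|/eqP] := ltgtP x s; last by rewrite (negbTE xs).
      rewrite /= mulr1 DF //.
      have qE : \forall k \near \oo, (h k)^-1 *: (F (h k *: 1 + x) - F x) = q k x.
        near=> k; rewrite /q /G [in X in X *: _]hE invrK [_ *: 1]mulr1 [_ + x]addrC.
        rewrite !min_l //; first exact: ltW.
        have : h k < s - x.
          by near: k; apply: (cvgr_lt _ hc); rewrite subr_gt0.
        lra.
      apply: cvg_trans (near_eq_cvg qE) _.
      apply: (iffLR (cvgr_dnbhsP (fun h : R => h^-1 *: (F (h *: 1 + x) - F x)) 0 _) dx h).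
      by split => [n|]; [rewrite gt_eqF|exact: hc].
    rewrite /= mulr0.
    have -> : q ^~ x = fun=> 0; last exact: cvg_cst.
    apply/funext => k; rewrite /q /G !min_r ?subrr ?mulr0 //; first exact: ltW.
    by have := ki0 k; lra.
have hDs := bounded_compact_lt s hD.
have iq k : Rintegral mu setT (q k) = F s.
  pose F1 x := F x * (x <= s)%R%:R.
  pose I x : R := \1_(`]s - h k, s]%classic) x.
  (* G equals F up to s and the constant F s beyond. Its increment is a translate of F1 minus F1,
     whose integrals cancel, plus F s on an interval of length [h k]; hence every [q k] integrates
     to exactly F s. *)
  have qE : q k = fun x => (h k)^-1 * (F1 (x + h k) + (F s * I x - F1 x)).
    apply/funext => x; rewrite /q hE invrK -hE; congr (_ * _).
    rewrite /G /F1 /I indicE mem_setE in_itv /=; have h0 := ki0 k.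
    rewrite !minEle; case: (leP x s) => xs; case: (leP (x + h k) s) => xhs.
    - by rewrite (_ : (s - h k < x) = false) /= ?mulr0 ?mulr1 ?add0r //; apply/negbTE; rewrite -leNgt; lra.
    - by rewrite (_ : (s - h k < x) = true) /= ?mulr0 ?mulr1 ?add0r //; lra.
    - lra.
    - by rewrite andbF !mulr0 !subrr addr0.
  have h0 := ki0 k.
  have mF1 : measurable_fun setT F1.
    apply: measurable_funM => //.
    have -> : (fun x => (x <= s)%R%:R) = \1_(`]-oo, s]%classic) :> (R -> R).
      by apply/funext => x; rewrite indicE mem_setE in_itv.
    exact: measurable_indic.
  have hF1 : bounded_compact F1 (L * (2 * `|r| + 1)) `|r|.
    split => // x; rewrite /F1; last first.
      by rewrite mulf_eq0 negb_or => /andP[/Fr xr _]; apply: le_trans xr rle.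
    rewrite normrM; apply: (@le_trans _ _ `|F x|).
      by rewrite ler_piMr //; case: (x <= s); rewrite ?normr1 ?normr0.
    have [->|/Fr xr] := eqVneq (F x) 0; first by rewrite normr0 mulr_ge0 //; lra.
    have := FL x (- `|r| - 1); rewrite (F0 (- `|r| - 1)) ?subr0; last by lra.
    move=> /le_trans; apply; apply: ler_wpM2l => //.
    by move: xr; rewrite !ler_norml => /andP[? ?]; apply/andP; split; lra.
  have hF1t : bounded_compact (fun x => F1 (x + h k)) (L * (2 * `|r| + 1)) (`|r| + 1).
    have [_ FM Fs] := hF1; split => //.
      by apply: measurableT_comp mF1 _; apply: measurable_funD.
    move=> x /Fs; rewrite !ler_norml => /andP[? ?]; have h1 := ki1 k.
    by apply/andP; split; lra.
  have hI : bounded_compact I 1 (`|s| + 1).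
    split.
    - by apply: measurable_indic.
    - by move=> x; rewrite /I indicE; case: (_ \in _); rewrite ?normr1 ?normr0.
    - move=> x; rewrite /I indicE mem_setE in_itv /=.
      have [/andP[H1 H2] _|] := boolP (s - h k < x <= s); last by rewrite eqxx.
      have h1 := ki1 k; have h2 : - `|s| <= s by rewrite lerNl -normrN ler_norm.
      by rewrite ler_norml; apply/andP; split; lra.
  have iI : Rintegral mu setT I = h k.
    rewrite /Rintegral /I integral_indic //.
    have := lebesgue_measure_itv `]s - h k, s]%R; rewrite setIT /= => ->.
    by rewrite lte_fin ifT /=; lra.
  have jF1 := bounded_compact_integrable hF1.
  have jF1t := bounded_compact_integrable hF1t.
  have jI := bounded_compact_integrable hI.
  have hFI := bounded_compactZ (F s) hI.
  have jFI := bounded_compact_integrable hFI.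
  have jFIF := integrableB measurableT jFI jF1.
  have jall := integrableD measurableT jF1t jFIF.
  rewrite qE RintegralZl //.
  rewrite RintegralD // RintegralB // (Rintegral_translate mF1) //.
  rewrite (Rintegral_bounded_compactZ _ hI) iI addrC subrK mulrC mulfK ?gt_eqF //.
have := Rintegral_dominated_cvg hq hDs hlim.
under eq_fun do rewrite iq.
move=> H; apply/esym; apply: (cvg_unique _ _ H) => //.
exact: cvg_cst.
Unshelve. all: by end_near. Qed.

End LipFTC.

Section Iint.
Variable R : realType.
Local Notation mu := (@lebesgue_measure R).
Local Notation mR := (measurableTypeR R).

Lemma Rintegral_bounded_compact (f : R -> R) M r : 0 <= r ->
  bounded_compact f M r -> `|Rintegral mu setT f| <= M * (2 * r).
Proof.
move=> r0 hf; have jf := bounded_compact_integrable hf.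
have M0 := bounded_compact_ge hf.
apply: le_trans (le_normr_Rintegral measurableT jf) _.
have hI1 : bounded_compact (fun x => \1_(`[-r, r]%classic) x : R) 1 r.
  by apply: itv_bounded_compact; rewrite ?normrN ger0_norm.
have hI := bounded_compactZ M hI1.
have jI := bounded_compact_integrable hI.
apply: (@le_trans _ _ (Rintegral mu setT (fun x => M * \1_(`[-r, r]%classic) x))).
  apply: le_Rintegral => //; first exact: integrable_norm jf.
  move=> x _ /=; have [_ fM fr] := hf.
  rewrite indicE mem_setE in_itv /= -ler_norml.
  have [_|xr] := boolP (`|x| <= r); first by rewrite mulr1.
  by rewrite mulr0; have [->|/fr] := eqVneq (f x) 0; rewrite ?normr0 // (negbTE xr).
by rewrite (Rintegral_bounded_compactZ M hI1) Rintegral_itv; [rewrite opprK mulr2n mulrDl mul1r|lra].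
Qed.

(** Adding I, a multiple of an indicator, makes the integrand nonnegative, so that Tonelli gives
    measurability; the integral of I is then subtracted. *)
Lemma measurable_Rintegral_param d (T : measurableType d) (h : T * mR -> R) (B r : R) :
  measurable_fun setT h -> (forall p, `|h p| <= B) -> (forall p, h p != 0 -> `|p.2| <= r) ->
  measurable_fun setT (fun t => Rintegral mu setT (fun s => h (t, s))).
Proof.
move=> mh hB hr.
pose I (s : mR) : R := B * \1_(`[-r, r]%classic) s.
have mI : measurable_fun setT I by apply: measurable_funM => //; apply: measurable_indic.
have hI : bounded_compact I `|B| r.
  split => //.
  - by move=> x; rewrite /I indicE; case: (_ \in _); rewrite ?mulr1 ?mulr0 ?normr0.
  - move=> x; rewrite /I indicE mem_setE in_itv /= ler_norml.
    by case: (_ && _) => //; rewrite mulr0 eqxx.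
have hh t : bounded_compact (fun s => h (t, s)) B r.
  split; [|by move=> x; exact: hB|by move=> x /hr].
  by apply: measurableT_comp mh _; apply: measurable_pair1.
have jI := bounded_compact_integrable hI.
have E : (fun t => Rintegral mu setT (fun s => h (t, s))) =
   (fun t => fine (\int[mu]_s (EFin \o (fun p : T * mR => h p + I p.2)%R) (t, s))%E
             - Rintegral mu setT I).
  apply/funext => t; have jh := bounded_compact_integrable (hh t).
  by rewrite -/(Rintegral mu setT (fun s => h (t, s) + I s)) RintegralD // addrK.
rewrite E; apply: measurable_funB => //.
apply: measurableT_comp; first exact: fine_measurable.
apply: (@measurable_fun_fubini_tonelli_F _ _ T mR R mu
  (EFin \o (fun p : T * mR => h p + I p.2)%R)).
  apply/measurable_EFinP; apply: measurable_funD => //.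
  exact: measurableT_comp mI measurable_snd.
move=> [t s] /=; rewrite lee_fin.
rewrite /I indicE mem_setE in_itv /= -ler_norml.
have [_|sr] := boolP (`|s| <= r).
  by have := hB (t, s); rewrite ler_norml mulr1 => /andP[? ?]; lra.
rewrite mulr0 addr0; have [->//|/hr] := eqVneq (h (t, s)) 0.
by rewrite /= (negbTE sr).
Qed.

(** * Iterated integrals *)

Section Exchange.
Variables (B r : R).

Definition bounded_compact2 (h : mR * mR -> R) := [/\ measurable_fun setT h,
  forall p, `|h p| <= B & forall p, h p != 0 -> `|p.1| <= r /\ `|p.2| <= r].

Lemma bounded_compact2_sec1 h t : bounded_compact2 h ->
  bounded_compact (fun s => h (t, s)) B r.
Proof.
move=> [mh hB hr]; split => //; last by move=> x /hr[].
by apply: measurableT_comp mh _; apply: measurable_pair1.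
Qed.

Lemma bounded_compact2_swap h : bounded_compact2 h ->
  bounded_compact2 (fun p => h (p.2, p.1)).
Proof.
move=> [mh hB hr]; split => //; last by move=> p /hr[].
apply: measurableT_comp mh _; apply: measurable_fun_pair.
  exact: measurable_snd.
exact: measurable_fst.
Qed.

Lemma bounded_compact2_int h : 0 <= r -> bounded_compact2 h ->
  bounded_compact (fun t => Rintegral mu setT (fun s => h (t, s))) (B * (2 * r)) r.
Proof.
move=> r0 hh; have [mh hB hr] := hh; split.
- by apply: (@measurable_Rintegral_param _ mR h B r) => // p /hr[].
- move=> t; apply: Rintegral_bounded_compact => //; exact: bounded_compact2_sec1.
- move=> t; apply: contraNT => tr.
  rewrite (_ : (fun s => h (t, s)) = fun=> 0) ?Rintegral_cst ?mul0r //.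
  apply/funext => s; have [//|/hr[]] := eqVneq (h (t, s)) 0.
  by rewrite /= (negbTE tr).
Qed.

Lemma Rintegral_exchange_ge0 h : 0 <= r -> bounded_compact2 h -> (forall p, 0 <= h p) ->
  Rintegral mu setT (fun t => Rintegral mu setT (fun s => h (t, s))) =
  Rintegral mu setT (fun s => Rintegral mu setT (fun t => h (t, s))).
Proof.
move=> r0 hh h0; have hh' := bounded_compact2_swap hh; have [mh _ _] := hh.
have E k : bounded_compact2 k ->
    Rintegral mu setT (fun t => Rintegral mu setT (fun s => k (t, s))) =
    fine (\int[mu]_t \int[mu]_s (k (t, s))%:E)%E.
  move=> hk; rewrite {1}/Rintegral; congr fine; apply: eq_integral => t _.
  rewrite /Rintegral fineK //; apply: integrable_fin_num => //.
  exact: bounded_compact_integrable (bounded_compact2_sec1 t hk).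
rewrite (E _ hh) (E _ hh'); congr fine.
apply: (fubini_tonelli (EFin \o h)) => [|p]; first exact/measurable_EFinP.
by rewrite lee_fin.
Qed.

End Exchange.

(** Tonelli applies to the positive and the negative part, which inherit the bound and the
    support. *)
Lemma Rintegral_exchange (h : mR * mR -> R) (B r : R) : 0 <= r ->
  bounded_compact2 B r h ->
  Rintegral mu setT (fun t => Rintegral mu setT (fun s => h (t, s))) =
  Rintegral mu setT (fun s => Rintegral mu setT (fun t => h (t, s))).
Proof.
move=> r0 hh.
pose pos (k : mR * mR -> R) p := Num.max (k p) 0.
pose neg (k : mR * mR -> R) p := Num.max (- k p) 0.
have hpos k : bounded_compact2 B r k -> bounded_compact2 B r (pos k).
  move=> [mk kB kr]; split => [|p|p]; first exact: measurable_maxr.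
    apply: le_trans (kB p); rewrite /pos; have [h0|h0] := leP (k p) 0; last by [].
    by rewrite normr0.
  by rewrite /pos; have [h0|h0] := leP (k p) 0; [rewrite eqxx|exact: kr].
have hneg k : bounded_compact2 B r k -> bounded_compact2 B r (neg k).
  move=> [mk kB kr]; apply: (hpos (fun p => - k p)); split => [|p|p].
  - exact: measurable_funN.
  - by rewrite normrN.
  - by rewrite oppr_eq0 => /kr.
have E k : bounded_compact2 B r k ->
    Rintegral mu setT (fun t => Rintegral mu setT (fun s => k (t, s))) =
    Rintegral mu setT (fun t => Rintegral mu setT (fun s => pos k (t, s))) -
    Rintegral mu setT (fun t => Rintegral mu setT (fun s => neg k (t, s))).
  move=> hk; have hp := hpos k hk; have hn := hneg k hk.
  have jp := bounded_compact_integrable (bounded_compact2_int r0 hp).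
  have jn := bounded_compact_integrable (bounded_compact2_int r0 hn).
  rewrite -RintegralB //; apply: eq_Rintegral => t _.
  have jp' := bounded_compact_integrable (bounded_compact2_sec1 t hp).
  have jn' := bounded_compact_integrable (bounded_compact2_sec1 t hn).
  rewrite -RintegralB //.
  apply: eq_Rintegral => s _; rewrite /pos /neg.
  by have [h0|h0] := leP (k (t, s)) 0; [rewrite max_l|rewrite max_r]; lra.
rewrite (E _ hh) (E _ (bounded_compact2_swap hh)).
rewrite (Rintegral_exchange_ge0 r0 (hpos h hh)) ?(Rintegral_exchange_ge0 r0 (hneg h hh)) //.
all: by move=> p; rewrite le_max lexx orbT.
Qed.

End Iint.

Section IintTheory.
Variable R : realType.
Local Notation mu := (@lebesgue_measure R).
Local Notation mR := (measurableTypeR R).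

Definition rowcons k (t : R) (y : 'rV[R]_k) : 'rV[R]_k.+1 :=
  row_mx (const_mx t : 'rV[R]_1) y.

Lemma rowcons0 k t (y : 'rV[R]_k) : rowcons t y 0 ord0 = t.
Proof.
rewrite /rowcons mxE; case: splitP => j /=; first by rewrite mxE.
by rewrite add1n.
Qed.

Lemma rowconsS k t (y : 'rV[R]_k) i : rowcons t y 0 (lift ord0 i) = y 0 i.
Proof.
rewrite /rowcons mxE; case: splitP => j /=.
  by rewrite (ord1 j).
by rewrite /bump /= => /eqP; rewrite eqn_add2l => /eqP /val_inj ->.
Qed.

(* Joint Borel measurability on T * R^k, tested against measurable curves so
   that no sigma-algebra on row vectors is needed. *)
Definition pborel d (T : measurableType d) k (F : T -> 'rV[R]_k -> R) : Prop :=
  forall d' (S : measurableType d') (a : S -> T) (g : S -> 'rV[R]_k),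
    measurable_fun setT a -> (forall i, measurable_fun setT (fun s => g s 0 i)) ->
    measurable_fun setT (fun s => F (a s) (g s)).

Definition borel k (f : 'rV[R]_k -> R) : Prop :=
  forall d' (S : measurableType d') (g : S -> 'rV[R]_k),
    (forall i, measurable_fun setT (fun s => g s 0 i)) ->
    measurable_fun setT (fun s => f (g s)).

(** Each induction step moves one coordinate into the parameter space, so measurability in a general
    parameter and the bound have to be proved together. *)
Lemma iint_param k : forall d (T : measurableType d) (F : T -> 'rV[R]_k -> R) (M r : R),
  0 <= M -> 0 <= r -> pborel F -> (forall t y, `|F t y| <= M) ->
  (forall t y, F t y != 0 -> forall i, `|y 0 i| <= r) ->
  measurable_fun setT (fun t => iint (F t)) /\
  forall t, `|iint (F t)| <= M * (2 * r) ^+ k.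
Proof.
elim: k => [|k IH] d T F M r M0 r0 mF FM Fr.
  split; last by move=> t; rewrite expr0 mulr1; exact: FM.
  apply: (mF _ T id (fun=> 0)).
    exact: measurable_id.
  by case.
pose F' (p : T * mR) (y : 'rV[R]_k) := F p.1 (rowcons p.2 y).
have mF' : pborel F'.
  move=> d' S a g ma mg; apply: (mF _ S (fun s => (a s).1) (fun s => rowcons (a s).2 (g s))).
    exact: measurableT_comp measurable_fst ma.
  move=> i; case: (unliftP ord0 i) => [j ->|->].
    by apply: eq_measurable_fun (mg j) => s _; rewrite rowconsS.
  apply: (@eq_measurable_fun _ _ _ _ _ (fun s => (a s).2)) => [s _|]; first by rewrite rowcons0.
  exact: measurableT_comp measurable_snd ma.
have F'M p y : `|F' p y| <= M by exact: FM.
have F'r p y : F' p y != 0 -> forall i, `|y 0 i| <= r.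
  by move=> /Fr h i; have := h (lift ord0 i); rewrite rowconsS.
have [mI bI] := IH _ _ F' M r M0 r0 mF' F'M F'r.
have supp p : iint (F' p) != 0 -> `|p.2| <= r.
  apply: contraNT => pr; rewrite (_ : F' p = fun=> 0).
    apply/eqP; elim: (k) => //= m IHm.
    by rewrite (_ : (fun _ : R => _) = fun=> 0) ?Rintegral_cst ?mul0r //; apply/funext.
  apply/funext => y; have [//|/Fr/(_ ord0)] := eqVneq (F' p y) 0.
  by rewrite rowcons0 (negbTE pr).
split; first exact: (measurable_Rintegral_param (r := r) mI bI supp).
move=> t; rewrite exprSr mulrA.
apply: (@Rintegral_bounded_compact R (fun s => iint (F' (t, s)))) => //; split => //.
  by apply: measurableT_comp mI _; apply: measurable_pair1.
by move=> x /supp.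
Qed.

(** A class closed under slices and under integrating out a variable. On it every intermediate
    integral of [iint] is a finite Lebesgue integral, so the induction on the dimension never meets
    a default value. *)
Definition integrand k (f : 'rV[R]_k -> R) : Prop :=
  exists M r : R, [/\ 0 <= M, 0 <= r, borel f, forall x, `|f x| <= M &
    forall x, f x != 0 -> forall i, `|x 0 i| <= r].

Lemma borel_slice k (f : 'rV[R]_k.+1 -> R) : borel f ->
  pborel (fun (t : mR) y => f (rowcons t y)).
Proof.
move=> bf d' S a g ma mg; apply: bf => i; case: (unliftP ord0 i) => [j ->|->].
  by apply: eq_measurable_fun (mg j) => s _; rewrite rowconsS.
by apply: eq_measurable_fun ma => s _; rewrite rowcons0.
Qed.

Lemma iint0 k : iint (fun _ : 'rV[R]_k => 0) = 0.
Proof.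
elim: k => //= m IH.
by rewrite (_ : (fun _ : R => _) = fun=> 0) ?Rintegral_cst ?mul0r //; apply/funext.
Qed.

Lemma iintS k (f : 'rV[R]_k.+1 -> R) :
  iint f = Rintegral mu setT (fun t => iint (fun y => f (rowcons t y))).
Proof. by []. Qed.

Lemma integrand_slice k (f : 'rV[R]_k.+1 -> R) t : integrand f ->
  integrand (fun y => f (rowcons t y)).
Proof.
move=> [M [r [M0 r0 bf fM fr]]]; exists M, r; split => //.
- move=> d S g mg; apply: (borel_slice bf (a := fun=> t)) => //.
- by move=> y /fr h i; have := h (lift ord0 i); rewrite rowconsS.
Qed.

Lemma integrand_iint k (f : 'rV[R]_k.+1 -> R) : integrand f ->
  exists M r, bounded_compact (fun t => iint (fun y => f (rowcons t y))) M r.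
Proof.
move=> [M [r [M0 r0 bf fM fr]]]; exists (M * (2 * r) ^+ k), r.
have [|mI bI] := @iint_param k _ mR (fun t y => f (rowcons t y)) M r M0 r0 (borel_slice bf)
    (fun t y => fM _).
  by move=> t y /fr h i; have := h (lift ord0 i); rewrite rowconsS.
split => // t; apply: contraNT => tr.
rewrite (_ : (fun y => _) = fun=> 0) ?iint0 //.
apply/funext => y; have [//|/fr/(_ ord0)] := eqVneq (f (rowcons t y)) 0.
by rewrite rowcons0 (negbTE tr).
Qed.

Lemma integrand_iint_integrable k (f : 'rV[R]_k.+1 -> R) : integrand f ->
  mu.-integrable setT (EFin \o (fun t => iint (fun y => f (rowcons t y)))).
Proof. by move=> /integrand_iint[M [r /bounded_compact_integrable]]. Qed.

Lemma iint_le k (f g : 'rV[R]_k -> R) : integrand f -> integrand g ->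
  (forall x, f x <= g x) -> iint f <= iint g.
Proof.
elim: k f g => [|k IH] f g hf hg fg; first exact: fg.
rewrite !iintS; apply: le_Rintegral => //; try exact: integrand_iint_integrable.
by move=> t _; apply: IH; [exact: integrand_slice|exact: integrand_slice|].
Qed.

Lemma eq_iint k (f g : 'rV[R]_k -> R) : f =1 g -> iint f = iint g.
Proof. by move=> fg; congr iint; apply/funext. Qed.

Lemma borel_comp1 k (h : R -> R) (f : 'rV[R]_k -> R) :
  measurable_fun setT h -> borel f -> borel (fun x => h (f x)).
Proof. by move=> mh bf d S g mg; apply: measurableT_comp mh _; apply: bf. Qed.

Lemma borel_cst k (c : R) : borel (fun _ : 'rV[R]_k => c).
Proof. by move=> d S g mg; apply: measurable_cst. Qed.

Lemma borelD k (f g : 'rV[R]_k -> R) : borel f -> borel g -> borel (fun x => f x + g x).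
Proof. by move=> bf bg d S h mh; apply: measurable_funD; [exact: bf|exact: bg]. Qed.

Lemma borelB k (f g : 'rV[R]_k -> R) : borel f -> borel g -> borel (fun x => f x - g x).
Proof. by move=> bf bg d S h mh; apply: measurable_funB; [exact: bf|exact: bg]. Qed.

Lemma borelM k (f g : 'rV[R]_k -> R) : borel f -> borel g -> borel (fun x => f x * g x).
Proof. by move=> bf bg d S h mh; apply: measurable_funM; [exact: bf|exact: bg]. Qed.

Lemma borel_coord k (i : 'I_k) : borel (fun x : 'rV[R]_k => x 0 i).
Proof. by move=> d S g mg. Qed.

Lemma borel_sum k (I : Type) (s : seq I) (f : I -> 'rV[R]_k -> R) :
  (forall i, borel (f i)) -> borel (fun x => \sum_(i <- s) f i x).
Proof.
move=> bf d S g mg; apply: measurable_sum => i; exact: bf.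
Qed.

Lemma integrandD k (f g : 'rV[R]_k -> R) : integrand f -> integrand g ->
  integrand (fun x => f x + g x).
Proof.
move=> [M [r [M0 r0 bf fM fr]]] [M' [r' [M0' r0' bg gM gr]]].
exists (M + M'), (Num.max r r'); split.
- exact: addr_ge0.
- by rewrite le_max r0.
- exact: borelD.
- by move=> x; apply: le_trans (ler_normD _ _) _; apply: lerD.
- move=> x h i; rewrite le_max.
  have [fx|/fr/(_ i) -> //] := eqVneq (f x) 0.
  by move: h; rewrite fx add0r => /gr/(_ i) ->; rewrite orbT.
Qed.

Lemma integrandM k (f g : 'rV[R]_k -> R) : integrand f -> borel g ->
  (forall r : R, exists M : R, forall x : 'rV[R]_k, (forall i, `|x 0 i| <= r) -> `|g x| <= M) ->
  integrand (fun x => f x * g x).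
Proof.
move=> [M [r [M0 r0 bf fM fr]]] bg gb; have [M' gM] := gb r.
exists (M * `|M'|), r; split => //.
- exact: mulr_ge0.
- exact: borelM.
- move=> x; have [->|fx] := eqVneq (f x) 0; first by rewrite mul0r normr0 mulr_ge0.
  rewrite normrM; apply: ler_pM => //; apply: le_trans (ler_norm _); apply: gM; exact: fr.
- by move=> x; rewrite mulf_eq0 negb_or => /andP[/fr].
Qed.

Lemma integrandZ k c (f : 'rV[R]_k -> R) : integrand f -> integrand (fun x => c * f x).
Proof.
move=> hf; have := integrandM hf (borel_cst c) _.
rewrite (_ : (fun x => f x * c) = fun x => c * f x); last by apply/funext => x; rewrite mulrC.
by apply => r; exists `|c|.
Qed.

Lemma integrandB k (f g : 'rV[R]_k -> R) : integrand f -> integrand g ->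
  integrand (fun x => f x - g x).
Proof.
move=> hf /(integrandZ (-1)) hg; have := integrandD hf hg.
by congr integrand; apply/funext => x; rewrite mulN1r.
Qed.

Lemma iintZ k c (f : 'rV[R]_k -> R) : integrand f ->
  iint (fun x => c * f x) = c * iint f.
Proof.
elim: k f => [|k IH] f hf //.
rewrite !iintS -RintegralZl //; last exact: integrand_iint_integrable.
by apply: eq_Rintegral => t _; rewrite -IH //; exact: integrand_slice.
Qed.

Lemma iintD k (f g : 'rV[R]_k -> R) : integrand f -> integrand g ->
  iint (fun x => f x + g x) = iint f + iint g.
Proof.
elim: k f g => [|k IH] f g hf hg //.
rewrite !iintS -RintegralD //; try exact: integrand_iint_integrable.
by apply: eq_Rintegral => t _; rewrite -IH //; exact: integrand_slice.
Qed.

Lemma iintB k (f g : 'rV[R]_k -> R) : integrand f -> integrand g ->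
  iint (fun x => f x - g x) = iint f - iint g.
Proof.
move=> hf hg; rewrite -mulN1r -iintZ // -iintD //; last exact: integrandZ.
by apply: eq_iint => x; rewrite mulN1r.
Qed.

End IintTheory.

Section IintFubini.
Variable R : realType.
Local Notation mu := (@lebesgue_measure R).
Local Notation mR := (measurableTypeR R).

Lemma integrand0 k : integrand (fun _ : 'rV[R]_k => 0).
Proof.
exists 0, 0; split; [by []|by []|exact: borel_cst|by move=> x; rewrite normr0|].
by move=> x; rewrite eqxx.
Qed.

Lemma iint_ge0 k (f : 'rV[R]_k -> R) : integrand f -> (forall x, 0 <= f x) -> 0 <= iint f.
Proof. by move=> hf f0; rewrite -(iint0 R k); apply: iint_le => //; exact: integrand0. Qed.

Lemma measurable_rowcons d (S : measurableType d) k (a : S -> R) (g : S -> 'rV[R]_k) :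
  measurable_fun setT a -> (forall i, measurable_fun setT (fun s => g s 0 i)) ->
  forall i, measurable_fun setT (fun s => rowcons (a s) (g s) 0 i).
Proof.
move=> ma mg i; case: (unliftP ord0 i) => [j ->|->].
  by apply: eq_measurable_fun (mg j) => s _; rewrite rowconsS.
by apply: eq_measurable_fun ma => s _; rewrite rowcons0.
Qed.

Lemma integrand_int0 k (f : 'rV[R]_k.+1 -> R) : integrand f ->
  integrand (fun y => Rintegral mu setT (fun t => f (rowcons t y))).
Proof.
move=> [M [r [M0 r0 bf fM fr]]]; exists (M * (2 * r)), r; split => //.
- by rewrite !mulr_ge0.
- move=> d S g mg.
  apply: (@measurable_Rintegral_param R _ S (fun p => f (rowcons p.2 (g p.1))) M r).
  + apply: bf; apply: measurable_rowcons => [|i]; first exact: measurable_snd.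
    exact: measurableT_comp (mg i) measurable_fst.
  + by move=> p; exact: fM.
  + by move=> p /fr/(_ ord0); rewrite rowcons0.
- move=> y; apply: Rintegral_bounded_compact => //; split => //.
    by apply: (borel_slice bf (a := id) (g := fun=> y)) => //; exact: measurable_id.
  by move=> t /fr/(_ ord0); rewrite rowcons0.
- move=> y nz i; apply: contraNT nz => yi.
  rewrite (_ : (fun t => _) = fun=> 0) ?Rintegral_cst ?mul0r //.
  apply/funext => t; have [//|/fr/(_ (lift ord0 i))] := eqVneq (f (rowcons t y)) 0.
  by rewrite rowconsS (negbTE yi).
Qed.

(** Fubini exchanges the first two variables; the induction hypothesis, applied with the second one
    frozen, then moves the first past all the others. *)
Lemma iint_exchange k (f : 'rV[R]_k.+1 -> R) : integrand f ->
  iint f = iint (fun y => Rintegral mu setT (fun t => f (rowcons t y))).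
Proof.
rewrite iintS; elim: k f => [|k IH] f hf //.
have [M [r [M0 r0 bf fM fr]]] := hf.
pose F (p : mR * mR) z := f (rowcons p.1 (rowcons p.2 z)).
have pF : pborel F.
  move=> d S a g ma mg; apply: bf; apply: measurable_rowcons => [|i].
    exact: measurableT_comp measurable_fst ma.
  by apply: measurable_rowcons => //; exact: measurableT_comp measurable_snd ma.
have [|mI bI] := @iint_param R k _ _ F M r M0 r0 pF (fun _ _ => fM _).
  move=> p z /fr h i; have := h (lift ord0 (lift ord0 i)).
  by rewrite !rowconsS.
have hI : bounded_compact2 (M * (2 * r) ^+ k) r (fun p => iint (F p)).
  split => // p; have [Fp0|/existsNP[z /eqP /fr h] _] := pselect (forall z, F p z = 0).
    by rewrite (_ : F p = fun=> 0) ?iint0 ?eqxx //; exact/funext.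
  by split; [have := h ord0|have := h (lift ord0 ord0)]; rewrite ?rowconsS rowcons0.
transitivity (Rintegral mu setT (fun t => Rintegral mu setT (fun s => iint (F (t, s))))).
  by [].
rewrite (Rintegral_exchange r0 hI) iintS; apply: eq_Rintegral => s _.
pose fs (x : 'rV[R]_k.+1) := f (rowcons (x 0 ord0) (rowcons s (\row_i x 0 (lift ord0 i)))).
have fsE t z : fs (rowcons t z) = f (rowcons t (rowcons s z)).
  rewrite /fs rowcons0; congr (f (rowcons _ (rowcons _ _))).
  by apply/rowP => i; rewrite mxE rowconsS.
have hfs : integrand fs.
  exists M, r; split => //; last 2 first.
  - by move=> x; exact: fM.
  - move=> x /fr h i; case: (unliftP ord0 i) => [j ->|->].
      by have := h (lift ord0 (lift ord0 j)); rewrite !rowconsS mxE.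
    by have := h ord0; rewrite rowcons0.
  - move=> d S g mg; apply: bf; apply: measurable_rowcons => // i.
    apply: measurable_rowcons => // j.
    by apply: eq_measurable_fun (mg (lift ord0 j)) => ? _; rewrite mxE.
transitivity (Rintegral mu setT (fun t => iint (fun y => fs (rowcons t y)))).
  by apply: eq_Rintegral => t _; apply: eq_iint => z; rewrite fsE.
rewrite IH //; apply: eq_iint => z; apply: eq_Rintegral => t _; exact: fsE.
Qed.

Definition upd k (x : 'rV[R]_k) (i : 'I_k) (s : R) : 'rV[R]_k :=
  \row_j if j == i then s else x 0 j.

Lemma updE k (x : 'rV[R]_k) i s : upd x i s 0 i = s.
Proof. by rewrite mxE eqxx. Qed.

Lemma updN k (x : 'rV[R]_k) i s j : j != i -> upd x i s 0 j = x 0 j.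
Proof. by move=> ji; rewrite mxE (negbTE ji). Qed.

Lemma upd_upd k (x : 'rV[R]_k) i s t : upd (upd x i s) i t = upd x i t.
Proof. by apply/rowP => j; rewrite !mxE; case: eqP. Qed.

Lemma upd_id k (x : 'rV[R]_k) i : upd x i (x 0 i) = x.
Proof. by apply/rowP => j; rewrite !mxE; case: eqP => // ->. Qed.

Lemma upd_addE k (x : 'rV[R]_k) i h : upd x i (x 0 i + h) = h *: delta_mx 0 i + x.
Proof.
apply/rowP => j; rewrite !mxE eqxx /=; case: eqP => [->|_].
  by rewrite mulr1 addrC.
by rewrite mulr0 add0r.
Qed.

Lemma upd_rowcons0 k t (y : 'rV[R]_k) s : upd (rowcons t y) ord0 s = rowcons s y.
Proof.
apply/rowP => j; rewrite mxE; case: eqP => [->|/eqP]; first by rewrite rowcons0.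
by case: (unliftP ord0 j) => [i ->|->]; rewrite ?eqxx // !rowconsS.
Qed.

Lemma upd_rowconsS k t (y : 'rV[R]_k) i s :
  upd (rowcons t y) (lift ord0 i) s = rowcons t (upd y i s).
Proof.
apply/rowP => j; rewrite mxE; case: (unliftP ord0 j) => [l ->|->].
  by rewrite (inj_eq lift_inj) !rowconsS mxE.
by rewrite !rowcons0.
Qed.

(** The form in which Fubini is used below: coordinate i may be integrated first, so a comparison on
    every line parallel to that axis suffices. Used in both directions it gives equalities. *)
Lemma iint_line_le k (i : 'I_k) (f g : 'rV[R]_k -> R) : integrand f -> integrand g ->
  (forall x, Rintegral mu setT (fun s => f (upd x i s)) <=
             Rintegral mu setT (fun s => g (upd x i s))) ->
  iint f <= iint g.
Proof.
elim: k i f g => [|k IH] i f g hf hg fg; first by case: i {fg}.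
move: fg; case: (unliftP ord0 i) => [j ->|->] fg.
  rewrite !iintS; apply: le_Rintegral => //; try exact: integrand_iint_integrable.
  move=> t _; apply: (IH j); try exact: integrand_slice.
  move=> y; have := fg (rowcons t y).
  by congr (_ <= _); apply: eq_Rintegral => s _; rewrite upd_rowconsS.
rewrite !iint_exchange //; apply: iint_le; try exact: integrand_int0.
move=> y; have := fg (rowcons 0 y).
by congr (_ <= _); apply: eq_Rintegral => s _; rewrite upd_rowcons0.
Qed.

Lemma iint_translate k (i : 'I_k) tau (f : 'rV[R]_k -> R) : integrand f ->
  integrand (fun x => f (tau *: delta_mx 0 i + x)) /\
  iint (fun x => f (tau *: delta_mx 0 i + x)) = iint f.
Proof.
move=> hf; have [M [r [M0 r0 bf fM fr]]] := hf.
have hft : integrand (fun x => f (tau *: delta_mx 0 i + x)).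
  exists M, (r + `|tau|); split => //.
  - exact: addr_ge0.
  - move=> d S g mg; apply: bf => j.
    under eq_fun do rewrite !mxE; apply: measurable_funD => //; exact: mg.
  - move=> x /fr h j; have := h j; rewrite !mxE eqxx /=.
    rewrite -[X in _ -> `|X| <= _](addKr (tau * (j == i)%:R)) => {}h.
    apply: le_trans (ler_normD _ _) _; rewrite addrC; apply: lerD => //.
    by rewrite normrN normrM ler_piMr //; case: (_ == _); rewrite ?normr1 ?normr0.
split => //.
have E x : Rintegral mu setT (fun s => f (tau *: delta_mx 0 i + upd x i s)) =
           Rintegral mu setT (fun s => f (upd x i s)).
  have mfu : measurable_fun setT (fun s : mR => f (upd x i s)).
    apply: bf => j; under eq_fun do rewrite mxE; case: (j == i); [exact: measurable_id|exact: measurable_cst].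
  rewrite (_ : (fun s => _) = (fun s => (fun s => f (upd x i s)) (s + tau))); last first.
    by apply/funext => s; rewrite -upd_addE updE upd_upd.
  apply: (Rintegral_translate (f := fun s => f (upd x i s))) => //.
  apply: (@bounded_compact_integrable _ _ M (r + `|tau|)); split => //.
    by apply: measurableT_comp mfu _; apply: measurable_funD.
  move=> s /fr/(_ i); rewrite updE => h.
  rewrite -[s](addrK tau); apply: le_trans (ler_normD _ _) _.
  by rewrite normrN lerD.
by apply/eqP; rewrite eq_le; apply/andP; split; apply: (iint_line_le (i := i)) => // x; rewrite E.
Qed.

Lemma Rintegral0_exists (h : R -> R) M r a b : bounded_compact h M r ->
  (forall t, 0 <= h t) -> Rintegral mu setT h = 0 -> a < b ->
  exists t, a < t < b /\ h t = 0.
Proof.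
move=> hh h0 ih ab; have jh := bounded_compact_integrable hh; have [mh _ _] := hh.
have ih0 : (\int[mu]_x `|(EFin \o h) x| = 0)%E.
  rewrite -[RHS](_ : (Rintegral mu setT h)%:E = 0%E); last by rewrite ih.
  rewrite /Rintegral fineK; last exact: integrable_fin_num.
  by apply: eq_integral => x _ /=; rewrite ger0_norm.
have mEh : measurable_fun setT (EFin \o h) by exact/measurable_EFinP.
have [N [mN N0 sN]] := iffLR (ae_eq_integral_abs mu measurableT mEh) ih0.
apply: contrapT => /forallNP nex.
have : (mu `]a, b[%classic <= mu N)%E.
  have mI : measurable (`]a, b[%classic : set mR) by exact: measurable_itv.
  apply: le_measure; rewrite ?inE //=.
  move=> t /=; rewrite in_itv /= => tab; apply: sN => /= ht.
  by apply: (nex t); split => //; have [] := ht I.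
rewrite N0; have := lebesgue_measure_itv `]a, b[%R => /= ->.
by rewrite lte_fin ab -EFinD lee_fin; lra.
Qed.

Lemma iint0_point k (f : 'rV[R]_k -> R) (a b : 'rV[R]_k) : integrand f ->
  (forall x, 0 <= f x) -> iint f = 0 -> (forall j, a 0 j < b 0 j) ->
  exists x : 'rV[R]_k, (forall j, a 0 j < x 0 j < b 0 j) /\ f x = 0.
Proof.
elim: k f a b => [|k IH] f a b hf f0 if0 ab.
  by exists 0; split => //; case.
have [M [r hb]] := integrand_iint hf.
have ge0 t : 0 <= iint (fun y => f (rowcons t y)).
  by apply: iint_ge0 => //; exact: integrand_slice.
have [t [tab ht]] := Rintegral0_exists hb ge0 if0 (ab ord0).
have [|y [yab fy]] := IH (fun y => f (rowcons t y)) (\row_i a 0 (lift ord0 i))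
  (\row_i b 0 (lift ord0 i)) (integrand_slice t hf) (fun _ => f0 _) ht.
  by move=> j; rewrite !mxE.
exists (rowcons t y); split => // j; case: (unliftP ord0 j) => [i ->|->].
  by have h := yab i; rewrite !mxE in h; rewrite rowconsS.
by rewrite rowcons0.
Qed.

(** Turns an almost everywhere statement into one about lines: as close as desired to any given line
    there is a parallel one on which f integrates to zero. *)
Lemma iint0_line k (i : 'I_k) (f : 'rV[R]_k -> R) (a b : 'rV[R]_k) : integrand f ->
  (forall x, 0 <= f x) -> iint f = 0 -> (forall j, a 0 j < b 0 j) ->
  exists x : 'rV[R]_k, (forall j, a 0 j < x 0 j < b 0 j) /\
    Rintegral mu setT (fun s => f (upd x i s)) = 0.
Proof.
elim: k i f a b => [|k IH] i f a b hf f0 if0 ab; first by case: i.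
have [M [r hb]] := integrand_iint hf.
pose a' : 'rV[R]_k := \row_i a 0 (lift ord0 i); pose b' : 'rV[R]_k := \row_i b 0 (lift ord0 i).
have ab' j : a' 0 j < b' 0 j by rewrite !mxE.
have cons t (y : 'rV[R]_k) : a 0 ord0 < t < b 0 ord0 -> (forall j, a' 0 j < y 0 j < b' 0 j) ->
    forall j, a 0 j < rowcons t y 0 j < b 0 j.
  move=> tab yab j; case: (unliftP ord0 j) => [l ->|->]; last by rewrite rowcons0.
  by have h := yab l; rewrite !mxE in h; rewrite rowconsS.
case: (unliftP ord0 i) => [j ->|->].
  have ge0 t : 0 <= iint (fun y => f (rowcons t y)).
    by apply: iint_ge0 => //; exact: integrand_slice.
  have [t [tab ht]] := Rintegral0_exists hb ge0 if0 (ab ord0).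
  have [y [yab fy]] := IH j _ a' b' (integrand_slice t hf) (fun _ => f0 _) ht ab'.
  exists (rowcons t y); split; first exact: cons.
  by rewrite -[RHS]fy; apply: eq_Rintegral => s _; rewrite upd_rowconsS.
rewrite iint_exchange // in if0.
have [|y [yab fy]] := iint0_point (integrand_int0 hf) _ if0 ab'.
  by move=> y; apply: Rintegral_ge0.
exists (rowcons ((a 0 ord0 + b 0 ord0) / 2) y); split.
  by apply: cons => //; have abo := ab ord0; apply/andP; split; lra.
by rewrite -[RHS]fy; apply: eq_Rintegral => s _; rewrite upd_rowcons0.
Qed.

End IintFubini.

(** * Borel sets and Borel functions on row vectors *)

Section BorelFunctions.
Variable R : realType.

Definition borel_set k (A : set 'rV[R]_k) : Prop :=
  forall d' (S : measurableType d') (g : S -> 'rV[R]_k),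
    (forall i, measurable_fun setT (fun s => g s 0 i)) -> measurable (g @^-1` A).

Lemma borel_indic k (A : set 'rV[R]_k) : borel_set A -> borel (fun x => \1_A x : R).
Proof.
move=> bA d S g mg.
rewrite (_ : (fun s => _) = (\1_(g @^-1` A) : S -> R)).
  apply: measurable_indic; exact: bA.
by apply/funext => s; rewrite !indicE.
Qed.

Lemma borel_set_le k (f : 'rV[R]_k -> R) c : borel f -> borel_set [set x | f x <= c].
Proof.
move=> bf d S g mg; have := bf _ S g mg => /(_ measurableT _ (measurable_itv `]-oo, c])).
rewrite setTI; congr measurable; apply/seteqP; split => s /=; rewrite in_itv //=.
Qed.

Lemma borel_setC k (A : set 'rV[R]_k) : borel_set A -> borel_set (~` A).
Proof. by move=> bA d S g mg; apply: measurableC; apply: bA. Qed.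

Lemma borel_setU k (A B : set 'rV[R]_k) : borel_set A -> borel_set B -> borel_set (A `|` B).
Proof. by move=> bA bB d S g mg; apply: measurableU; [apply: bA|apply: bB]. Qed.

Lemma borel_setI k (A B : set 'rV[R]_k) : borel_set A -> borel_set B -> borel_set (A `&` B).
Proof. by move=> bA bB d S g mg; apply: measurableI; [apply: bA|apply: bB]. Qed.

Lemma borel_bigcap k (A : nat -> set 'rV[R]_k) : (forall n, borel_set (A n)) ->
  borel_set [set x | forall n, A n x].
Proof.
move=> bA d S g mg; rewrite (_ : _ @^-1` _ = \bigcap_n (g @^-1` A n)).
  by apply: bigcapT_measurable => n; apply: bA.
by apply/seteqP; split => s /= h n; [move=> _|]; apply: h.
Qed.

Lemma borel_bigcup k (A : nat -> set 'rV[R]_k) : (forall n, borel_set (A n)) ->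
  borel_set [set x | exists n, A n x].
Proof.
move=> bA d S g mg; rewrite (_ : _ @^-1` _ = \bigcup_n (g @^-1` A n)).
  by apply: bigcup_measurable => n _; apply: bA.
by apply/seteqP; split => s /= [n]; [exists n|move=> _ h; exists n].
Qed.

Lemma borel_set_cst k (P : Prop) : borel_set [set _ : 'rV[R]_k | P].
Proof.
move=> d S g mg; have [p|np] := pselect P.
  by rewrite (_ : _ @^-1` _ = setT) //; apply/seteqP; split.
by rewrite (_ : _ @^-1` _ = set0) //; apply/seteqP; split.
Qed.

Lemma borel_cvg k (f_ : nat -> 'rV[R]_k -> R) f : (forall n, borel (f_ n)) ->
  (forall x, f_ n x @[n --> \oo] --> f x) -> borel f.
Proof.
move=> bf cf d S g mg; apply: (measurable_fun_cvg (h := fun n s => f_ n (g s))).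
  by move=> n; apply: bf.
by move=> s _; apply: cf.
Qed.

Definition l1 k (x : 'rV[R]_k) : R := \sum_i `|x 0 i|.

Lemma l1_ge0 k (x : 'rV[R]_k) : 0 <= l1 x.
Proof. by apply: sumr_ge0. Qed.

Lemma l1_coord k (x : 'rV[R]_k) i : `|x 0 i| <= l1 x.
Proof. by rewrite /l1 (bigD1 i) //= lerDl sumr_ge0. Qed.

Lemma l1_le k (x : 'rV[R]_k) (r : R) : (forall i, `|x 0 i| <= r) -> l1 x <= k%:R * r.
Proof.
move=> xr; rewrite -[k in k%:R]card_ord mulr_natl -sumr_const.
by apply: ler_sum => i _; exact: xr.
Qed.

Lemma borel_l1 k (q : 'rV[R]_k) : borel (fun x => l1 (x - q)).
Proof.
apply: borel_sum => i; apply: (borel_comp1 (h := fun t => `|t|)).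
  exact: normr_measurable.
move=> d S g mg; under eq_fun do rewrite !mxE.
by apply: measurable_funB => //; exact: mg.
Qed.

Definition rats (n : nat) : R := ratr (odflt 0 (unpickle n)).

Lemma rats_dense (a b : R) : a < b -> exists n, a < rats n < b.
Proof.
move=> /rat_in_itvoo[q]; rewrite in_itv /= => qab.
by exists (pickle q); rewrite /rats pickleK.
Qed.

Definition ratvec k (n : nat) : 'rV[R]_k := map_mx ratr (odflt (0 : 'rV[rat]_k) (unpickle n)).

Lemma ratvec_dense k (x : 'rV[R]_k) (e : R) : 0 < e -> exists n, l1 (x - ratvec k n) <= e.
Proof.
move=> e0; have e1 : 0 < e / k.+1%:R by rewrite divr_gt0.
have /choice[q qP] (i : 'I_k) : exists q : rat, `|x 0 i - ratr q| <= e / k.+1%:R.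
  move: (e / _) e1 => e' e1.
  have /rat_in_itvoo[q] : x 0 i - e' < x 0 i by rewrite ltrBlDr ltrDl.
  rewrite in_itv /= => /andP[qa qb]; exists q.
  by rewrite ger0_norm; lra.
exists (pickle (\row_i q i)); rewrite /ratvec pickleK /=.
apply: (@le_trans _ _ (\sum_(i < k) e / k.+1%:R)).
  by apply: ler_sum => i _; rewrite !mxE; exact: qP.
rewrite sumr_const card_ord -[_ *+ k]mulr_natr -mulrA; apply: ler_piMr; first exact: ltW.
by rewrite ler_pdivrMl // mulr1 ler_nat.
Qed.

(** A Lipschitz function is the infimum of the countably many cones of slope L with apex on its
    graph over a rational point. *)
Lemma lipschitz_borel k (f : 'rV[R]_k -> R) L : 0 <= L ->
  (forall x y, `|f x - f y| <= L * l1 (x - y)) -> borel f.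
Proof.
move=> L0 fL.
pose h n x := f (ratvec k n) + L * l1 (x - ratvec k n).
have fh n x : f x <= h n x.
  have := fL x (ratvec k n); rewrite /h ler_norml => /andP[_]; lra.
have bh n : borel (h n).
  by apply: borelD; [exact: borel_cst|apply: borelM; [exact: borel_cst|exact: borel_l1]].
move=> d S g mg.
apply: (@eq_measurable_fun _ _ _ _ _ (fun s => infs (fun n => h n (g s)) 0)); last first.
  apply: (@measurable_fun_infs _ _ _ _ (fun n s => h n (g s))) => [s _|n].
    by exists (f (g s)) => _ [n _ <-].
  exact: bh.
move=> s _; rewrite /infs /=.
set A := sdrop _ _.
have AE : A = [set h n (g s) | n in setT].
  by apply/seteqP; split => _ [n _ <-]; exists n.
have A0 : A !=set0 by rewrite AE; exists (h 0%N (g s)); exists 0%N.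
have lbA : lbound A (f (g s)) by rewrite AE => _ [n _ <-].
apply/eqP; rewrite eq_le; apply/andP; split; last exact: lb_le_inf.
apply/ler_addgt0Pr => e e0.
(* Passing to the apex costs L times the distance twice, once for f and once for the cone; the added
   1 keeps the denominator positive. *)
have e1 : 0 < e / (2 * L + 1) by rewrite divr_gt0 //; lra.
have [n hn] := ratvec_dense (g s) e1.
apply: (@le_trans _ _ (h n (g s))).
  by apply: ge_inf; [exists (f (g s))|rewrite AE; exists n].
have := fL (g s) (ratvec k n); rewrite ler_norml => /andP[h1 _].
have h2 : L * l1 (g s - ratvec k n) <= L * (e / (2 * L + 1)) by apply: ler_wpM2l.
have h3 : 2 * (L * (e / (2 * L + 1))) <= e.
  rewrite !mulrA ler_pdivrMr; last by lra.
  nra.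
rewrite /h; lra.
Qed.

End BorelFunctions.

(** * Locally Lipschitz functions and their partial derivatives *)

Section LocLip.
Variable R : realType.

Definition in_cube k (r : R) (x : 'rV[R]_k) := forall i, `|x 0 i| <= r.

(* Locally Lipschitz functions, with one constant per cube. *)
Definition llip k (f : 'rV[R]_k -> R) : Prop := forall r : R, exists L : R,
  0 <= L /\ forall x y, in_cube r x -> in_cube r y -> `|f x - f y| <= L * l1 (x - y).

Definition llip1 (f : R -> R) : Prop := forall r : R, exists L : R,
  0 <= L /\ forall x y, `|x| <= r -> `|y| <= r -> `|f x - f y| <= L * `|x - y|.

(** For r >= 0 this is the retraction onto the interval from -r to r; composing with it makes a
    locally Lipschitz function globally Lipschitz and leaves it unchanged there. *)
Definition clip1 (r s : R) : R := Num.max (- r) (Num.min r s).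

Lemma max_lip (s a b : R) : `|Num.max a s - Num.max b s| <= `|a - b|.
Proof.
have h1 := ler_norm (a - b); have h2 := ler_norm (b - a); rewrite distrC in h2.
have h3 := normr_ge0 (a - b).
by rewrite ler_norml !maxEle; case: (leP a s) => ?; case: (leP b s) => ?;
  apply/andP; split; lra.
Qed.

Lemma min_lip (s a b : R) : `|Num.min a s - Num.min b s| <= `|a - b|.
Proof.
rewrite -[Num.min a s]opprK -[Num.min b s]opprK !oppr_min -opprD normrN.
by apply: le_trans (max_lip _ _ _) _; rewrite -opprD normrN.
Qed.

Lemma clip1_lip r s t : `|clip1 r s - clip1 r t| <= `|s - t|.
Proof.
rewrite /clip1 ![Num.max (- r) _]maxC ![Num.min r _]minC.
exact: le_trans (max_lip _ _ _) (min_lip _ _ _).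
Qed.

Lemma clip1_bound r s : 0 <= r -> `|clip1 r s| <= r.
Proof.
move=> r0; rewrite ler_norml /clip1 !maxEle !minEle.
by case: (leP r s) => ?; case: (leP (- r) r) => ?; case: (leP (- r) s) => ?;
  apply/andP; split; lra.
Qed.

Lemma clip1_id r s : `|s| <= r -> clip1 r s = s.
Proof.
rewrite ler_norml => /andP[? ?]; rewrite /clip1 maxEle minEle.
by case: (leP r s) => ?; case: (leP (- r) r) => ?; case: (leP (- r) s) => ?;
  apply/eqP; rewrite eq_le; apply/andP; split; lra.
Qed.

Definition clip k r (x : 'rV[R]_k) : 'rV[R]_k := \row_i clip1 r (x 0 i).

Lemma clip_cube k r (x : 'rV[R]_k) : 0 <= r -> in_cube r (clip r x).
Proof. by move=> r0 i; rewrite mxE clip1_bound. Qed.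

Lemma clip_id k r (x : 'rV[R]_k) : in_cube r x -> clip r x = x.
Proof. by move=> xr; apply/rowP => i; rewrite mxE clip1_id. Qed.

Lemma clip_l1 k r (x y : 'rV[R]_k) : l1 (clip r x - clip r y) <= l1 (x - y).
Proof. by apply: ler_sum => i _; rewrite !mxE clip1_lip. Qed.

Lemma in_cube_l1 k (x : 'rV[R]_k) : in_cube (l1 x) x.
Proof. by move=> i; exact: l1_coord. Qed.

Lemma in_cubeW k r r' (x : 'rV[R]_k) : r <= r' -> in_cube r x -> in_cube r' x.
Proof. by move=> rr xr i; apply: le_trans (xr i) rr. Qed.

Lemma in_cube_near k (x y : 'rV[R]_k) (d : R) : (forall i, `|y 0 i - x 0 i| <= d) -> in_cube (l1 x + d) y.
Proof.
move=> yx i; rewrite -[y 0 i](subrK (x 0 i)) addrC.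
by apply: le_trans (ler_normD _ _) _; apply: lerD => //; exact: l1_coord.
Qed.

Lemma llip_at k (f : 'rV[R]_k -> R) (x : 'rV[R]_k) (e : R) : llip f -> 0 < e -> exists2 d : R, 0 < d <= 1 &
  forall y : 'rV[R]_k, (forall i, `|y 0 i - x 0 i| <= d) -> `|f y - f x| <= e.
Proof.
move=> lf e0; have [L [L0 fL]] := lf (l1 x + 1).
have D0 : 0 < L * k%:R + 1 by rewrite ltr_wpDl // mulr_ge0.
pose d := Num.min 1 (e / (L * k%:R + 1)).
have d0 : 0 < d by rewrite lt_min ltr01 divr_gt0.
have d1 : d <= 1 by rewrite ge_min lexx.
exists d => [|y yx]; first by rewrite d0.
have xc : in_cube (l1 x + 1) x by apply: in_cubeW (in_cube_l1 x); rewrite lerDl.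
have yc : in_cube (l1 x + 1) y by apply: in_cubeW (in_cube_near yx); rewrite lerD2l.
have h : l1 (y - x) <= k%:R * d by apply: l1_le => i; rewrite !mxE.
apply: le_trans (fL _ _ yc xc) _; apply: le_trans (ler_wpM2l L0 h) _.
have : d <= e / (L * k%:R + 1) by rewrite ge_min lexx orbT.
rewrite ler_pdivlMr //; apply: le_trans.
by rewrite mulrA mulrC ler_wpM2l ?(ltW d0) // lerDl.
Qed.

(** f is the pointwise limit of its compositions with the retractions onto growing cubes, which are
    globally Lipschitz. *)
Lemma llip_borel k (f : 'rV[R]_k -> R) : llip f -> borel f.
Proof.
move=> lf; apply: (@borel_cvg R _ (fun n x => f (clip n%:R x))).
  move=> n; have [L [L0 fL]] := lf n%:R; apply: (lipschitz_borel L0) => x y.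
  apply: le_trans (fL _ _ _ _) _; try exact: clip_cube.
  by apply: ler_wpM2l => //; exact: clip_l1.
move=> x; apply: cvg_near_cst; near=> n; rewrite clip_id // => i.
apply: le_trans (l1_coord x i) _; apply: ltW; near: n.
exact: nbhs_infty_gtr.
Unshelve. all: by end_near. Qed.

Definition locbd k (f : 'rV[R]_k -> R) := forall r : R, exists M : R,
  forall x, in_cube r x -> `|f x| <= M.

Lemma llip_locbd k (f : 'rV[R]_k -> R) : llip f -> locbd f.
Proof.
move=> lf r; have [L [L0 fL]] := lf r; exists (`|f 0| + L * (k%:R * r)) => x xr.
have [r0|r0] := leP 0 r; last first.
  case: k f lf fL x xr => [|k] f lf fL x xr; last first.
    by have := le_trans (normr_ge0 _) (xr ord0); rewrite leNgt r0.
  by rewrite (_ : x = 0) ?mul0r ?mulr0 ?addr0 //; apply/rowP; case.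
rewrite -[f x](subrK (f 0)) addrC; apply: le_trans (ler_normD _ _) _; rewrite lerD2l.
apply: le_trans (fL _ _ xr _) _; first by move=> i; rewrite mxE normr0.
by rewrite subr0; apply: ler_wpM2l => //; exact: l1_le.
Qed.

Lemma llip_cst k c : llip (fun _ : 'rV[R]_k => c).
Proof. by move=> r; exists 0; split => // x y _ _; rewrite subrr normr0 mul0r. Qed.

Lemma llip_coord k i : llip (fun x : 'rV[R]_k => x 0 i).
Proof.
move=> r; exists 1; split => // x y _ _; rewrite mul1r.
by have := l1_coord (x - y) i; rewrite !mxE.
Qed.

Lemma llipD k (f g : 'rV[R]_k -> R) : llip f -> llip g -> llip (fun x => f x + g x).
Proof.
move=> lf lg r; have [L [L0 fL]] := lf r; have [L' [L0' gL]] := lg r.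
exists (L + L'); split => [|x y xr yr]; first exact: addr_ge0.
rewrite mulrDl opprD addrACA; apply: le_trans (ler_normD _ _) _.
by apply: lerD; [exact: fL|exact: gL].
Qed.

Lemma llipN k (f : 'rV[R]_k -> R) : llip f -> llip (fun x => - f x).
Proof.
move=> lf r; have [L [L0 fL]] := lf r; exists L; split => // x y xr yr.
by rewrite -opprD normrN; exact: fL.
Qed.

Lemma llipB k (f g : 'rV[R]_k -> R) : llip f -> llip g -> llip (fun x => f x - g x).
Proof. by move=> lf /llipN lg; exact: llipD. Qed.

Lemma llipM k (f g : 'rV[R]_k -> R) : llip f -> llip g -> llip (fun x => f x * g x).
Proof.
move=> lf lg r; have [L [L0 fL]] := lf r; have [L' [L0' gL]] := lg r.
have [M fM] := llip_locbd lf r; have [M' gM] := llip_locbd lg r.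
exists (`|M| * L' + `|M'| * L); split => [|x y xr yr].
  by rewrite addr_ge0 // mulr_ge0.
rewrite (_ : f x * g x - f y * g y = f x * (g x - g y) + g y * (f x - f y)); last by ring.
apply: le_trans (ler_normD _ _) _; rewrite !normrM mulrDl -!mulrA.
apply: lerD; apply: ler_pM => //; rewrite ?gL ?fL //.
  exact: le_trans (fM _ xr) (ler_norm _).
exact: le_trans (gM _ yr) (ler_norm _).
Qed.

Lemma llip_comp k (h : R -> R) (f : 'rV[R]_k -> R) : llip1 h -> llip f ->
  llip (fun x => h (f x)).
Proof.
move=> lh lf r; have [L [L0 fL]] := lf r; have [M fM] := llip_locbd lf r.
have [L' [L0' hL]] := lh M; exists (L' * L); split => [|x y xr yr]; first exact: mulr_ge0.
apply: le_trans (hL _ _ (fM _ xr) (fM _ yr)) _.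
by rewrite -mulrA ler_wpM2l // fL.
Qed.

Lemma llip_sum k (I : Type) (s : seq I) (P : pred I) (f : I -> 'rV[R]_k -> R) :
  (forall i, llip (f i)) -> llip (fun x => \sum_(i <- s | P i) f i x).
Proof.
move=> lf; elim: s => [|a s IH].
  by rewrite (_ : (fun x => _) = fun=> 0) ?funeqE => [|x]; [exact: llip_cst|rewrite big_nil].
rewrite (_ : (fun x => _) = fun x => (if P a then f a x else 0) + \sum_(i <- s | P i) f i x).
  by apply: llipD => //; case: (P a) => //; exact: llip_cst.
by apply/funext => x; rewrite big_cons; case: (P a) => //; rewrite add0r.
Qed.

Lemma llip_exp k (f : 'rV[R]_k -> R) m : llip f -> llip (fun x => f x ^+ m).
Proof.
move=> lf; elim: m => [|m IH]; first exact: llip_cst.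
by under eq_fun do rewrite exprS; exact: llipM.
Qed.

Lemma llip_max0 k (f : 'rV[R]_k -> R) : llip f -> llip (fun x => Num.max (f x) 0).
Proof.
move=> lf r; have [L [L0 fL]] := lf r; exists L; split => // x y xr yr.
exact: le_trans (max_lip _ _ _) (fL x y xr yr).
Qed.

End LocLip.

Section Partial.
Variable R : realType.

Definition pd k (i : 'I_k) (f : 'rV[R]_k -> R) (x : 'rV[R]_k) : R := 'D_(delta_mx 0 i) f x.
Definition pdable k (i : 'I_k) (f : 'rV[R]_k -> R) (x : 'rV[R]_k) : Prop :=
  derivable f x (delta_mx 0 i).

Definition quot k (i : 'I_k) (f : 'rV[R]_k -> R) (x : 'rV[R]_k) (h : R) : R :=
  h^-1 * (f (h *: delta_mx 0 i + x) - f x).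

Lemma line_quot k (i : 'I_k) (f : 'rV[R]_k -> R) x s :
  (fun h : R => h^-1 *: (((fun t => f (upd x i t)) \o shift s) (h *: 1) - f (upd x i s))) =
  quot i f (upd x i s).
Proof.
apply/funext => h; rewrite /quot -upd_addE updE upd_upd /= [_ *: 1]mulr1 [h + s]addrC.
by [].
Qed.

Lemma pd_line k (i : 'I_k) (f : 'rV[R]_k -> R) x s :
  pd i f (upd x i s) = 'D_1 (fun t => f (upd x i t)) s.
Proof. by rewrite /derive line_quot. Qed.

Lemma pdable_line k (i : 'I_k) (f : 'rV[R]_k -> R) x s :
  pdable i f (upd x i s) = derivable (fun t => f (upd x i t)) s 1.
Proof. by rewrite /derivable line_quot. Qed.

Lemma upd_cube k r (x : 'rV[R]_k) i s : in_cube r x -> `|s| <= r -> in_cube r (upd x i s).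
Proof. by move=> xr sr j; rewrite mxE; case: eqP. Qed.

Lemma l1_upd k (x : 'rV[R]_k) i s t : l1 (upd x i s - upd x i t) = `|s - t|.
Proof.
rewrite /l1 (bigD1 i) //= !mxE eqxx big1 ?addr0 // => j ji.
by rewrite !mxE (negbTE ji) subrr normr0.
Qed.

Lemma l1_shift k (x : 'rV[R]_k) i h : l1 (h *: delta_mx 0 i + x - x) = `|h|.
Proof. by rewrite -upd_addE -[X in _ - X](upd_id x i) l1_upd addrC addKr. Qed.

Lemma shift_cube k r (x : 'rV[R]_k) i h :
  in_cube r x -> in_cube (r + `|h|) (h *: delta_mx 0 i + x).
Proof.
move=> xr j; rewrite -upd_addE mxE; case: eqP => [_|_].
  by apply: le_trans (ler_normD _ _) _; rewrite lerD2r.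
by apply: le_trans (xr j) _; rewrite lerDl.
Qed.

Lemma quot_bound k (i : 'I_k) (f : 'rV[R]_k -> R) r L x h : 0 <= L ->
  (forall x y, in_cube (r + 1) x -> in_cube (r + 1) y -> `|f x - f y| <= L * l1 (x - y)) ->
  in_cube r x -> `|h| <= 1 -> `|quot i f x h| <= L.
Proof.
move=> L0 fL xr h1; have [->|h0] := eqVneq h 0; first by rewrite /quot invr0 mul0r normr0.
rewrite /quot normrM normrV ?unitfE // mulrC ler_pdivrMr ?normr_gt0 //.
rewrite -(l1_shift x i h); apply: fL.
  by apply: in_cubeW (shift_cube i h xr); rewrite lerD2l.
by apply: in_cubeW xr; rewrite lerDl.
Qed.

Lemma pd_cvg_seq k (i : 'I_k) (f : 'rV[R]_k -> R) x : pdable i f x ->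
  quot i f x n.+1%:R^-1 @[n --> \oo] --> pd i f x.
Proof.
move=> df; have := iffLR (cvgr_dnbhsP (quot i f x) 0 (pd i f x)) df (fun n => n.+1%:R^-1).
by apply; split => [n|]; [rewrite invr_eq0|exact: cvg_harmonic].
Qed.

Lemma pd_bound k (i : 'I_k) (f : 'rV[R]_k -> R) r L x : 0 <= L ->
  (forall x y, in_cube (r + 1) x -> in_cube (r + 1) y -> `|f x - f y| <= L * l1 (x - y)) ->
  in_cube r x -> `|pd i f x| <= L.
Proof.
move=> L0 fL xr; have [df|ndf] := pselect (pdable i f x); last first.
  (* Where the difference quotients diverge, the derivative has the default value 0. *)
  by rewrite /pd /derive (dvgP ndf) normr0.
apply: (cvgr_to_le (cvg_norm (pd_cvg_seq df))); near=> n.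
by apply: (quot_bound _ L0 fL xr); rewrite ger0_norm ?invr_ge0 // invf_le1 // ler1n.
Unshelve. all: by end_near. Qed.

Lemma llip_locbd_pd k (i : 'I_k) (f : 'rV[R]_k -> R) : llip f -> locbd (pd i f).
Proof.
move=> lf r; have [L [L0 fL]] := lf (r + 1); exists L => x xr.
exact: (pd_bound i L0 fL xr).
Qed.

Lemma llip_line_continuous k (i : 'I_k) (f : 'rV[R]_k -> R) x : llip f ->
  continuous (fun s => f (upd x i s)).
Proof.
move=> lf s; have [L [L0 fL]] := lf (l1 x + `|s| + 1).
apply/(@cvgrPdist_lt _ R^o) => e e0; near=> t.
have st1 : `|s - t| < 1 by near: t; apply: (@cvgr_dist_lt R R^o _ _ _ id s cvg_id).
have t1 : `|t| <= l1 x + `|s| + 1.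
  have := ler_normD (t - s) s; rewrite subrK distrC; have := l1_ge0 x; lra.
have xc : in_cube (l1 x + `|s| + 1) x.
  by apply: in_cubeW (in_cube_l1 x); rewrite -addrA lerDl addr_ge0.
apply: le_lt_trans (fL _ _ _ _) _.
- by apply: upd_cube => //; have := l1_ge0 x; lra.
- exact: upd_cube.
rewrite l1_upd; apply: (@le_lt_trans _ _ ((L + 1) * `|s - t|)).
  by apply: ler_wpM2r => //; lra.
rewrite mulrC -ltr_pdivlMr; last by lra.
near: t; apply: (@cvgr_dist_lt R R^o _ _ _ id s cvg_id).
by rewrite divr_gt0 //; lra.
Unshelve. all: by end_near. Qed.

Lemma quot_continuous k (i : 'I_k) (f : 'rV[R]_k -> R) x h : llip f -> h != 0 ->
  {for h, continuous (quot i f x)}.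
Proof.
move=> lf h0; apply: cvgM; first exact: cvgV.
apply: cvgB; last exact: cvg_cst.
rewrite (_ : (fun h => _) = (fun h => (fun s => f (upd x i s)) (x 0 i + h))); last first.
  by apply/funext => h'; rewrite upd_addE.
rewrite -upd_addE; apply: (cvg_comp (fun h => x 0 i + h) (fun s => f (upd x i s))).
  by apply: cvgD; [exact: cvg_cst|exact: cvg_id].
exact: llip_line_continuous.
Qed.

(* Testing rational increments only makes the set of differentiability points
   a countable combination of Borel sets. *)
Lemma quot_cauchy k (i : 'I_k) (f : 'rV[R]_k -> R) x : llip f ->
  pdable i f x <-> forall m : nat, exists j : nat, forall n1 n2 : nat,
    0 < `|rats R n1| < j.+1%:R^-1 -> 0 < `|rats R n2| < j.+1%:R^-1 ->
    `|quot i f x (rats R n1) - quot i f x (rats R n2)| <= m.+1%:R^-1.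
Proof.
move=> lf; split.
  move=> df m; have m0 : (0 : R) < m.+1%:R^-1 / 2 by rewrite divr_gt0 // invr_gt0.
  have /cvgrPdist_lt/(_ _ m0) : quot i f x h @[h --> 0^'] --> pd i f x by exact: df.
  rewrite near_withinE => /nbhs_normP[d /= d0 hd].
  have [j hj] : exists j : nat, j.+1%:R^-1 < d.
    have [j _ /(_ j (leqnn j))] := (cvgr_lt _ (@cvg_harmonic R)) d d0.
    by exists j.
  exists j => n1 n2 /andP[n10 n1j] /andP[n20 n2j].
  have h1 := hd (rats R n1) _ _; have h2 := hd (rats R n2) _ _.
  have := ler_distD (pd i f x) (quot i f x (rats R n1)) (quot i f x (rats R n2)).
  have {}h1 : `|quot i f x (rats R n1) - pd i f x| < m.+1%:R^-1 / 2.
    rewrite distrC; apply: h1; last by rewrite -normr_gt0.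
    by rewrite /= sub0r normrN; exact: lt_trans n1j hj.
  have {}h2 : `|pd i f x - quot i f x (rats R n2)| < m.+1%:R^-1 / 2.
    apply: h2; last by rewrite -normr_gt0.
    by rewrite /= sub0r normrN; exact: lt_trans n2j hj.
  move: (m.+1%:R^-1 : R) h1 h2 {m0 hd} => e h1 h2; lra.
move=> H; rewrite /pdable /derivable; apply/(@cauchy_cvgP R); apply: cauchy_exP => e e0.
have e3 : 0 < e / 3 by lra.
have [m hm] : exists m : nat, m.+1%:R^-1 < e / 3.
  have [j _ /(_ j (leqnn j))] := (cvgr_lt _ (@cvg_harmonic R)) (e / 3) e3.
  by exists j.
have [j hj] := H m.
(* Quotients are continuous in the increment away from 0, so an arbitrary small increment can be
   traded for a rational one at a cost below e / 3. *)
have approx h : 0 < `|h| < j.+1%:R^-1 -> exists n, 0 < `|rats R n| < j.+1%:R^-1 /\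
    `|quot i f x h - quot i f x (rats R n)| < e / 3.
  move=> /andP[h0 hlt].
  have nz : h != 0 by rewrite -normr_gt0.
  have A1 : \forall t \near h, `|quot i f x h - quot i f x t| < e / 3.
    by have /cvgrPdist_lt := quot_continuous (i := i) (x := x) lf nz; apply.
  have N : (`|t| : R) @[t --> h] --> `|h|.
    by apply: (@cvg_norm R R^o _ _ _ id); exact: cvg_id.
  have A2 : \forall t \near h, 0 < `|t|.
    exact: (cvgr_gt _ N).
  have A3 : \forall t \near h, `|t| < j.+1%:R^-1.
    exact: (cvgr_lt _ N).
  have /nbhs_normP [d /= d0 hd] : \forall t \near h,
      `|quot i f x h - quot i f x t| < e / 3 /\ (0 < `|t| /\ `|t| < j.+1%:R^-1).
    exact: (filterI A1 (filterI A2 A3)).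
  have [n /andP[n1 n2]] : exists n, h < rats R n < h + d by apply: rats_dense; rewrite ltrDl.
  have [|B1 [B2 B3]] := hd (rats R n).
    by rewrite /= distrC gtr0_norm ?subr_gt0 // ltrBlDl.
  by exists n; rewrite B2 B3.
have nearj : \forall h \near (0 : R)^', 0 < `|h| < j.+1%:R^-1.
  rewrite near_withinE; near=> h => h0; rewrite normr_gt0 h0 /=.
  rewrite -[h]subr0 distrC; near: h.
  by apply: (@cvgr_dist_lt R R^o _ _ _ id 0 cvg_id); rewrite invr_gt0.
have [n0 n0P] : exists n, 0 < rats R n < j.+1%:R^-1 by apply: rats_dense; rewrite invr_gt0.
have n0Q : 0 < `|rats R n0| < j.+1%:R^-1.
  by have /andP[n1 n2] := n0P; rewrite gtr0_norm // n1.
exists (quot i f x (rats R n0)); apply: filterS nearj => h hP.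
have [n [nP hn]] := approx h hP.
have := hj _ _ n0Q nP => hnn.
rewrite -ball_normE /=.
have := ler_distD (quot i f x (rats R n)) (quot i f x (rats R n0)) (quot i f x h).
have -> : `|quot i f x (rats R n) - quot i f x h| = `|quot i f x h - quot i f x (rats R n)|.
  by rewrite distrC.
move=> htri; apply: (le_lt_trans htri).
have := le_lt_trans hnn hm; lra.
Unshelve. all: by end_near. Qed.

End Partial.

(** * Null sets and almost everywhere differentiability *)

Section NullSets.
Variable R : realType.
Local Notation mu := (@lebesgue_measure R).
Local Notation mR := (measurableTypeR R).

Lemma borel_shift k (i : 'I_k) (f : 'rV[R]_k -> R) h :
  borel f -> borel (fun x => f (h *: delta_mx 0 i + x)).
Proof.
move=> bf d S g mg; apply: bf => j.
by under eq_fun do rewrite !mxE; apply: measurable_funD => //; exact: mg.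
Qed.

Lemma borel_quot k (i : 'I_k) (f : 'rV[R]_k -> R) h : llip f -> borel (fun x => quot i f x h).
Proof.
move=> /llip_borel bf; apply: borelM; first exact: borel_cst.
by apply: borelB => //; exact: borel_shift.
Qed.

Lemma borel_set_imp k (P : Prop) (A : set 'rV[R]_k) : borel_set A ->
  borel_set [set x | P -> A x].
Proof.
move=> bA; have [p|np] := pselect P.
  by rewrite (_ : [set x | _] = A) //; apply/seteqP; split => x //= H; exact: H.
rewrite (_ : [set x | _] = [set _ | True]); first exact: borel_set_cst.
by apply/seteqP; split => x //= _ p; case: np.
Qed.

Lemma borel_set_pdable k (i : 'I_k) (f : 'rV[R]_k -> R) : llip f ->
  borel_set [set x | pdable i f x].
Proof.
move=> lf.
pose A (m j n1 n2 : nat) (x : 'rV[R]_k) :=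
    0 < `|rats R n1| < j.+1%:R^-1 -> 0 < `|rats R n2| < j.+1%:R^-1 ->
    `|quot i f x (rats R n1) - quot i f x (rats R n2)| <= m.+1%:R^-1.
rewrite (_ : [set x | _] = [set x | forall m, [set y | exists j,
    [set z | forall n1, [set t | forall n2, A m j n1 n2 t] z] y] x]); last first.
  by apply/seteqP; split => x /= /(quot_cauchy i x lf).
apply: borel_bigcap => m; apply: borel_bigcup => j; apply: borel_bigcap => n1.
apply: borel_bigcap => n2; apply: borel_set_imp; apply: borel_set_imp.
apply: (@borel_set_le R k (fun x => `|quot i f x (rats R n1) - quot i f x (rats R n2)|)).
apply: (borel_comp1 (h := fun t : R => `|t|)); first exact: normr_measurable.
by apply: borelB; exact: borel_quot.
Qed.

(** The default value 0 at points of nondifferentiability makes [pd] an everywhere limit of Borel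
    functions: quotients times the indicator of the set of differentiability. *)
Lemma borel_pd k (i : 'I_k) (f : 'rV[R]_k -> R) : llip f -> borel (pd i f).
Proof.
move=> lf; pose E := [set x | pdable i f x].
apply: (@borel_cvg R k (fun n x => quot i f x n.+1%:R^-1 * \1_E x)).
  move=> n; apply: borelM; first exact: borel_quot.
  by apply: borel_indic; exact: borel_set_pdable.
move=> x; rewrite indicE; have [xE|xE] := pselect (pdable i f x).
  by rewrite mem_set //=; under eq_fun do rewrite mulr1; exact: pd_cvg_seq.
rewrite memNset // [pd i f x](_ : _ = 0); last by rewrite /pd /derive (dvgP xE).
by under eq_fun do rewrite mulr0; exact: cvg_cst.
Qed.

(* Null sets only ever enter through integrals of integrands, so no product
   measure is needed. *)
Definition nullset k (N : set 'rV[R]_k) := borel_set N /\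
  forall f, integrand f -> iint (fun x => f x * \1_N x) = 0.

Lemma integrand_indic k (N : set 'rV[R]_k) f : borel_set N -> integrand f ->
  integrand (fun x => f x * \1_N x).
Proof.
move=> bN hf; apply: integrandM => //; first exact: borel_indic.
move=> r; exists 1 => x _; rewrite indicE; case: (_ \in _); by rewrite ?normr1 ?normr0.
Qed.

Lemma iint_le_off k (N : set 'rV[R]_k) (f g : 'rV[R]_k -> R) : nullset N ->
  integrand f -> integrand g -> (forall x, ~ N x -> f x <= g x) -> iint f <= iint g.
Proof.
move=> [bN N0] hf hg fg.
have E h : integrand h -> iint h = iint (fun x => h x - h x * \1_N x).
  by move=> hh; rewrite iintB ?N0 ?subr0 //; exact: integrand_indic.
rewrite (E f) // (E g) //; apply: iint_le.
- by apply: integrandB => //; exact: integrand_indic.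
- by apply: integrandB => //; exact: integrand_indic.
move=> x; rewrite indicE; have [xN|xN] := pselect (N x).
  by rewrite mem_set // !mulr1 !subrr.
by rewrite memNset // !mulr0 !subr0 fg.
Qed.

Lemma nullsetU k (M N : set 'rV[R]_k) : nullset M -> nullset N -> nullset (M `|` N).
Proof.
move=> [bM M0] [bN N0]; split => [|f hf]; first exact: borel_setU.
have hM := integrand_indic bM hf; have hN := integrand_indic bN hf.
have hMN := integrand_indic bN hM.
rewrite (_ : (fun x => _) = fun x => f x * \1_M x + (f x * \1_N x - f x * \1_M x * \1_N x)).
  by rewrite iintD ?iintB ?M0 ?N0 ?subrr ?addr0 //; exact: integrandB.
apply/funext => x; rewrite !indicE in_setU.
by case: (x \in M); case: (x \in N) => /=; ring.
Qed.

Lemma nullset_bigU k m (N : 'I_m -> set 'rV[R]_k) : (forall i, nullset (N i)) ->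
  nullset [set x | exists i, N i x].
Proof.
elim: m N => [|m IH] N hN.
  rewrite (_ : [set x | _] = set0).
    split; first by have := @borel_set_cst R k False; congr borel_set; apply/seteqP; split.
    move=> f _; rewrite (_ : (fun x => _) = fun=> 0) ?iint0 //.
    by apply/funext => x; rewrite indicE in_set0 mulr0.
  by apply/seteqP; split => // x [[]].
rewrite (_ : [set x | _] = N ord0 `|` [set x | exists i, N (lift ord0 i) x]).
  by apply: nullsetU => //; exact: IH.
apply/seteqP; split => x /=.
  by move=> [i]; case: (unliftP ord0 i) => [j ->|->] h; [right; exists j|left].
by move=> [h|[i h]]; [exists ord0|exists (lift ord0 i)].
Qed.

Lemma measurable_upd k (x : 'rV[R]_k) i j : measurable_fun setT (fun s : mR => upd x i s 0 j).
Proof.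
by under eq_fun do rewrite mxE; case: (j == i); [exact: measurable_id|exact: measurable_cst].
Qed.

(** Integrating in direction i first already gives 0 on every line, whatever the integrand. *)
Lemma nullset_line k (i : 'I_k) (N : set 'rV[R]_k) : borel_set N ->
  (forall x, mu.-negligible [set s | N (upd x i s)]) -> nullset N.
Proof.
move=> bN hN; split => // f hf.
have hfN := integrand_indic bN hf.
have E x : Rintegral mu setT (fun s => f (upd x i s) * \1_N (upd x i s)) = 0.
  pose h s := f (upd x i s) * \1_N (upd x i s).
  have mh : measurable_fun setT (EFin \o h).
    apply/measurable_EFinP; have [M [r [_ _ b _ _]]] := hfN.
    by apply: (b _ mR (fun s => upd x i s)) => j; exact: measurable_upd.
  have aeh : ae_eq mu setT (EFin \o h) (cst 0%E).
    have [A [mA A0 sA]] := hN x; exists A; split => // s /= nh; apply: sA => /=.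
    apply: contrapT => nN; apply: nh => _; rewrite /h indicE memNset //.
    by rewrite mulr0.
  rewrite /Rintegral -[RHS]/(fine 0%E); congr fine.
  have := @ae_eq_integral _ mR R mu setT (cst 0%E) (EFin \o h) measurableT mh
    (measurable_cst _) aeh.
  by rewrite integral0.
have E0 x : Rintegral mu setT (fun s => (fun _ : 'rV[R]_k => 0) (upd x i s)) = 0.
  by rewrite Rintegral_cst // mul0r.
apply/eqP; rewrite eq_le -(iint0 R k); apply/andP; split;
  by apply: (iint_line_le (i := i)) => //; try exact: integrand0; move=> x; rewrite E E0.
Qed.

Lemma line_lipschitz k (f : 'rV[R]_k -> R) x i r : llip f -> 0 <= r -> exists L,
  0 <= L /\ forall s t, `|f (upd x i (clip1 r s)) - f (upd x i (clip1 r t))| <= L * `|s - t|.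
Proof.
move=> lf r0; have [L [L0 fL]] := lf (l1 x + r); exists L; split => // s t.
have c z : in_cube (l1 x + r) (upd x i (clip1 r z)).
  apply: upd_cube.
    by apply: in_cubeW (in_cube_l1 x); rewrite lerDl.
  by apply: le_trans (clip1_bound _ r0) _; rewrite lerDr l1_ge0.
apply: le_trans (fL _ _ (c s) (c t)) _.
by rewrite l1_upd; apply: ler_wpM2l => //; exact: clip1_lip.
Qed.

(** A gradient here is a row of partial derivatives, so Rademacher's theorem reduces to Lipschitz
    functions on lines. Clipping makes the restriction to a line globally Lipschitz and does not
    change it near a point s once n > |s|. *)
Lemma nullset_not_pdable k (i : 'I_k) (f : 'rV[R]_k -> R) : llip f ->
  nullset [set x | ~ pdable i f x].
Proof.
move=> lf; apply: (nullset_line (i := i)).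
  by apply: borel_setC; exact: borel_set_pdable.
move=> x; pose F n s := f (upd x i (clip1 n%:R s)).
have FN n : mu.-negligible [set s | ~ derivable (F n) s 1].
  have [L [_ hL]] := line_lipschitz x i lf (ler0n R n).
  exact: lipschitz_derivable_ae hL.
have sub : [set s | [set x | ~ pdable i f x] (upd x i s)] `<=`
    \bigcup_n [set s | ~ derivable (F n) s 1].
  move=> s /= nd; exists (Num.truncn `|s|).+1; first by [].
  move=> /= dF; apply: nd.
  rewrite pdable_line; apply: near_eq_derivable dF.
  near=> t; rewrite /F clip1_id //; apply: ltW; near: t.
  apply: (cvgr_lt `|s|); last exact: truncnS_gt.
  by apply: (@cvg_norm R R^o _ _ _ id); exact: cvg_id.
have [A [mA A0 sA]] := negligible_bigcup FN.
by exists A; split => //; apply: subset_trans sub sA.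
Unshelve. all: by end_near. Qed.

End NullSets.

(** * The fundamental theorem on lines, and sets covered by small boxes *)

Section LineFTC.
Variable R : realType.
Local Notation mu := (@lebesgue_measure R).
Local Notation mR := (measurableTypeR R).

Lemma bounded_compact_norm (f : R -> R) M r : bounded_compact f M r ->
  bounded_compact (fun x => `|f x|) M r.
Proof.
move=> [mf fM fr]; split.
- by apply: measurableT_comp mf; exact: normr_measurable.
- by move=> x; rewrite normr_id.
- by move=> x; rewrite normr_eq0 => /fr.
Qed.

Lemma clip1_far (r s : R) : 0 <= r -> r < `|s| -> `|clip1 r s| = r.
Proof.
move=> r0; have [s0|s0] := leP 0 s; [rewrite ger0_norm //|rewrite ltr0_norm //] => rs.
  by rewrite /clip1 min_l ?max_r ?ger0_norm //; lra.
by rewrite /clip1 min_r ?max_l ?normrN ?ger0_norm //; lra.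
Qed.

Section Line.
Variables (k : nat) (i : 'I_k) (Phi : 'rV[R]_k -> R) (r : R).
Hypotheses (lPhi : llip Phi) (r0 : 0 <= r).
Hypothesis supp : forall x, Phi x != 0 -> in_cube r x.

(** The cube is closed, so from a point outside it Phi vanishes for a while along the line in
    direction i. *)
Lemma pd_supp x : pd i Phi x != 0 -> in_cube r x.
Proof.
move=> nz j; rewrite leNgt; apply/negP => xj; move/eqP: nz; apply.
rewrite -[x](upd_id x i) pd_line.
rewrite (@near_eq_derive R R^o R^o _ (cst 0)) ?derive_cst //.
have [ji|ji] := eqVneq j i; last first.
  near=> s; apply/eqP; apply: contraT => /supp /(_ j).
  by rewrite updN // leNgt xj.
rewrite ji in xj; near=> s; apply/eqP; apply: contraT => /supp /(_ i).
rewrite updE leNgt => /negP; case; near: s; apply: (cvgr_gt `|x 0 i|) xj.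
by apply: (@cvg_norm R R^o _ _ _ id); exact: cvg_id.
Unshelve. all: by end_near. Qed.

Lemma line_pd_bounded_compact x : exists M,
  bounded_compact (fun s => pd i Phi (upd x i s)) M r.
Proof.
have [M PM] := llip_locbd_pd i lPhi r; exists `|M|; split.
- by apply: (borel_pd i lPhi (g := fun s : mR => upd x i s)) => j; exact: measurable_upd.
- move=> s; have [->|/pd_supp xr] := eqVneq (pd i Phi (upd x i s)) 0.
    by rewrite normr0.
  exact: le_trans (PM _ xr) (ler_norm _).
- by move=> s /pd_supp/(_ i); rewrite updE.
Qed.

Lemma line_ftc x s0 :
  Rintegral mu setT (fun s => pd i Phi (upd x i s) * (s < s0)%R%:R) = Phi (upd x i s0).
Proof.
have [M hD] := line_pd_bounded_compact x.
have r1 : 0 <= r + 1 by rewrite addr_ge0.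
(* The restriction to the line vanishes beyond r, so clipping at r + 1 does not change it; this
   shows that it is globally Lipschitz. *)
have Fc s : Phi (upd x i (clip1 (r + 1) s)) = Phi (upd x i s).
  have [sr|sr] := leP `|s| (r + 1); first by rewrite clip1_id.
  have z t : r < `|t| -> Phi (upd x i t) = 0.
    move=> rt; apply/eqP; apply: contraTT rt => /supp/(_ i).
    by rewrite updE leNgt.
  rewrite !z //; first by apply: lt_trans sr; rewrite ltrDl.
  by rewrite clip1_far // ltrDl.
have [L [L0 hL]] := line_lipschitz x i lPhi r1.
apply: (@ftc_lipschitz R (fun s => Phi (upd x i s)) _ L r M r s0) => //.
- by move=> s t; rewrite -(Fc s) -(Fc t).
- by move=> s /supp/(_ i); rewrite updE.
- by move=> s _; rewrite pd_line.
Qed.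

Lemma line_ftc0 x : Rintegral mu setT (fun s => pd i Phi (upd x i s)) = 0.
Proof.
rewrite -[RHS](_ : Phi (upd x i (r + 1)) = 0); last first.
  apply/eqP; apply: contraT => /supp/(_ i); rewrite updE ger0_norm; last by rewrite addr_ge0.
  by rewrite leNgt ltrDl ltr01.
rewrite -line_ftc; apply: eq_Rintegral => s _.
have [->|/pd_supp/(_ i)] := eqVneq (pd i Phi (upd x i s)) 0; first by rewrite mul0r.
rewrite updE ler_norml => /andP[_ sr].
by rewrite (_ : s < r + 1) ?mulr1 //; apply: le_lt_trans sr _; rewrite ltrDl.
Qed.

Lemma line_ftc_bound x s0 :
  `|Phi (upd x i s0)| <= Rintegral mu setT (fun s => `|pd i Phi (upd x i s)|).
Proof.
have [M hD] := line_pd_bounded_compact x; have hDs := bounded_compact_lt s0 hD.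
rewrite -line_ftc; have j1 := bounded_compact_integrable hDs.
apply: le_trans (le_normr_Rintegral measurableT j1) _.
apply: le_Rintegral => //.
- exact: bounded_compact_integrable (bounded_compact_norm hDs).
- exact: bounded_compact_integrable (bounded_compact_norm hD).
- by move=> s _ /=; case: (s < s0); rewrite ?mulr1 // mulr0 normr0.
Qed.

End Line.

Lemma iint_dominated k (f_ : nat -> 'rV[R]_k -> R) (f : 'rV[R]_k -> R) M r :
  0 <= M -> 0 <= r -> (forall n, borel (f_ n)) ->
  (forall n x, `|f_ n x| <= M) -> (forall n x, f_ n x != 0 -> in_cube r x) ->
  integrand f -> (forall x, f_ n x @[n --> \oo] --> f x) ->
  iint (f_ n) @[n --> \oo] --> iint f.
Proof.
move=> M0; elim: k f_ f => [|k IH] f_ f r0 bf fM fr hf cf; first exact: cf.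
have [M' [r' hI]] := integrand_iint hf.
apply: (@Rintegral_dominated_cvg R (fun n t => iint (fun y => f_ n (rowcons t y)))
  (fun t => iint (fun y => f (rowcons t y))) (M * (2 * r) ^+ k) r M' r') => //.
  move=> n.
  have [|mI bI] := @iint_param R k _ mR (fun t y => f_ n (rowcons t y)) M r M0 r0
      (borel_slice (bf n)) (fun t y => fM _ _).
    by move=> t y /fr h i; have := h (lift ord0 i); rewrite rowconsS.
  split => // t; apply: contraNT => tr.
  rewrite (_ : (fun y => _) = fun=> 0) ?iint0 //.
  apply/funext => y; have [//|/fr/(_ ord0)] := eqVneq (f_ n (rowcons t y)) 0.
  by rewrite rowcons0 (negbTE tr).
apply: (@nearW _ _ _ (ae_filter_ringOfSetsType mu)) => t.
apply: IH => //.
- by move=> n d S g mg; apply: (borel_slice (bf n) (a := fun=> t)).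
- by move=> n y /fr h i; have := h (lift ord0 i); rewrite rowconsS.
- exact: integrand_slice.
Qed.

Lemma borel_prod k (I : Type) (s : seq I) (f : I -> 'rV[R]_k -> R) :
  (forall i, borel (f i)) -> borel (fun x => \prod_(i <- s) f i x).
Proof.
move=> bf; elim: s => [|a s IH].
  by under eq_fun do rewrite big_nil; exact: borel_cst.
under eq_fun do rewrite big_cons.
exact: (borelM (bf a) IH).
Qed.

Lemma integrand_prod k (phi : 'I_k -> R -> R) M r : 0 <= M -> 0 <= r ->
  (forall i, bounded_compact (phi i) M r) ->
  integrand (fun x : 'rV[R]_k => \prod_i phi i (x 0 i)).
Proof.
move=> M0 r0 hphi; exists (M ^+ k), r; split => //.
- exact: exprn_ge0.
- apply: borel_prod => i; have [mphi _ _] := hphi i.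
  exact: (borel_comp1 mphi (borel_coord i)).
- move=> x; rewrite normr_prod -[k in X in _ <= X]card_ord -prodr_const.
  by apply: ler_prod => i _; rewrite normr_ge0; have [_ ->] := hphi i.
- move=> x nz i; have [_ _] := hphi i; apply; apply: contraNneq nz => z.
  by rewrite (bigD1 i) //= z mul0r.
Qed.

Lemma iint_prod k (phi : 'I_k -> R -> R) M r : 0 <= M -> 0 <= r ->
  (forall i, bounded_compact (phi i) M r) ->
  iint (fun x : 'rV[R]_k => \prod_i phi i (x 0 i)) = \prod_i Rintegral mu setT (phi i).
Proof.
move=> M0 r0; elim: k phi => [|k IH] phi hphi; first by rewrite /= !big_ord0.
have hphi' i : bounded_compact (phi (lift ord0 i)) M r by [].
rewrite iintS big_ord_recl -(IH (fun i => phi (lift ord0 i))) //.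
rewrite mulrC -RintegralZl //; last exact: bounded_compact_integrable (hphi ord0).
apply: eq_Rintegral => t _; rewrite [RHS]mulrC -iintZ; last exact: integrand_prod M0 r0 hphi'.
apply: eq_iint => y; rewrite big_ord_recl rowcons0; congr (_ * _).
by apply: eq_bigr => i _; rewrite rowconsS.
Qed.

Lemma indic_box k (a b x : 'rV[R]_k) :
  \1_(box a b) x = \prod_i \1_(`[a 0 i, b 0 i]%classic) (x 0 i) :> R.
Proof.
rewrite indicE; have [xb|xb] := pselect (box a b x).
  by rewrite mem_set // big1 // => i _; rewrite indicE mem_set //= in_itv /= xb.
rewrite memNset //; move/existsNP: xb => [i xi]; rewrite (bigD1 i) //= indicE.
by rewrite memNset ?mul0r //= in_itv.
Qed.

Lemma box_bounded_compact k (a b : 'rV[R]_k) i :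
  bounded_compact (fun s => \1_(`[a 0 i, b 0 i]%classic) s : R) 1 (l1 a + l1 b).
Proof.
apply: itv_bounded_compact.
  by apply: le_trans (l1_coord a i) _; rewrite lerDl l1_ge0.
by apply: le_trans (l1_coord b i) _; rewrite lerDr l1_ge0.
Qed.

Lemma integrand_box k (a b : 'rV[R]_k) : integrand (fun x => \1_(box a b) x : R).
Proof.
under eq_fun do rewrite indic_box.
apply: (@integrand_prod k (fun i s => \1_(`[a 0 i, b 0 i]%classic) s) 1 (l1 a + l1 b)) => //.
  by rewrite addr_ge0 ?l1_ge0.
exact: box_bounded_compact.
Qed.

Lemma iint_box k (a b : 'rV[R]_k) : (forall i, a 0 i <= b 0 i) ->
  iint (fun x => \1_(box a b) x : R) = box_vol a b.
Proof.
move=> ab; under eq_fun do rewrite indic_box.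
rewrite (@iint_prod k (fun i s => \1_(`[a 0 i, b 0 i]%classic) s) 1 (l1 a + l1 b)) //.
- apply: eq_bigr => i _; rewrite /Rintegral integral_indic //.
  have := lebesgue_measure_itv `[a 0 i, b 0 i]%R; rewrite setIT /= => ->.
  rewrite lte_fin; case: ltP => //= h.
  by have -> : a 0 i = b 0 i; [apply/eqP; rewrite eq_le ab h|rewrite subrr].
- by rewrite addr_ge0 ?l1_ge0.
- exact: box_bounded_compact.
Qed.

(** Links coverings by boxes to iterated integrals. The product [u n] is the indicator of the
    complement of the first n boxes, so f (1 - u n) tends to f, which is supported in the covered
    set, and is at most M times the sum of the indicators of these boxes. *)
Lemma Rn_null_iint0 k (N : set 'rV[R]_k) (f : 'rV[R]_k -> R) : Rn_null_set N ->
  integrand f -> (forall x, 0 <= f x) -> (forall x, f x != 0 -> N x) -> iint f = 0.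
Proof.
move=> nullN hf f0 fN; apply/eqP; rewrite eq_le iint_ge0 // andbT.
have [M [r [M0 r0 bf fM fr]]] := hf.
apply/ler_addgt0Pr => e e0; rewrite add0r.
have e1 : 0 < e / (M + 1) by rewrite divr_gt0 //; lra.
have [a [b [ab [cov vol]]]] := nullN _ e1.
pose u n x : R := \prod_(j < n) (1 - \1_(box (a j) (b j)) x).
have I01 (A : set 'rV[R]_k) x : 0 <= (\1_A x : R) <= 1.
  by rewrite indicE; case: (_ \in _); rewrite ?lexx ler01.
have u01 n x : 0 <= u n x <= 1.
  elim: n => [|n /andP[IH1 IH2]]; first by rewrite /u big_ord0 ler01 lexx.
  rewrite /u big_ord_recr /= -/(u n x).
  have /andP[? ?] := I01 (box (a n) (b n)) x;   by rewrite mulr_ge0 ?mulr_ile1 //; lra.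
have us n x : 1 - u n x <= \sum_(j < n) \1_(box (a j) (b j)) x.
  elim: n => [|n IH]; first by rewrite /u !big_ord0 subrr.
  rewrite /u !big_ord_recr /= -/(u n x).
  have /andP[? ?] := I01 (box (a n) (b n)) x; have /andP[? ?] := u01 n x.
  set i := \1_(box (a n) (b n)) x in IH *; nra.
have bu n : borel (u n).
  apply: borel_prod => j; apply: borelB; first exact: borel_cst.
  by have [? [? [_ _ ?]]] := integrand_box (a j) (b j).
have hfu n : integrand (fun x => f x * (1 - u n x)).
  apply: integrandM => //; first by apply: borelB => //; exact: borel_cst.
  move=> ?; exists 1 => x _; have /andP[? ?] := u01 n x; rewrite ger0_norm; lra.
have lim : iint (fun x => f x * (1 - u n x)) @[n --> \oo] --> iint f.
  apply: (@iint_dominated k _ f M r) => //.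
  - by move=> n; have [? [? [_ _ ?]]] := hfu n.
  - move=> n x; apply: le_trans (fM x); rewrite normrM ler_piMr //.
    by have /andP[? ?] := u01 n x; rewrite ger0_norm; lra.
  - by move=> n x; rewrite mulf_eq0 negb_or => /andP[/fr].
  - move=> x; have [fx|/fN /cov [j _ xj]] := eqVneq (f x) 0.
      by under eq_fun do rewrite fx mul0r; rewrite fx; exact: cvg_cst.
    apply: cvg_near_cst; exists j.+1 => // n /= jn.
    rewrite /u (bigD1 (Ordinal jn)) //= indicE mem_set //= subrr mul0r subr0 mulr1 //.
apply: (cvgr_to_le lim); near=> n.
apply: (@le_trans _ _ (iint (fun x => M * \sum_(j < n) \1_(box (a j) (b j)) x))).
  apply: iint_le => //.
    apply: integrandZ; elim: (n) => [|m IH].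
      by under eq_fun do rewrite big_ord0; exact: integrand0.
    by under eq_fun do rewrite big_ord_recr /=; apply: integrandD => //; exact: integrand_box.
  move=> x; apply: ler_pM => //.
    by have /andP[? ?] := u01 n x; lra.
  exact: le_trans (ler_norm _) (fM x).
have hs m : integrand (fun x => \sum_(j < m) \1_(box (a j) (b j)) x : R).
  elim: m => [|m IH]; first by under eq_fun do rewrite big_ord0; exact: integrand0.
  by under eq_fun do rewrite big_ord_recr /=; apply: integrandD => //; exact: integrand_box.
rewrite iintZ //.
have -> : iint (fun x => \sum_(j < n) \1_(box (a j) (b j)) x) = \sum_(j < n) box_vol (a j) (b j).
  elim: (n) => [|m IH].
    by rewrite big_ord0 -[RHS](iint0 R k); apply: eq_iint => x; rewrite big_ord0.
  rewrite big_ord_recr /= -IH -(iint_box (ab m)) -iintD //; last exact: integrand_box.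
  by apply: eq_iint => x; rewrite big_ord_recr.
apply: (@le_trans _ _ (M * (e / (M + 1)))); first exact: ler_wpM2l.
rewrite mulrA ler_pdivrMr; nra.
Unshelve. all: by end_near. Qed.

End LineFTC.

(** * The Euclidean norm, and derivatives of powers *)

Section Enorm.
Variable R : realType.

Lemma enorm_ge0 k (x : 'rV[R]_k) : 0 <= enorm x.
Proof. exact: sqrtr_ge0. Qed.

Lemma sqr_enorm k (x : 'rV[R]_k) : enorm x ^+ 2 = \sum_i x 0 i ^+ 2.
Proof. by rewrite sqr_sqrtr // sumr_ge0 // => i _; exact: sqr_ge0. Qed.

Lemma cauchy_schwarz k (x y : 'rV[R]_k) :
  \sum_i x 0 i * y 0 i <= enorm x * enorm y.
Proof.
set P := \sum_i _; have X0 := enorm_ge0 x; have Y0 := enorm_ge0 y.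
have key : 0 <= enorm y ^+ 2 * (enorm x ^+ 2 * enorm y ^+ 2 - P ^+ 2).
  have : 0 <= \sum_i (enorm y ^+ 2 * x 0 i - P * y 0 i) ^+ 2.
    by apply: sumr_ge0 => i _; exact: sqr_ge0.
  congr (_ <= _).
  transitivity (\sum_i ((enorm y ^+ 2) ^+ 2 * (x 0 i ^+ 2) - 2 * enorm y ^+ 2 * P * (x 0 i * y 0 i)
     + P ^+ 2 * y 0 i ^+ 2)); first by apply: eq_bigr => i _; ring.
  by rewrite big_split sumrB -!mulr_sumr -!sqr_enorm -/P /=; ring.
have [y0|y0] := eqVneq (enorm y) 0.
  rewrite y0 mulr0 /P big1 // => i _.
  have : y 0 i ^+ 2 <= enorm y ^+ 2.
    rewrite sqr_enorm (bigD1 i) //= lerDl.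
    by apply: sumr_ge0 => j _; exact: sqr_ge0.
  rewrite y0 expr0n /=.
  rewrite le_eqVlt ltNge sqr_ge0 orbF sqrf_eq0 => /eqP ->; rewrite mulr0 //.
have yy : 0 < enorm y ^+ 2 by rewrite exprn_gt0 // lt_neqAle eq_sym y0.
rewrite pmulr_rge0 // subr_ge0 -exprMn in key.
by apply: le_trans (ler_norm _) _; rewrite -ler_sqr ?nnegrE ?mulr_ge0 // real_normK ?num_real.
Qed.

Lemma enormD k (x y : 'rV[R]_k) : enorm (x + y) <= enorm x + enorm y.
Proof.
rewrite -ler_sqr ?nnegrE ?addr_ge0 ?enorm_ge0 // sqrrD !sqr_enorm.
rewrite -[X in _ <= X](_ : \sum_i x 0 i ^+ 2 + \sum_i y 0 i ^+ 2 + enorm x * enorm y *+ 2 = _); last by ring.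
apply: (@le_trans _ _ (\sum_i x 0 i ^+ 2 + \sum_i y 0 i ^+ 2 + (\sum_i x 0 i * y 0 i) *+ 2)).
  rewrite -sumrMnl -!big_split /=; apply: ler_sum => i _.
  by rewrite mxE sqrrD; have -> : x 0 i ^+ 2 + x 0 i * y 0 i *+ 2 + y 0 i ^+ 2 =
    x 0 i ^+ 2 + y 0 i ^+ 2 + x 0 i * y 0 i *+ 2 by ring.
by rewrite lerD2l lerMn2r cauchy_schwarz orbT.
Qed.

Lemma enormZ k c (x : 'rV[R]_k) : enorm (c *: x) = `|c| * enorm x.
Proof.
rewrite /enorm -sqrtr_sqr -sqrtrM ?sqr_ge0 // mulr_sumr; congr Num.sqrt.
by apply: eq_bigr => i _; rewrite mxE exprMn.
Qed.

Lemma enorm_coord k (x : 'rV[R]_k) i : `|x 0 i| <= enorm x.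
Proof.
rewrite -sqrtr_sqr ler_sqrt; first by rewrite (bigD1 i) //= lerDl sumr_ge0 // => *; exact: sqr_ge0.
by apply: sumr_ge0 => *; exact: sqr_ge0.
Qed.

Lemma enorm_l1 k (x : 'rV[R]_k) : enorm x <= l1 x.
Proof.
rewrite -ler_sqr ?nnegrE ?enorm_ge0 ?l1_ge0 // sqr_enorm /l1.
elim: k x => [|k IH] x; first by rewrite !big_ord0 expr0n.
rewrite big_ord_recl [in X in _ <= X]big_ord_recl sqrrD.
have := IH (\row_i x 0 (lift ord0 i)).
under eq_bigr do rewrite mxE; under [in X in _ <= X]eq_bigr do rewrite mxE.
move=> h; rewrite -[x 0 ord0 ^+ 2]real_normK ?num_real //.
rewrite -addrA lerD2l; apply: le_trans h _; rewrite lerDr.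
by rewrite mulrn_wge0 // mulr_ge0 // sumr_ge0.
Qed.

Lemma l1_enorm k (x : 'rV[R]_k) : l1 x <= k%:R * enorm x.
Proof.
by apply: l1_le => i; exact: enorm_coord.
Qed.

Lemma borel_enorm k m (F : 'I_m -> 'rV[R]_k -> R) : (forall i, borel (F i)) ->
  borel (fun x => enorm (\row_i F i x)).
Proof.
move=> bF; apply: (borel_comp1 (h := Num.sqrt)).
  by apply: continuous_measurable_fun; exact: sqrt_continuous.
apply: borel_sum => i d S g mg; under eq_fun do rewrite mxE.
by apply: measurable_funX; apply: bF.
Qed.

End Enorm.

Section Deriv.
Variable R : realType.

Lemma gradE k (u : 'rV[R]_k -> R) x : grad u x = \row_i pd i u x.
Proof. by []. Qed.

(** At a zero of F the difference quotient of a power of order at least 2 is O(h) by the Lipschitz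
    bound alone, even if F has a kink there. *)
Lemma is_derive_pow_zero k (i : 'I_k) (F : 'rV[R]_k -> R) x p : llip F -> F x = 0 ->
  is_derive x (delta_mx 0 i) (fun y => F y ^+ p.+2) 0.
Proof.
move=> lF Fx.
have H : quot i (fun y => F y ^+ p.+2) x h @[h --> 0^'] --> (0 : R).
  have [L [L0 FL]] := lF (l1 x + 1); have [M FM] := llip_locbd lF (l1 x + 1).
  have M0 : 0 <= M by apply: le_trans (FM x _) => //; apply: in_cubeW (in_cube_l1 x); rewrite lerDl.
  apply/(@cvgrPdist_le _ R^o) => e e0; near=> h.
  rewrite sub0r normrN /quot Fx expr0n subr0 normrM normrV ?unitfE; last by near: h; exact: nbhs_dnbhs_neq.
  have h0 : 0 < `|h| by rewrite normr_gt0; near: h; exact: nbhs_dnbhs_neq.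
  have h1 : `|h| <= 1.
    near: h; apply: nbhs_dnbhs; near=> h; rewrite -[h]subr0 distrC; near: h.
    exact: (@cvgr_dist_le R R^o _ _ _ id 0 cvg_id).
  have he : `|h| <= e / (L ^+ 2 * M ^+ p + 1).
    near: h; apply: nbhs_dnbhs; near=> h; rewrite -[h]subr0 distrC; near: h.
    apply: (@cvgr_dist_le R R^o _ _ _ id 0 cvg_id).
    by rewrite divr_gt0 // ltr_wpDl // mulr_ge0 // exprn_ge0.
  set y := h *: delta_mx 0 i + x.
  have yc : in_cube (l1 x + 1) y.
    by apply: in_cubeW (shift_cube i h (in_cube_l1 x)); rewrite lerD2l.
  have Fy : `|F y| <= L * `|h|.
    rewrite -[F y]subr0 -Fx; apply: le_trans (FL _ _ yc _) _.
      by apply: in_cubeW (in_cube_l1 x); rewrite lerDl.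
    by rewrite l1_shift.
  rewrite ler_pdivrMl // normrX -addn2 exprD.
  apply: (@le_trans _ _ (M ^+ p * (L * `|h|) ^+ 2)).
    apply: ler_pM; rewrite ?exprn_ge0 //; apply: lerXn2r; rewrite ?nnegrE ?mulr_ge0 //.
    exact: FM.
  have C0 : 0 <= L ^+ 2 * M ^+ p by rewrite mulr_ge0 // exprn_ge0.
  move: he; rewrite ler_pdivlMr; last by rewrite ltr_wpDl.
  move=> he; rewrite exprMn (_ : M ^+ p * (L ^+ 2 * `|h| ^+ 2) = `|h| * (`|h| * (L ^+ 2 * M ^+ p))); last by ring.
  apply: ler_wpM2l => //; apply: le_trans he; apply: ler_wpM2l => //.
  by rewrite lerDl.
apply: DeriveDef; first by apply/cvg_ex; exists 0.
exact: (cvg_lim _ H).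
Unshelve. all: by end_near. Qed.

(** Meant for positive parts such as [cutoff] and g, whose derivative is only known where they are
    positive; powers of order at least 2 smooth the edge of the zero set. *)
Lemma is_derive_pow k (i : 'I_k) (F : 'rV[R]_k -> R) x p D : llip F ->
  (F x != 0 -> is_derive x (delta_mx 0 i) F D) ->
  is_derive x (delta_mx 0 i) (fun y => F y ^+ p.+2) (p.+2%:R * F x ^+ p.+1 * D).
Proof.
move=> lF hD; have [F0|/hD {}hD] := eqVneq (F x) 0.
  by rewrite F0 expr0n /= mulr0 mul0r; exact: is_derive_pow_zero.
by have := @is_deriveX R _ F p.+2 x (delta_mx 0 i) D hD; rewrite exprfctE.
Qed.

End Deriv.

(** * The integral estimate *)

Section TestFunctions.
Variable R : realType.

Lemma enorm_comb k (A B Z : 'rV[R]_k) al be c : 0 <= al -> 0 <= be ->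
  enorm (al *: A + be *: B + c *: Z) <= al * enorm A + be * enorm B + `|c| * enorm Z.
Proof.
move=> a0 b0; apply: le_trans (enormD _ _) _; rewrite enormZ lerD2r.
by apply: le_trans (enormD _ _) _; rewrite !enormZ !ger0_norm.
Qed.

(** Here a, b, z stand for |grad U1|, |grad U2|, |grad eta|, X for eta g^m, and p, pt for eta times
    the derivatives of s^m and of s^m - la s^(m+1) at s = g. Adding the two bounds leaves (pt - p +
    X) a = - sg X a and X ((1 + sg) e - 1 + la g) b. Since (1 + sg)(1 - 3 sg) <= 1 - 2 sg and la g
    <= sg, the latter is at most - sg X b; this is the origin of the factor 3. *)
Lemma excess_pair_bound (a b z E1 E2 X gm gt p pt e sg la g : R) :
  0 <= a -> 0 <= b -> 0 <= z -> 0 <= X -> 0 < sg -> sg <= 3%:R^-1 -> 0 <= e <= 1 - 3 * sg ->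
  0 <= la <= 1 -> 0 <= g <= sg -> gt <= gm -> p - pt = (1 + sg) * X ->
  E1 <= (1 - p) * a + (p * e) * b + gm * z - a + X * a ->
  E2 <= (1 - pt * e) * b + pt * a + gt * z - b - (X - la * g * X) * b ->
  E1 + E2 <= - sg * (X * (a + b)) + 2 * (gm * z).
Proof.
move=> a0 b0 z0 X0 sg0 sg3 /andP[e0 e1] /andP[l0 l1] /andP[g0 g1] gg pE h1 h2.
apply: le_trans (lerD h1 h2) _.
have -> : p = pt + (1 + sg) * X by lra.
have hz : gt * z <= gm * z by apply: ler_wpM2r.
have hlg : la * g <= sg by apply: le_trans (ler_piMl g0 l1) g1.
have hb : X * b * ((1 + sg) * e - 1 + la * g + sg) <= 0.
  apply: mulr_ge0_le0; first exact: mulr_ge0.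
  have : (1 + sg) * e <= (1 + sg) * (1 - 3 * sg) by apply: ler_wpM2l => //; lra.
  have : 0 <= sg * sg by apply: mulr_ge0; lra.
  lra.
have -> : (1 - (pt + (1 + sg) * X)) * a + (pt + (1 + sg) * X) * e * b + gm * z - a + X * a +
  ((1 - pt * e) * b + pt * a + gt * z - b - (X - la * g * X) * b) =
  - sg * (X * (a + b)) + X * b * ((1 + sg) * e - 1 + la * g + sg) + gm * z + gt * z by ring.
lra.
Qed.

Definition obox k (a b : 'rV[R]_k) : set 'rV[R]_k := [set x | forall i, a 0 i < x 0 i < b 0 i].

Lemma borel_set_forall k m (A : 'I_m -> set 'rV[R]_k) : (forall i, borel_set (A i)) ->
  borel_set [set x | forall i, A i x].
Proof.
elim: m A => [|m IH] A hA.
  by have := @borel_set_cst R k True; congr borel_set; apply/seteqP; split => // x _ [].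
rewrite (_ : [set x | _] = A ord0 `&` [set x | forall i, A (lift ord0 i) x]).
  by apply: borel_setI => //; exact: IH.
apply/seteqP; split => x /=; first by move=> h; split.
by move=> [h0 h] i; case: (unliftP ord0 i) => [j ->|->].
Qed.

Lemma borel_set_obox k (a b : 'rV[R]_k) : borel_set (obox a b).
Proof.
apply: borel_set_forall => i d S g mg.
have := mg i measurableT _ (measurable_itv `]a 0 i, b 0 i[).
by rewrite setTI; congr measurable; apply/seteqP; split => s /=; rewrite in_itv.
Qed.

Lemma obox_cube k (a b : 'rV[R]_k) x : obox a b x -> in_cube (l1 a + l1 b) x.
Proof.
move=> xab i; have /andP[h1 h2] := xab i.
have := l1_coord a i; have := l1_coord b i; rewrite !ler_norml.
by move=> /andP[? ?] /andP[? ?]; have := l1_ge0 a; have := l1_ge0 b; move=> ? ?;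
  apply/andP; split; lra.
Qed.

Lemma integrand_obox k (a b : 'rV[R]_k) (f : 'rV[R]_k -> R) : borel f -> locbd f ->
  integrand (fun x => \1_(obox a b) x * f x).
Proof.
move=> bf lf; apply: integrandM => //.
exists 1, (l1 a + l1 b); split => //.
- by rewrite addr_ge0 ?l1_ge0.
- by apply: borel_indic; exact: borel_set_obox.
- by move=> x; rewrite indicE; case: (_ \in _); rewrite ?normr1 ?normr0.
- move=> x; rewrite indicE; have [xb _|xb] := pselect (obox a b x).
    exact: obox_cube.
  by rewrite memNset // eqxx.
Qed.

(* [wtest] is the weak formulation for the competitor U + phi on an open box,
   after cancellation of the common terms. *)
Definition excess k (U phi : 'rV[R]_k -> R) (x : 'rV[R]_k) : R :=
  enorm (grad (fun y => U y + phi y) x) - enorm (grad U x) + phi x * enorm (grad U x).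

Definition wtest k (W U : 'rV[R]_k.+1 -> R) (s1 : R) : Prop :=
  forall (phi : 'rV[R]_k.+1 -> R) (a b : 'rV[R]_k.+1) (d : R),
    0 < d -> llip phi -> b 0 ord_max <= s1 ->
    (forall x, phi x != 0 -> forall i, a 0 i + d <= x 0 i <= b 0 i - d) ->
    0 <= iint (fun x => \1_(obox a b) x * (W x * excess U phi x)).

Lemma locbdD k (f g : 'rV[R]_k -> R) : locbd f -> locbd g -> locbd (fun x => f x + g x).
Proof.
move=> lf lg r; have [M hM] := lf r; have [M' hM'] := lg r; exists (M + M') => x xr.
by apply: le_trans (ler_normD _ _) _; apply: lerD; [exact: hM|exact: hM'].
Qed.

Lemma locbdN k (f : 'rV[R]_k -> R) : locbd f -> locbd (fun x => - f x).
Proof. by move=> lf r; have [M hM] := lf r; exists M => x xr; rewrite normrN; exact: hM. Qed.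

Lemma locbdM k (f g : 'rV[R]_k -> R) : locbd f -> locbd g -> locbd (fun x => f x * g x).
Proof.
move=> lf lg r; have [M hM] := lf r; have [M' hM'] := lg r; exists (`|M| * `|M'|) => x xr.
rewrite normrM; apply: ler_pM => //.
  exact: le_trans (hM _ xr) (ler_norm _).
exact: le_trans (hM' _ xr) (ler_norm _).
Qed.

Lemma borel_enorm_grad k (f : 'rV[R]_k -> R) : llip f -> borel (fun x => enorm (grad f x)).
Proof. by move=> lf; apply: (@borel_enorm R k k (fun i => pd i f)) => i; exact: borel_pd. Qed.

Lemma locbd_enorm_grad k (f : 'rV[R]_k -> R) : llip f -> locbd (fun x => enorm (grad f x)).
Proof.
move=> lf r; have /choice[M hM] (i : 'I_k) := llip_locbd_pd i lf r.
exists (\sum_i M i) => x xr; rewrite ger0_norm ?enorm_ge0 //.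
apply: le_trans (enorm_l1 _) _; apply: ler_sum => i _; rewrite mxE; exact: hM.
Qed.

Lemma borel_excess k (U phi : 'rV[R]_k -> R) : llip U -> llip phi -> borel (excess U phi).
Proof.
move=> lU lphi; apply: borelD.
  apply: borelB; apply: borel_enorm_grad => //; exact: llipD.
by apply: borelM; [exact: llip_borel|exact: borel_enorm_grad].
Qed.

Lemma locbd_excess k (U phi : 'rV[R]_k -> R) : llip U -> llip phi -> locbd (excess U phi).
Proof.
move=> lU lphi; apply: locbdD.
  apply: locbdD; first by apply: locbd_enorm_grad; exact: llipD.
  by apply: locbdN; exact: locbd_enorm_grad.
by apply: locbdM; [exact: llip_locbd|exact: locbd_enorm_grad].
Qed.

(** The last coordinate is left out: g bounds the support vertically, and a cutoff constant on
    vertical lines does not enter the vertical derivative used in the Poincare inequality. *)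
Definition paraboloid k (r : R) (x : 'rV[R]_k.+1) : R :=
  1 - r ^- 2 * \sum_(i | i != ord_max) x 0 i ^+ 2.
Definition cutoff k (r : R) (x : 'rV[R]_k.+1) : R := Num.max (paraboloid r x) 0.

Lemma llip_paraboloid k r : llip (@paraboloid k r).
Proof.
apply: llipB; first exact: llip_cst.
apply: llipM; first exact: llip_cst.
by apply: llip_sum => i; apply: llip_exp; exact: llip_coord.
Qed.

Lemma llip_cutoff k r : llip (@cutoff k r).
Proof. by apply: llip_max0; exact: llip_paraboloid. Qed.

Lemma cutoff_ge0 k r (x : 'rV[R]_k.+1) : 0 <= cutoff r x.
Proof. by rewrite /cutoff le_max lexx orbT. Qed.

Lemma sum_sqr_ge0 k (x : 'rV[R]_k.+1) : 0 <= \sum_(i | i != ord_max) x 0 i ^+ 2.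
Proof. by apply: sumr_ge0 => i _; exact: sqr_ge0. Qed.

Lemma cutoff_le1 k r (x : 'rV[R]_k.+1) : cutoff r x <= 1.
Proof.
rewrite /cutoff ge_max ler01 andbT /paraboloid gerBl mulr_ge0 ?sum_sqr_ge0 //.
by rewrite invr_ge0 sqr_ge0.
Qed.

Lemma cutoff_supp k r (x : 'rV[R]_k.+1) i : 0 < r -> cutoff r x != 0 -> i != ord_max ->
  `|x 0 i| <= r.
Proof.
move=> r0 cx im; rewrite leNgt; apply: contra cx => xr.
rewrite /cutoff; apply/eqP; apply: max_r; rewrite /paraboloid subr_le0.
rewrite mulrC ler_pdivlMr ?exprn_gt0 // mul1r (bigD1 i) //=.
apply: (@le_trans _ _ (x 0 i ^+ 2)).
  rewrite -[x 0 i ^+ 2]real_normK ?num_real //; apply: lerXn2r; rewrite ?nnegrE //; exact: ltW.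
by rewrite lerDl; apply: sumr_ge0 => j _; exact: sqr_ge0.
Qed.

Definition dcutoff k (r : R) (x : 'rV[R]_k.+1) (i : 'I_k.+1) : R :=
  if i == ord_max then 0 else - (r ^- 2 * (2 * x 0 i)).

Lemma paraboloid_shift k r (x : 'rV[R]_k.+1) i h :
  paraboloid r (h *: delta_mx 0 i + x) =
  paraboloid r x + h * (if i == ord_max then 0 else - (r ^- 2 * (2 * x 0 i + h))).
Proof.
rewrite /paraboloid -upd_addE; have [->|im] := eqVneq i ord_max.
  rewrite mulr0 addr0; congr (_ - _ * _); apply: eq_bigr => j jm.
  by rewrite updN.
rewrite (bigD1 i) //= [in RHS](bigD1 i) //= updE.
rewrite (eq_bigr (fun j => x 0 j ^+ 2)); first by ring.
by move=> j /andP[_ ji]; rewrite updN.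
Qed.

Lemma is_derive_cutoff k r (x : 'rV[R]_k.+1) i : cutoff r x != 0 ->
  is_derive x (delta_mx 0 i) (cutoff r) (dcutoff r x i).
Proof.
move=> cx; have px : 0 < paraboloid r x.
  by rewrite ltNge; apply: contra cx => h; rewrite /cutoff max_r.
have H : quot i (cutoff r) x h @[h --> 0^'] --> dcutoff r x i.
  have E : \forall h \near (0 : R)^', (if i == ord_max then 0 else - (r ^- 2 * (2 * x 0 i + h)))
      = quot i (cutoff r) x h.
    have P : \forall h \near (0 : R), 0 < paraboloid r (h *: delta_mx 0 i + x).
      have c := @llip_line_continuous R _ i (@paraboloid k r) x (@llip_paraboloid k r) (x 0 i).
      have : paraboloid r (upd x i (x 0 i + h)) @[h --> (0 : R)] --> paraboloid r x.
        have c0 : (x 0 i + h) @[h --> (0 : R)] --> x 0 i + 0.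
          by apply: cvgD; [exact: cvg_cst|exact: cvg_id].
        rewrite addr0 in c0; have := cvg_comp _ _ c0 c.
        by rewrite upd_id.
      move=> /cvgr_gt /(_ _ px); apply: filterS => h; by rewrite upd_addE.
    near=> h; have h0 : h != 0 by near: h; exact: nbhs_dnbhs_neq.
    have ph : 0 < paraboloid r (h *: delta_mx 0 i + x) by near: h; exact: nbhs_dnbhs.
    rewrite /quot /cutoff !max_l ?(ltW ph) ?(ltW px) // paraboloid_shift addrAC subrr add0r.
    by rewrite mulKf.
  apply: cvg_trans (near_eq_cvg E) _; rewrite /dcutoff.
  case: (i == ord_max); first exact: cvg_cst.
  have c0 : (2 * x 0 i + h) @[h --> (0 : R)^'] --> 2 * x 0 i + 0.
    by apply: cvgD; [exact: cvg_cst|exact: nbhs_dnbhs].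
  by rewrite addr0 in c0; apply: cvgN; apply: cvgMr.
apply: DeriveDef; first by apply/cvg_ex; exists (dcutoff r x i).
exact: (cvg_lim _ H).
Unshelve. all: by end_near. Qed.

End TestFunctions.

Section CoreEstimate.
Variable R : realType.
Local Notation mu := (@lebesgue_measure R).

Lemma integrand_pd k (i : 'I_k) (Phi : 'rV[R]_k -> R) r : llip Phi -> 0 <= r ->
  (forall x, Phi x != 0 -> in_cube r x) -> integrand (pd i Phi).
Proof.
move=> lPhi r0 supp; have [M PM] := llip_locbd_pd i lPhi r; exists `|M|, r; split => //.
- exact: borel_pd.
- move=> x; have [->|h] := eqVneq (pd i Phi x) 0; first by rewrite normr0.
  by apply: le_trans (PM _ _) (ler_norm _); apply: (pd_supp supp h).
- by move=> x; apply: pd_supp.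
Qed.

Lemma integrand_norm k (f : 'rV[R]_k -> R) : integrand f -> integrand (fun x => `|f x|).
Proof.
move=> [M [r [M0 r0 bf fM fr]]]; exists M, r; split => //.
- by apply: (borel_comp1 (h := fun t : R => `|t|)) => //; exact: normr_measurable.
- by move=> x; rewrite normr_id.
- by move=> x; rewrite normr_eq0 => /fr.
Qed.

Lemma integrand_llip k (f : 'rV[R]_k -> R) r : llip f -> 0 <= r ->
  (forall x, f x != 0 -> in_cube r x) -> integrand f.
Proof.
move=> lf r0 fr; have [M fM] := llip_locbd lf r; exists `|M|, r; split => //.
- exact: llip_borel.
- move=> x; have [->|/fr xr] := eqVneq (f x) 0; first by rewrite normr0.
  exact: le_trans (fM _ xr) (ler_norm _).
Qed.

Lemma iint_test k (f1 f2 Y Z : 'rV[R]_k -> R) (N : set 'rV[R]_k) a b :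
  nullset N -> integrand f1 -> integrand f2 -> integrand Y -> integrand Z ->
  0 <= iint f1 -> 0 <= iint f2 ->
  (forall x, ~ N x -> f1 x + f2 x <= a * Y x - b * Z x) -> b * iint Z <= a * iint Y.
Proof.
move=> nN i1 i2 iY iZ h1 h2 h.
have := addr_ge0 h1 h2; rewrite -(iintD i1 i2) => h3.
have := le_trans h3 (iint_le_off nN (integrandD i1 i2)
  (integrandB (integrandZ a iY) (integrandZ b iZ)) h).
by rewrite (iintB (integrandZ a iY) (integrandZ b iZ)) (iintZ a iY) (iintZ b iZ) subr_ge0.
Qed.

(** An abstract setting: g stands for the positive part of the truncation of U2 minus U1 minus a
    constant, and e for the derivative of the truncation. The gap between s0 and s1 leaves room for
    an open test box around the support of g. *)
Variables (k : nat) (W U1 U2 g e : 'rV[R]_k.+1 -> R) (Wm s0 s1 c sg : R).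
Hypotheses (lU1 : llip U1) (lU2 : llip U2) (lg : llip g).
Hypotheses (bW : borel W) (W1 : forall x, 1 <= W x) (WWm : forall x, W x <= Wm).
Hypotheses (t1 : wtest W U1 s1) (t2 : wtest W U2 s1) (s01 : s0 < s1) (cs0 : c <= s0).
Hypotheses (sg0 : 0 < sg) (sg3 : sg <= 3%:R^-1).
Hypotheses (g0 : forall x, 0 <= g x) (gsg : forall x, g x <= sg).
Hypothesis gm1 : forall x, k.+2%:R * g x <= 1.
Hypothesis gs : forall x, g x != 0 -> c <= x 0 ord_max <= s0.
Hypothesis eb : forall x, 0 <= e x <= 1 - 3 * sg.
Hypothesis gD : forall x i, g x != 0 -> pdable i U1 x -> pdable i U2 x ->
  is_derive x (delta_mx 0 i) g (e x * pd i U2 x - pd i U1 x).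

Local Notation m := k.+2.
(* Chosen so that the derivatives of g^m and g^m - la g^m.+1 differ by exactly
   (1 + sg) g^m; the surplus sg g^m is what controls the gradients. *)
Let la : R := (1 + sg) / m.+1%:R.

Let la01 : 0 <= la <= 1.
Proof.
have h3 : (0 : R) < m.+1%:R by [].
apply/andP; split; first by apply: divr_ge0 => //; move: sg0; lra.
rewrite /la ler_pdivrMr // mul1r; apply: (@le_trans _ _ 2); first by move: sg3; lra.
by rewrite ler_nat.
Qed.

Let g1 x : g x <= 1.
Proof. by apply: le_trans (gsg x) _; move: sg3; lra. Qed.

Section Radius.
Variable r : R.
Hypothesis r1 : 1 <= r.
Let r0 : 0 < r. Proof. exact: lt_le_trans r1. Qed.

(** The power m + 1 makes |grad eta| at most a constant times zeta^m / r. Hence g^m |grad eta| is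
    controlled by (zeta g)^m, while eta g^(m+1) is exactly (zeta g)^(m+1). *)
Let et (x : 'rV[R]_k.+1) := cutoff r x ^+ m.+1 : R.
Let y (x : 'rV[R]_k.+1) := cutoff r x * g x : R.
Let gt (x : 'rV[R]_k.+1) := g x ^+ m - la * g x ^+ m.+1 : R.
Let phi1 (x : 'rV[R]_k.+1) := et x * g x ^+ m : R.
Let phi2 (x : 'rV[R]_k.+1) := - (et x * gt x) : R.
Let P (x : 'rV[R]_k.+1) := et x * g x ^+ m * (enorm (grad U1 x) + enorm (grad U2 x)) : R.

Let llip_et : llip et. Proof. by apply: llip_exp; exact: llip_cutoff. Qed.
Let ly : llip y. Proof. by apply: llipM => //; exact: llip_cutoff. Qed.
Let lphi1 : llip phi1. Proof. by apply: llipM => //; exact: llip_exp. Qed.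
Let lphi2 : llip phi2.
Proof.
apply: llipN; apply: llipM => //; apply: llipB; first exact: llip_exp.
by apply: llipM; [exact: llip_cst|exact: llip_exp].
Qed.

Let rho : R := r + `|c| + `|s0|.
Let rho0 : 0 <= rho.
Proof. by rewrite /rho !addr_ge0 // ltW. Qed.

Lemma y_supp x : y x != 0 -> (forall i, i != ord_max -> `|x 0 i| <= r) /\ c <= x 0 ord_max <= s0.
Proof.
rewrite mulf_eq0 negb_or => /andP[zx gx]; split; last exact: gs.
by move=> i im; exact: cutoff_supp zx im.
Qed.

Lemma y_supp_cube x : y x != 0 -> in_cube rho x.
Proof.
move=> /y_supp[h1 /andP[h2 h3]] i; rewrite /rho; have [->|im] := eqVneq i ord_max.
  have := ler_norm s0; have := ler_norm (- c); rewrite normrN ler_norml.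
  have := normr_ge0 c; have := normr_ge0 s0; have := r0.
  by move=> ? ? ? ? ?; apply/andP; split; lra.
by apply: le_trans (h1 i im) _; rewrite -addrA lerDl addr_ge0.
Qed.

Let y0P x : y x = 0 -> cutoff r x = 0 \/ g x = 0.
Proof. by move=> /eqP; rewrite /y [_ == _]mulf_eq0 => /orP[]/eqP ->; [left|right]. Qed.

Lemma phi1_y x : phi1 x != 0 -> y x != 0.
Proof.
by apply: contraNneq => /y0P[]h; rewrite /phi1 /et h expr0n /= ?mulr0 ?mul0r.
Qed.

Lemma phi2_y x : phi2 x != 0 -> y x != 0.
Proof.
apply: contraNneq => /y0P[]h; rewrite /phi2 /et /gt h !expr0n /=.
  by rewrite mul0r oppr0.
by rewrite mulr0 subrr mulr0 oppr0.
Qed.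

Let gt_le x : gt x <= g x ^+ m.
Proof.
have /andP[? ?] := la01; rewrite /gt lerBlDr lerDl mulr_ge0 // exprn_ge0 //.
Qed.

Let et01 x : 0 <= et x <= 1.
Proof.
rewrite /et exprn_ge0 ?cutoff_ge0 //=; apply: exprn_ile1; first exact: cutoff_ge0.
exact: cutoff_le1.
Qed.

Lemma is_derive_et x i : is_derive x (delta_mx 0 i) et (m.+1%:R * cutoff r x ^+ m * dcutoff r x i).
Proof.
apply: (@is_derive_pow R _ i (cutoff r) x k.+1); first exact: llip_cutoff.
exact: is_derive_cutoff.
Qed.

Lemma pd_et x i : pd i et x = m.+1%:R * cutoff r x ^+ m * dcutoff r x i.
Proof. by rewrite /pd; have [_ ->] := is_derive_et x i. Qed.

(** Where the cutoff is positive each of its k + 1 partial derivatives is at most 2 / r in absolute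
    value; the power contributes the factor m + 1. *)
Let Ceta : R := 2 * m.+1%:R * k.+1%:R.

Lemma enorm_grad_et x : enorm (grad et x) <= Ceta / r * cutoff r x ^+ m.
Proof.
apply: le_trans (enorm_l1 _) _.
apply: (@le_trans _ _ (\sum_(i < k.+1) (2 * m.+1%:R / r * cutoff r x ^+ m))).
  apply: ler_sum => i _; rewrite mxE -/(pd i et x) pd_et.
  have [zx|zx] := eqVneq (cutoff r x) 0; first by rewrite zx expr0n /= !mulr0 mul0r normr0.
  have zm : 0 <= cutoff r x ^+ m by rewrite exprn_ge0 // cutoff_ge0.
  rewrite normrM ger0_norm; last by rewrite mulr_ge0.
  rewrite (_ : 2 * m.+1%:R / r * _ = m.+1%:R * cutoff r x ^+ m * (2 / r)); last by ring.
  apply: ler_wpM2l; first by rewrite mulr_ge0.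
  rewrite /dcutoff; case: eqVneq => [_|im]; first by rewrite normr0 divr_ge0 // ltW.
  rewrite normrN !normrM normrV ?unitfE ?expf_neq0 ?gt_eqF // normrX (gtr0_norm r0) normr_nat.
  have := cutoff_supp r0 zx im => xi.
  rewrite (_ : 2 / r = r ^- 2 * (2 * r)); last by field; rewrite gt_eqF.
  by apply: ler_wpM2l; [rewrite invr_ge0 sqr_ge0|apply: ler_wpM2l].
rewrite sumr_const card_ord -[X in X <= _]mulr_natr /Ceta.
by rewrite le_eqVlt; apply/orP; left; apply/eqP; ring.
Qed.

Lemma is_derive_gpow x i p : pdable i U1 x -> pdable i U2 x ->
  is_derive x (delta_mx 0 i) (fun z => g z ^+ p.+2)
   (p.+2%:R * g x ^+ p.+1 * (e x * pd i U2 x - pd i U1 x)).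
Proof.
move=> h1 h2; exact: (@is_derive_pow R _ i g x p _ lg (fun gx => gD gx h1 h2)).
Qed.

Lemma is_derive_U (U : 'rV[R]_k.+1 -> R) x i : pdable i U x ->
  is_derive x (delta_mx 0 i) U (pd i U x).
Proof. by move=> h; exact: DeriveDef. Qed.

Lemma grad_phi1 x : (forall i, pdable i U1 x) -> (forall i, pdable i U2 x) ->
  let p := et x * (m%:R * g x ^+ k.+1) in
  grad (fun z => U1 z + phi1 z) x =
  (1 - p) *: grad U1 x + (p * e x) *: grad U2 x + g x ^+ m *: grad et x.
Proof.
move=> h1 h2 p; apply/rowP => i; rewrite !mxE.
have D1 := is_derive_U (h1 i); have D2 := is_derive_gpow k (h1 i) (h2 i).
have D3 := is_derive_et x i.
have D4 := is_deriveM D3 D2; have [_] := is_deriveD D1 D4.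
rewrite -[U1 + _]/(fun z => U1 z + phi1 z) => ->.
rewrite -!/(pd _ _ _) pd_et /GRing.scale /= /p; ring.
Qed.

Lemma grad_phi2 x : (forall i, pdable i U1 x) -> (forall i, pdable i U2 x) ->
  let pt := et x * (m%:R * g x ^+ k.+1 - la * m.+1%:R * g x ^+ m) in
  grad (fun z => U2 z + phi2 z) x =
  (1 - pt * e x) *: grad U2 x + pt *: grad U1 x + (- gt x) *: grad et x.
Proof.
move=> h1 h2 pt; apply/rowP => i; rewrite !mxE.
have D1 := is_derive_U (h2 i); have D2 := is_derive_gpow k (h1 i) (h2 i).
have D2' := is_deriveM (is_derive_cst la x (delta_mx 0 i)) (is_derive_gpow k.+1 (h1 i) (h2 i)).
have D3 := is_derive_et x i.
have D4 := is_deriveN (is_deriveM D3 (is_deriveB D2 D2')); have [_] := is_deriveD D1 D4.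
rewrite (_ : U2 + _ = (fun z => U2 z + phi2 z)) => [->|].
  rewrite -!/(pd _ _ _) pd_et /GRing.scale /= /pt /gt.
  rewrite -[(_ - _ * _) x]/(g x ^+ m - la * g x ^+ k.+3).
  ring.
by [].
Qed.

Lemma sum_excess x : (forall i, pdable i U1 x) -> (forall i, pdable i U2 x) ->
  excess U1 phi1 x + excess U2 phi2 x <=
  - sg * P x + 2 * (g x ^+ m * enorm (grad et x)).
Proof.
move=> h1 h2; rewrite /excess /P.
pose X := et x * g x ^+ m.
pose p := et x * (m%:R * g x ^+ k.+1).
pose pt := et x * (m%:R * g x ^+ k.+1 - la * m.+1%:R * g x ^+ m).
have /andP[et0 et1] := et01 x; have gx0 := g0 x; have gx1 := g1 x.
have gk0 : 0 <= g x ^+ k.+1 by rewrite exprn_ge0.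
have gm0 : 0 <= g x ^+ m by rewrite exprn_ge0.
have laE : la * m.+1%:R = 1 + sg by rewrite /la divfK // pnatr_eq0.
have p0 : 0 <= p by apply: mulr_ge0 => //; apply: mulr_ge0.
(* Since g <= 1, one has g^(m-1) <= g, and m g <= 1 makes the coefficient 1 - p of grad U1
   nonnegative. *)
have p1 : p <= 1.
  rewrite /p; apply: mulr_ile1 => //; first by rewrite mulr_ge0.
  apply: le_trans (gm1 x); apply: ler_wpM2l => //.
  by rewrite exprS ler_piMr // exprn_ile1.
have pt0 : 0 <= pt.
  rewrite /pt laE; apply: mulr_ge0 => //.
  have -> : m%:R * g x ^+ k.+1 - (1 + sg) * g x ^+ m = g x ^+ k.+1 * (m%:R - (1 + sg) * g x).
    by rewrite [g x ^+ m]exprS; ring.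
  apply: mulr_ge0 => //.
  have : (2 : R) <= m%:R by rewrite ler_nat.
  have : (1 + sg) * g x <= 2 * 1 by apply: ler_pM => //; move: sg0 sg3; lra.
  lra.
have ptp : pt <= p.
  rewrite /pt /p; apply: ler_wpM2l => //; rewrite laE gerBl mulr_ge0 //; move: sg0; lra.
have /andP[e0 e1] := eb x.
have gtx := gt_le x.
have gt0 : 0 <= gt x.
  have /andP[? la1] := la01; rewrite /gt.
  have -> : g x ^+ m - la * g x ^+ m.+1 = g x ^+ m * (1 - la * g x).
    by rewrite [g x ^+ m.+1]exprS; ring.
  by apply: mulr_ge0 => //; rewrite subr_ge0 mulr_ile1.
apply: (@excess_pair_bound R (enorm (grad U1 x)) (enorm (grad U2 x)) (enorm (grad et x)) _ _
   X (g x ^+ m) (gt x) p pt (e x) sg la (g x)) => //; try exact: enorm_ge0.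
- by rewrite /X mulr_ge0.
- by rewrite gx0 gsg.
- by rewrite /p /pt /X -laE; ring.
- rewrite lerD2r lerD2r grad_phi1 //.
  have q0 : 0 <= 1 - p by rewrite subr_ge0.
  have pe0 : 0 <= p * e x by apply: mulr_ge0.
  by have := enorm_comb (grad U1 x) (grad U2 x) (grad et x) (g x ^+ m) q0 pe0; rewrite (ger0_norm gm0).
- have -> : phi2 x = - (X - la * g x * X) by rewrite /phi2 /gt /X [g x ^+ m.+1]exprS; ring.
  rewrite mulNr lerD2r lerD2r grad_phi2 //.
  have q0 : 0 <= 1 - pt * e x.
    rewrite subr_ge0; apply: mulr_ile1 => //; first exact: le_trans p1.
    by apply: le_trans e1 _; move: sg0; lra.
  by have := enorm_comb (grad U2 x) (grad U1 x) (grad et x) (- gt x) q0 pt0; rewrite normrN (ger0_norm gt0).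
Qed.

Let N : set 'rV[R]_k.+1 := [set x | exists i, ~ pdable i U1 x] `|` [set x | exists i, ~ pdable i U2 x].

Let nullN : nullset N.
Proof.
by apply: nullsetU; apply: (nullset_bigU (N := fun i => [set x | ~ pdable i _ x])) => i;
  exact: nullset_not_pdable.
Qed.

Let offN x : ~ N x -> (forall i, pdable i U1 x) /\ (forall i, pdable i U2 x).
Proof.
move=> nN; split => i; apply: contrapT => h; apply: nN; [left|right]; by exists i.
Qed.

Let P_ge0 x : 0 <= P x.
Proof.
have /andP[? ?] := et01 x.
by apply: mulr_ge0; [apply: mulr_ge0 => //; exact: exprn_ge0|apply: addr_ge0; exact: enorm_ge0].
Qed.

Let hphi1 : integrand phi1.
Proof. by apply: (integrand_llip lphi1 rho0) => x /phi1_y /y_supp_cube. Qed.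

Let hP : integrand P.
Proof.
apply: integrandM => //; first by apply: borelD; exact: borel_enorm_grad.
by apply: locbdD; exact: locbd_enorm_grad.
Qed.

Let hym p : integrand (fun x => y x ^+ p.+1).
Proof.
apply: (@integrand_llip _ _ rho) => //; first exact: llip_exp.
by move=> x; rewrite expf_eq0 /= => /y_supp_cube.
Qed.

Lemma test_bound : sg * iint P <= 2 * Wm * Ceta / r * iint (fun x => y x ^+ m).
Proof.
(* The top face lies at s1, the other faces at distance at least 1 from the support, so d is a
   margin on all sides. *)
pose a0 : 'rV[R]_k.+1 := const_mx (- (r + `|c| + `|s0| + 1)).
pose b0 : 'rV[R]_k.+1 := \row_i if i == ord_max then s1 else r + 1.
pose d := Num.min 1 (s1 - s0).
have d0 : 0 < d by rewrite lt_min ltr01 subr_gt0.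
have d1 : d <= 1 by rewrite ge_min lexx.
have ds : d <= s1 - s0 by rewrite ge_min lexx orbT.
have b0m : b0 0 ord_max <= s1 by rewrite mxE eqxx.
have supp x : y x != 0 -> forall i, a0 0 i + d <= x 0 i <= b0 0 i - d.
  move=> /y_supp[h1 /andP[h2 h3]] i; rewrite !mxE.
  have c0 := normr_ge0 c; have s00 := normr_ge0 s0; have nc : - c <= `|c| by rewrite -normrN ler_norm.
  have r0' := r0; have [->|im] := eqVneq i ord_max; first by apply/andP; split; lra.
  by have := h1 i im; rewrite ler_norml => /andP[? ?]; apply/andP; split; lra.
pose K := obox a0 b0.
have suppK x : y x != 0 -> K x.
  by move=> /supp h i; have /andP[? ?] := h i; apply/andP; split; lra.
have lbW : locbd W.
  by move=> ?; exists Wm => x _; rewrite ger0_norm //; exact: le_trans (W1 x).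
pose f1 x : R := \1_K x * (W x * excess U1 phi1 x).
pose f2 x : R := \1_K x * (W x * excess U2 phi2 x).
have i1 : 0 <= iint f1 := t1 d0 lphi1 b0m (fun x h => supp x (phi1_y h)).
have i2 : 0 <= iint f2 := t2 d0 lphi2 b0m (fun x h => supp x (phi2_y h)).
have h1 : integrand f1.
  by apply: integrand_obox; [apply: (borelM bW); exact: borel_excess|apply: locbdM => //; exact: locbd_excess].
have h2 : integrand f2.
  by apply: integrand_obox; [apply: (borelM bW); exact: borel_excess|apply: locbdM => //; exact: locbd_excess].
have Wm0 : 0 <= Wm by apply: le_trans (WWm 0); apply: le_trans (W1 0).
have C0 : 0 <= 2 * Wm * Ceta / r by rewrite /Ceta !mulr_ge0 // invr_ge0 ltW.
apply: (iint_test nullN h1 h2 (hym k.+1) hP i1 i2) => x.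
move=> /offN[pd1 pd2]; rewrite /f1 /f2 -mulrDr -mulrDr.
have ym0 : 0 <= y x ^+ m by rewrite exprn_ge0 // mulr_ge0 // cutoff_ge0.
rewrite indicE; have [xK|xK] := pselect (K x); last first.
  rewrite memNset // mul0r subr_ge0.
  have -> : P x = 0.
    rewrite /P -/(phi1 x) (_ : phi1 x = 0) ?mul0r //; apply/eqP; apply: contraT => /phi1_y /suppK //.
  by rewrite mulr0 mulr_ge0.
rewrite mem_set // mul1r.
have W0 : 0 <= W x by apply: le_trans (W1 x).
apply: le_trans (ler_wpM2l W0 (sum_excess pd1 pd2)) _.
have hg : g x ^+ m * enorm (grad et x) <= Ceta / r * y x ^+ m.
  have -> : Ceta / r * y x ^+ m = g x ^+ m * (Ceta / r * cutoff r x ^+ m).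
    by rewrite /y exprMn; ring.
  by apply: ler_wpM2l; [rewrite exprn_ge0|exact: enorm_grad_et].
have hP0 := P_ge0 x; have hW1 := W1 x; have hW2 := WWm x.
(* The weight is estimated by Wm in the error term and by 1 in the gradient term, which has the
   favourable sign. *)
have e1 : W x * (2 * (g x ^+ m * enorm (grad et x))) <= Wm * (2 * (Ceta / r * y x ^+ m)).
  have q0 : 0 <= 2 * (g x ^+ m * enorm (grad et x)).
    by rewrite mulr_ge0 // mulr_ge0 ?enorm_ge0 // exprn_ge0.
  exact: (ler_pM W0 q0 hW2 (ler_wpM2l (ler0n R 2) hg)).
have e2 : sg * P x <= W x * (sg * P x).
  by rewrite ler_peMl // mulr_ge0 // ltW.
have -> : 2 * Wm * Ceta / r * y x ^+ m = Wm * (2 * (Ceta / r * y x ^+ m)) by ring.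
rewrite mulrDr mulNr mulrN addrC; exact: (lerB e1 e2).
Qed.

(** On a vertical line y^(m+1) is at most the integral of its derivative in absolute value, and s0 -
    c is the length of its support. Only g varies along the line, and e <= 1 bounds its derivative
    by |grad U1| + |grad U2|. *)
Lemma poincare : iint (fun x => y x ^+ m.+1) <= (s0 - c) * m.+1%:R * iint P.
Proof.
pose Phi x : R := y x ^+ m.+1.
have lPhi : llip Phi by exact: llip_exp.
have suppPhi x : Phi x != 0 -> in_cube rho x.
  by rewrite /Phi expf_eq0 /= => /y_supp_cube.
have sc : 0 <= s0 - c by rewrite subr_ge0.
have habs : integrand (fun x => `|pd ord_max Phi x|).
  exact: (integrand_norm (integrand_pd _ lPhi rho0 suppPhi)).
have step1 : iint Phi <= iint (fun x => (s0 - c) * `|pd ord_max Phi x|).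
  apply: (iint_line_le (i := ord_max)); [exact: hym|exact: integrandZ|].
  move=> x; pose A := Rintegral mu setT (fun s => `|pd ord_max Phi (upd x ord_max s)|).
  have [M hD] := line_pd_bounded_compact ord_max lPhi suppPhi x.
  have A0 : 0 <= A by apply: Rintegral_ge0.
  rewrite (Rintegral_bounded_compactZ _ (bounded_compact_norm hD)) -/A.
  have hI : bounded_compact (fun s => \1_(`[c, s0]%classic) s : R) 1 (`|c| + `|s0|).
    by apply: itv_bounded_compact; rewrite ?lerDl ?lerDr.
  have hAI := bounded_compactZ A hI.
  apply: (@le_trans _ _ (Rintegral mu setT (fun s => A * \1_(`[c, s0]%classic) s))).
    apply: le_Rintegral => //; last 1 first.
    - move=> s _; have [z|nz] := eqVneq (Phi (upd x ord_max s)) 0.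
        by rewrite z mulr_ge0 // indicE; case: (_ \in _).
      have := nz; rewrite /Phi expf_eq0 /= => /y_supp[_]; rewrite updE => hs.
      rewrite indicE mem_setE in_itv /= hs mulr1.
      apply: le_trans (ler_norm _) _; exact: (line_ftc_bound _ lPhi rho0 suppPhi).
    - have [M' [r' [M'0 r'0 bP PM' Pr]]] := hym m.
      apply: (@bounded_compact_integrable _ _ M' r'); split.
      + by apply: (bP _ _ (fun s => upd x ord_max s)) => j; exact: measurable_upd.
      + by move=> s; exact: PM'.
      + by move=> s /Pr/(_ ord_max); rewrite updE.
    - exact: bounded_compact_integrable hAI.
  by rewrite (Rintegral_bounded_compactZ _ hI) (Rintegral_itv cs0) mulrC.
apply: le_trans step1 _; rewrite iintZ // -mulrA; apply: ler_wpM2l => //.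
rewrite -iintZ //; apply: (iint_le_off nullN) => //; first exact: integrandZ.
move=> x /offN[h1 h2].
have D2 := is_derive_gpow k.+1 (h1 ord_max) (h2 ord_max); have D3 := is_derive_et x ord_max.
have [_] := is_deriveM D3 D2.
rewrite (_ : et * _ = Phi); last first.
  by apply/funext => z; rewrite /Phi /y exprMn.
rewrite -/(pd _ _ _) => ->; rewrite /dcutoff eqxx mulr0 scaler0 addr0 /GRing.scale /=.
have /andP[et0 _] := et01 x; have /andP[e0 e1] := eb x.
have gm0 : 0 <= g x ^+ m by rewrite exprn_ge0.
pose q := et x * (m.+1%:R * g x ^+ m).
have q0 : 0 <= q by apply: mulr_ge0 => //; apply: mulr_ge0.
pose z := e x * pd ord_max U2 x - pd ord_max U1 x.
rewrite (_ : et x * (m.+1%:R * g x ^+ m * _) = q * z); last by rewrite /q /z; ring.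
rewrite (normrM q z) (ger0_norm q0) /P.
rewrite (_ : m.+1%:R * (et x * g x ^+ m * _) = q * (enorm (grad U1 x) + enorm (grad U2 x))); last by rewrite /q; ring.
apply: ler_wpM2l => //; rewrite /z.
apply: le_trans (ler_normB _ _) _; rewrite addrC; apply: lerD.
  by have := enorm_coord (grad U1 x) ord_max; rewrite mxE.
rewrite normrM (ger0_norm e0).
apply: (@le_trans _ _ (1 * `|pd ord_max U2 x|)).
  by apply: ler_wpM2r => //; apply: le_trans e1 _; move: sg0; lra.
by rewrite mul1r; have := enorm_coord (grad U2 x) ord_max; rewrite mxE.
Qed.

(** A gathers the Poincare constant, the cutoff constant and 1 / sg. Q adds the volume of a cube
    containing the support, with the powers of r removed; neither depends on r. *)
Let A : R := (s0 - c) * m.+1%:R * (2 * Wm * Ceta) / sg.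
Let Q : R := (2 * A) ^+ m.+1 * (2 * (1 + `|c| + `|s0|)) ^+ k.+1.

Let A0 : 0 <= A.
Proof.
have Wm0 : 0 <= Wm by apply: le_trans (WWm 0); apply: le_trans (W1 0).
apply: divr_ge0; last exact: ltW.
apply: mulr_ge0; first by apply: mulr_ge0 => //; rewrite subr_ge0.
by rewrite /Ceta !mulr_ge0.
Qed.

Lemma power_bound : iint (fun x => y x ^+ m.+1) <= A / r * iint (fun x => y x ^+ m).
Proof.
apply: le_trans poincare _.
have h : iint P <= 2 * Wm * Ceta / r / sg * iint (fun x => y x ^+ m).
  have aux (T I J : R) : sg * I <= T * J -> I <= T / sg * J.
    by move=> h; rewrite (_ : T / sg * J = sg^-1 * (T * J)); [rewrite ler_pdivlMl|ring].
  exact: (aux _ _ _ test_bound).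
have h0 : 0 <= (s0 - c) * m.+1%:R by apply: mulr_ge0 => //; rewrite subr_ge0.
apply: le_trans (ler_wpM2l h0 h) _; rewrite le_eqVlt; apply/orP; left; apply/eqP.
by rewrite /A; ring.
Qed.

Lemma decay_bound : iint (fun x => y x ^+ m.+1) <= Q / r.
Proof.
pose a0 : 'rV[R]_k.+1 := const_mx (- rho); pose b0 : 'rV[R]_k.+1 := const_mx rho.
have ab i : a0 0 i <= b0 0 i by rewrite !mxE; move: rho0; lra.
have hB := integrand_box a0 b0.
pose D := A / r * (2 * A / r) ^+ m.
have Ar0 : 0 <= A / r by apply: divr_ge0 => //; exact: ltW.
(* Split at the height 2 A / r: above it half of y^(m+1) absorbs the left side, below it D bounds
   the left side. *)
have young x : A / r * y x ^+ m <= 2^-1 * y x ^+ m.+1 + D * \1_(box a0 b0) x.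
  have y0 : 0 <= y x by apply: mulr_ge0 => //; exact: cutoff_ge0.
  have D0 : 0 <= D by apply: mulr_ge0 => //; apply: exprn_ge0; rewrite -mulrA mulr_ge0.
  have [z|nz] := eqVneq (y x) 0.
    rewrite z !expr0n /= !mulr0 add0r mulr_ge0 // indicE; by case: (_ \in _).
  have xb : box a0 b0 x.
    by move=> i; rewrite !mxE -ler_norml; exact: (y_supp_cube nz).
  rewrite indicE mem_set // mulr1.
  have [h|h] := leP (2 * A / r) (y x).
    have : A / r * y x ^+ m <= 2^-1 * y x ^+ m.+1; last by lra.
    rewrite (exprS (y x) m) (mulrA 2^-1); apply: (ler_wpM2r (exprn_ge0 m y0)).
    by move: h; rewrite -mulrA; lra.
  have : A / r * y x ^+ m <= D.
    have A2 : 0 <= 2 * A / r by rewrite -mulrA mulr_ge0.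
    by apply: ler_wpM2l => //; apply: lerXn2r; rewrite ?nnegrE // ltW.
  have : 0 <= y x ^+ m.+1 by exact: exprn_ge0.
  lra.
have h1 : iint (fun x => A / r * y x ^+ m) <=
    iint (fun x => 2^-1 * y x ^+ m.+1 + D * \1_(box a0 b0) x).
  apply: iint_le => //; first exact: integrandZ (hym k.+1).
  by apply: integrandD; apply: integrandZ => //; exact: (hym k.+2).
rewrite (iintZ _ (hym k.+1)) (iintD (integrandZ _ (hym k.+2)) (integrandZ _ hB)) in h1.
rewrite (iintZ _ (hym k.+2)) (iintZ _ hB) (iint_box ab) in h1.
have h2 := le_trans power_bound h1.
have vol : box_vol a0 b0 = (2 * rho) ^+ k.+1.
  rewrite /box_vol (eq_bigr (fun=> 2 * rho)); last by move=> i _; rewrite !mxE; ring.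
  by rewrite prodr_const card_ord.
rewrite vol in h2.
have h3 : iint (fun x => y x ^+ m.+1) <= 2 * D * (2 * rho) ^+ k.+1 by lra.
apply: le_trans h3 _.
have rr : rho <= r * (1 + `|c| + `|s0|).
  rewrite /rho !mulrDr mulr1 lerD //; last by rewrite ler_peMl.
  by rewrite lerD // ler_peMl.
have h4 : (2 * rho) ^+ k.+1 <= (r * (2 * (1 + `|c| + `|s0|))) ^+ k.+1.
  apply: lerXn2r; rewrite ?nnegrE.
  - by apply: mulr_ge0 => //; exact: rho0.
  - by rewrite !mulr_ge0 ?addr_ge0 // ltW.
  - by rewrite mulrCA; apply: ler_wpM2l.
have D0 : 0 <= 2 * D.
  by apply: mulr_ge0 => //; apply: mulr_ge0 => //; apply: exprn_ge0; rewrite -mulrA mulr_ge0.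
apply: le_trans (ler_wpM2l D0 h4) _.
have -> : 2 * D = (2 * A) ^+ m.+1 * (r^-1) ^+ m.+1.
  by rewrite /D -exprMn [in RHS]exprS; ring.
(* As m + 1 = 2 + (k + 1), the volume consumes k + 1 factors 1 / r and two are left. *)
have aux (a b : R) : a * r^-1 ^+ m.+1 * (r * b) ^+ k.+1 = a * b ^+ k.+1 * (r^-1 * r^-1).
  have rV : r^-1 * r = 1 by rewrite mulVf // gt_eqF.
  rewrite exprMn -[m.+1]/(2 + k.+1)%N exprD -[RHS]mulr1.
  have <- : r^-1 ^+ k.+1 * r ^+ k.+1 = 1 by rewrite -exprMn rV expr1n.
  by move: (r^-1 ^+ k.+1) (r ^+ k.+1) (b ^+ k.+1) => ? ? ?; rewrite expr2; ring.
rewrite aux /Q; apply: ler_wpM2l.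
  by rewrite mulr_ge0 // exprn_ge0 // mulr_ge0 // ?addr_ge0.
have rV1 : r^-1 <= 1 by rewrite invf_le1.
by apply: ler_piMr => //; rewrite invr_ge0 ltW.
Qed.

End Radius.

(** A positive value of g persists on a small fixed box, on which the cutoff is at least 1/2 for
    large r. The integral of (zeta g)^(m+1) then stays above ka, against the bound Q / r. *)
Lemma truncated_difference_zero x0 : g x0 = 0.
Proof.
apply/eqP; apply: contraT => gx0.
pose ga := g x0; have ga0 : 0 < ga by rewrite lt_neqAle eq_sym gx0 g0.
have ga2 : 0 < ga / 2 by rewrite divr_gt0.
have [de /andP[de0 de1] hde] := llip_at x0 lg ga2.
pose a0 : 'rV[R]_k.+1 := \row_i (x0 0 i - de).
pose b0 : 'rV[R]_k.+1 := \row_i (x0 0 i + de).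
have ab i : a0 0 i <= b0 0 i by rewrite !mxE; lra.
have bx x : box a0 b0 x -> in_cube (l1 x0 + 1) x /\ ga / 2 <= g x.
  move=> xb; have xd i : `|x 0 i - x0 0 i| <= de.
    by have := xb i; rewrite !mxE ler_norml => /andP[? ?]; apply/andP; split; lra.
  split; first by apply: in_cubeW (in_cube_near xd); rewrite lerD2l.
  by have := hde x xd; rewrite ler_norml -/ga => /andP[]; lra.
pose M := l1 x0 + 1; have M1 : 1 <= M by rewrite /M lerDr l1_ge0.
(* ga / 4 is the lower bound ga / 2 for g times the lower bound 1/2 for the cutoff. *)
pose ka := (ga / 4%:R) ^+ m.+1 * box_vol a0 b0.
have vol0 : 0 < box_vol a0 b0 by apply: prodr_gt0 => i _; rewrite !mxE; lra.
have ka0 : 0 < ka by rewrite mulr_gt0 // exprn_gt0 // divr_gt0.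
have lower r : 2 * k.+1%:R * M <= r -> ka <= iint (fun x => (cutoff r x * g x) ^+ m.+1).
  move=> rM; have kk : (1 : R) <= k.+1%:R by rewrite ler1n.
  have r1 : 1 <= r by apply: le_trans rM; nra.
  rewrite /ka -iint_box // -iintZ; last exact: integrand_box.
  apply: iint_le; first by apply: integrandZ; exact: integrand_box.
    apply: (@integrand_llip _ _ (r + `|c| + `|s0|)).
    - by apply: llip_exp; apply: llipM => //; exact: llip_cutoff.
    - by rewrite !addr_ge0 //; lra.
    - by move=> x; rewrite expf_eq0 /= => /(y_supp_cube r1).
  move=> x; rewrite indicE; have [xb|xb] := pselect (box a0 b0 x); last first.
    rewrite memNset // mulr0 exprn_ge0 // mulr_ge0 // cutoff_ge0 //.
  rewrite mem_set // mulr1; have [xc gx] := bx x xb.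
  have zx : 2^-1 <= cutoff r x.
    rewrite /cutoff le_max; apply/orP; left; rewrite /paraboloid.
    have : \sum_(i | i != ord_max) x 0 i ^+ 2 <= k.+1%:R * M ^+ 2.
      apply: (@le_trans _ _ (\sum_(i < k.+1) M ^+ 2)); last by rewrite sumr_const card_ord mulr_natl.
      rewrite big_mkcond /=; apply: ler_sum => i _; case: ifP => _; last exact: sqr_ge0.
      rewrite -[x 0 i ^+ 2]real_normK ?num_real //; apply: lerXn2r; rewrite ?nnegrE //; lra.
    move=> hs; have r2 : 0 < r ^+ 2 by rewrite exprn_gt0 //; lra.
    have : r ^- 2 * (\sum_(i | i != ord_max) x 0 i ^+ 2) <= 2^-1; last by lra.
    rewrite ler_pdivrMl //; apply: le_trans hs _.
    have : (2 * k.+1%:R * M) ^+ 2 <= r ^+ 2 by apply: lerXn2r; rewrite ?nnegrE //; nra.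
    rewrite exprMn exprMn => h4.
    have : k.+1%:R * M ^+ 2 <= k.+1%:R ^+ 2 * M ^+ 2.
      by apply: ler_wpM2r; [exact: sqr_ge0|rewrite expr2 ler_peMl].
    lra.
  apply: lerXn2r; rewrite ?nnegrE.
  - by rewrite divr_ge0 // ltW.
  - by rewrite mulr_ge0 // cutoff_ge0.
  - have -> : ga / 4%:R = 2^-1 * (ga / 2) by field.
    by apply: ler_pM => //; rewrite ?invr_ge0 // divr_ge0 // ltW.
pose Q : R := (2 * ((s0 - c) * m.+1%:R * (2 * Wm * (2 * m.+1%:R * k.+1%:R)) / sg)) ^+ m.+1 *
  (2 * (1 + `|c| + `|s0|)) ^+ k.+1.
(* The first entry makes the cutoff at least 1/2 on the box, the second makes Q / r smaller than
   ka. *)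
pose r := Num.max (2 * k.+1%:R * M) (Q / ka + 1).
have rM : 2 * k.+1%:R * M <= r by rewrite le_max lexx.
have rQ : Q / ka + 1 <= r by rewrite le_max lexx orbT.
have r1 : 1 <= r.
  by have kk : (1 : R) <= k.+1%:R; [rewrite ler1n|apply: le_trans rM; nra].
have := le_trans (lower r rM) (decay_bound r1).
have r0 : 0 < r by lra.
rewrite -/Q ler_pdivlMr // mulrC -ler_pdivlMr // => h; lra.
Qed.

End CoreEstimate.

(** * Weak solutions below height 1 *)

Section Extension.
Variable R : realType.

Lemma near_forall_ord (T : Type) (F : set_system T) {FF : Filter F} m (A : 'I_m -> set T) :
  (forall i, \forall x \near F, A i x) -> \forall x \near F, forall i, A i x.
Proof.
elim: m A => [|m IH] A hA; first by apply: filterE => x [].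
have h0 := hA ord0; have h := IH (fun i => A (lift ord0 i)) (fun i => hA _).
apply: filterS2 h0 h => x x0 xS i.
by case: (unliftP ord0 i) => [j ->|->].
Qed.

Lemma near_coord k (x : 'rV[R]_k) i (A : set R) : nbhs (x 0 i) A -> nbhs x (fun y : 'rV[R]_k => A (y 0 i)).
Proof. exact: (@coord_continuous R 1 k 0 i x). Qed.

Lemma near_l1 k (x : 'rV[R]_k) e : 0 < e -> \forall y \near x, l1 (y - x) < e.
Proof.
move=> e0; pose d := e / k.+1%:R; have d0 : 0 < d by rewrite divr_gt0.
have : nbhs x (fun y : 'rV[R]_k => forall i, `|y 0 i - x 0 i| < d).
  apply: (@near_forall_ord _ _ (nbhs_filter x) k (fun i (y : 'rV[R]_k) => `|y 0 i - x 0 i| < d)) => i.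
  apply: (@near_coord k x i (fun t => `|t - x 0 i| < d)).
  by apply: filterS (nbhsx_ballx (x 0 i) d d0) => t; rewrite /ball /= distrC.
apply: filterS => y hy; apply: (@le_lt_trans _ _ (k%:R * d)).
  by apply: l1_le => i; rewrite !mxE ltW.
by rewrite mulrC /d mulrAC ltr_pdivrMr // ltr_pM2l // ltr_nat.
Qed.

Lemma open_obox k (a b : 'rV[R]_k) : open (obox a b).
Proof.
rewrite openE => x xab.
apply: (@near_forall_ord _ _ (nbhs_filter x) k (fun i (y : 'rV[R]_k) => a 0 i < y 0 i < b 0 i)) => i.
have /andP[h1 h2] := xab i; apply: (@near_coord k x i (fun t => a 0 i < t < b 0 i)).
near=> t; apply/andP; split; near: t; [exact: lt_nbhsr|exact: lt_nbhsl].
Unshelve. all: by end_near. Qed.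

Lemma compact_box k (a b : 'rV[R]_k) : compact (box a b).
Proof.
have := @rV_compact R k (fun i => `[a 0 i, b 0 i]%classic) (fun i => @segment_compact _ _ _).
by congr compact; apply/seteqP; split => x h i; have := h i; rewrite /= in_itv.
Qed.

Lemma closed_box k (a b : 'rV[R]_k) : closed (box a b).
Proof. by apply: compact_closed; [exact: norm_hausdorff|exact: compact_box]. Qed.

Lemma compactly_contained_box k (a b : 'rV[R]_k) (A B : set 'rV[R]_k) :
  A `<=` box a b -> box a b `<=` B -> compactly_contained A B.
Proof.
move=> Ab bB; have cA : closure A `<=` box a b.
  by rewrite [X in _ `<=` X](closure_id _).1; [exact: closureS|exact: closed_box].
split; last exact: subset_trans bB.
by apply: (subclosed_compact (@closed_closure _ A) (compact_box (a := a) (b := b)) cA).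
Qed.

(** The box is the union of the segments from c to its points. *)
Lemma connected_obox k (a b c : 'rV[R]_k) : obox a b c -> connected (obox a b).
Proof.
move=> cab; pose seg x := [set t *: (x - c) + c | t in `[0 : R, 1]%classic].
have -> : obox a b = \bigcup_(x in obox a b) seg x.
  apply/seteqP; split => [x xab|y [x xab [t /=]]].
    exists x => //; exists 1; first by rewrite /= in_itv /= ler01 lexx.
    by rewrite scale1r subrK.
  rewrite in_itv /= => /andP[t0 t1] <- i; rewrite !mxE.
  have /andP[? ?] := xab i; have /andP[? ?] := cab i.
  have [->|t0'] := eqVneq t 0; first by apply/andP; split; lra.
  have tp : 0 < t by rewrite lt_neqAle eq_sym t0'.
  by apply/andP; split; nra.
apply: bigcup_connected.
  exists c => x xab; exists 0; first by rewrite /= in_itv /= lexx ler01.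
  by rewrite scale0r add0r.
move=> x xab; apply: connected_continuous_connected; first exact: segment_connected.
apply: continuous_subspaceT => t; apply: cvgD; last exact: cvg_cst.
by apply: cvgZr_tmp; exact: cvg_id.
Qed.

Definition below1 k : set 'rV[R]_k.+1 := [set x | x 0 ord_max < 1].

(* u frozen above height s, so as to be defined and locally Lipschitz everywhere. *)
Definition ext k (s : R) (u : 'rV[R]_k.+1 -> R) (x : 'rV[R]_k.+1) : R :=
  u (upd x ord_max (Num.min (x 0 ord_max) s)).

Lemma ext_id k s (u : 'rV[R]_k.+1 -> R) (x : 'rV[R]_k.+1) : x 0 ord_max <= s -> ext s u x = u x.
Proof. by move=> xs; rewrite /ext min_l // upd_id. Qed.

Lemma pd_ext k s (u : 'rV[R]_k.+1 -> R) i (x : 'rV[R]_k.+1) : x 0 ord_max < s -> pd i (ext s u) x = pd i u x.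
Proof.
move=> xs; rewrite -[x](upd_id x i) !pd_line; apply: near_eq_derive.
have [->|im] := eqVneq i ord_max.
  have := lt_nbhsl xs; apply: filterS => t /= ts.
  by rewrite ext_id // updE ltW.
by apply: filterE => t; rewrite ext_id // updN 1?eq_sym // ltW.
Qed.

Lemma grad_ext k s (u : 'rV[R]_k.+1 -> R) (x : 'rV[R]_k.+1) : x 0 ord_max < s -> grad (ext s u) x = grad u x.
Proof. by move=> xs; rewrite !gradE; apply/rowP => i; rewrite !mxE pd_ext. Qed.

(** Freezing sends a cube into a compact box below height 1, where local constants become uniform.
    Frozen points closer than 1 / M satisfy the local estimate; otherwise M l1 (x - y) >= 1, and the
    bound M on |u| gives the constant 2 M M. *)
Lemma llip_ext k s (u : 'rV[R]_k.+1 -> R) : s < 1 -> loc_lipschitz (@below1 k) u -> llip (ext s u).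
Proof.
move=> s1 lu r.
pose a : 'rV[R]_k.+1 := const_mx (- (`|r| + `|s|)).
pose b : 'rV[R]_k.+1 := \row_i if i == ord_max then s else `|r| + `|s|.
have bO : box a b `<=` @below1 k.
  by move=> x /(_ ord_max); rewrite !mxE eqxx => /andP[_ h]; exact: le_lt_trans s1.
(* Bound, Lipschitz constant and scale share the parameter M, so that compactness delivers a single
   threshold for all three. *)
pose P (M : R) (x : 'rV[R]_k.+1) := below1 x -> `|u x| <= M /\
  forall y, l1 (y - x) < M^-1 -> below1 y -> `|u y - u x| <= M * l1 (y - x).
have : \forall M \near +oo, forall x, box a b x -> P M x.
  refine ((compact_near_coveringP _).1 (@compact_box _ a b) _ _ P _ _) => x /bO xO.
  have [e [L [e0 hL]]] := lu x xO.
  have e20 : 0 < e / 2 by rewrite divr_gt0.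
  near=> x' M => x'O.
  have M0 : 0 < M by near: M; apply: nbhs_pinfty_gt; exact: num_real.
  have x'x : l1 (x' - x) < e / 2 by near: x'; exact: near_l1.
  have LM : L <= M by near: M; apply: nbhs_pinfty_ge; exact: num_real.
  have eM : 2 / e <= M by near: M; apply: nbhs_pinfty_ge; exact: num_real.
  have uM : `|u x| + `|L| * e <= M by near: M; apply: nbhs_pinfty_ge; exact: num_real.
  have xx : enorm (x - x) < e by rewrite subrr; apply: le_lt_trans (enorm_l1 _) _; rewrite /l1 big1 // => i _; rewrite mxE normr0.
  have x'e : enorm (x' - x) < e by apply: le_lt_trans (enorm_l1 _) _; lra.
  split.
    rewrite -[u x'](subrK (u x)); apply: le_trans (ler_normD _ _) _.
    apply: le_trans uM; rewrite addrC lerD2l; apply: le_trans (hL _ _ x'e xx x'O xO) _.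
    apply: (@le_trans _ _ (`|L| * enorm (x' - x))).
      by apply: ler_wpM2r; [exact: enorm_ge0|exact: ler_norm].
    by apply: ler_wpM2l => //; exact: ltW.
  move=> y yx' yO; have Mi : M^-1 <= e / 2.
    by rewrite -[e / 2]invrK invfM invrK mulrC lef_pV2 ?posrE // ?divr_gt0.
  have ye : enorm (y - x) < e.
    rewrite -[y - x](subrKA x'); apply: le_lt_trans (enormD _ _) _.
    by have := enorm_l1 (y - x'); have := enorm_l1 (x' - x); lra.
  apply: le_trans (hL _ _ ye x'e yO x'O) _.
  apply: (@le_trans _ _ (M * enorm (y - x'))); first by apply: ler_wpM2r => //; exact: enorm_ge0.
  by apply: ler_wpM2l; [exact: ltW|exact: enorm_l1].
move=> hP; have [M [M0 {}hP]] : exists M : R, 0 < M /\ forall x, box a b x -> P M x.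
  near (+oo_R) => M; exists M; split; near: M; [by apply: nbhs_pinfty_gt; exact: num_real|exact: hP].
have cb x : in_cube r x -> box a b (upd x ord_max (Num.min (x 0 ord_max) s)).
  move=> xr i; rewrite !mxE; have := xr i; have := ler_norm r; have := ler_norm (- s).
  rewrite normrN ler_norml => h1 h2 /andP[h3 h4]; have := normr_ge0 r; have := normr_ge0 s.
  have h5 := ler_norm s.
  by case: eqP => [im|_] ? ?; rewrite ?minEle; [rewrite -im; case: (leP (x 0 i) s) => ?|];
    apply/andP; split; lra.
exists (2 * M * M + M); split; first by rewrite addr_ge0 ?mulr_ge0 // ltW.
move=> x y xr yr; rewrite /ext.
set x1 := upd x _ _; set y1 := upd y _ _.
have [ux hx] := hP _ (cb _ xr) (bO _ (cb _ xr)); have [uy hy] := hP _ (cb _ yr) (bO _ (cb _ yr)).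
have l01 := l1_ge0 (x - y).
have lxy : l1 (x1 - y1) <= l1 (x - y).
  by apply: ler_sum => i _; rewrite !mxE; case: eqP => [->|_] //; exact: min_lip.
have [hl|hl] := ltP (l1 (x1 - y1)) M^-1.
  apply: le_trans (hy _ hl (bO _ (cb _ xr))) _.
  apply: (@le_trans _ _ (M * l1 (x - y))); first by apply: ler_wpM2l => //; exact: ltW.
  by apply: ler_wpM2r => //; rewrite lerDr !mulr_ge0 // ltW.
have hM : 1 <= M * l1 (x - y).
  by rewrite -(mulfV (lt0r_neq0 M0)); apply: ler_wpM2l; [exact: ltW|exact: le_trans lxy].
apply: (@le_trans _ _ (2 * M)).
  by apply: le_trans (ler_normB _ _) _; rewrite -/x1 -/y1; lra.
have h1 : 0 <= M * l1 (x - y) by rewrite mulr_ge0 // ltW.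
have h2 : 2 * M * 1 <= 2 * M * (M * l1 (x - y)) by apply: ler_wpM2l => //; rewrite mulr_ge0 // ltW.
rewrite mulr1 in h2; apply: le_trans h2 _.
by rewrite (mulrDl (2 * M * M)) mulrA lerDl.
Unshelve. all: by end_near. Qed.

End Extension.

(** * From the weak formulation to test inequalities *)

Section WeakTest.
Variable R : realType.

Lemma near_below k s (x : 'rV[R]_k.+1) : x 0 ord_max < s ->
  nbhs x (fun y : 'rV[R]_k.+1 => y 0 ord_max < s).
Proof. by move=> xs; apply: (@near_coord _ _ x ord_max (fun t => t < s)); exact: lt_nbhsl. Qed.

Lemma pd_eq_below k s (f g : 'rV[R]_k.+1 -> R) i (x : 'rV[R]_k.+1) : x 0 ord_max < s ->
  (forall y : 'rV[R]_k.+1, y 0 ord_max < s -> f y = g y) -> pd i f x = pd i g x.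
Proof. by move=> /near_below xs fg; apply: near_eq_derive; apply: filterS xs => y /fg. Qed.

Lemma grad_eq_below k s (f g : 'rV[R]_k.+1 -> R) (x : 'rV[R]_k.+1) : x 0 ord_max < s ->
  (forall y : 'rV[R]_k.+1, y 0 ord_max < s -> f y = g y) -> grad f x = grad g x.
Proof. by move=> xs fg; apply/rowP => i; rewrite !mxE; apply: pd_eq_below xs fg. Qed.

Lemma loc_lipschitzD k (A : set 'rV[R]_k) (f g : 'rV[R]_k -> R) :
  loc_lipschitz A f -> loc_lipschitz A g -> loc_lipschitz A (fun x => f x + g x).
Proof.
move=> lf lg x Ax; have [r [L [r0 hf]]] := lf x Ax; have [r' [L' [r'0 hg]]] := lg x Ax.
exists (Num.min r r'), (L + L'); split; first by rewrite lt_min r0.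
move=> y z; rewrite !lt_min => /andP[y1 y2] /andP[z1 z2] Ay Az.
rewrite opprD addrACA mulrDl; apply: le_trans (ler_normD _ _) _.
by apply: lerD; [exact: hf|exact: hg].
Qed.

Lemma llip_loc_lipschitz k (A : set 'rV[R]_k) (f : 'rV[R]_k -> R) : llip f -> loc_lipschitz A f.
Proof.
move=> lf x _; have [L [L0 fL]] := lf (l1 x + 1).
have cube y : enorm (y - x) < 1 -> in_cube (l1 x + 1) y.
  move=> /ltW yx; apply: in_cube_near => i; apply: le_trans yx.
  by have := enorm_coord (y - x) i; rewrite !mxE.
exists 1, (L * k%:R); split => // y z /cube yc /cube zc _ _.
apply: le_trans (fL _ _ yc zc) _; rewrite -mulrA; apply: ler_wpM2l => //.
exact: l1_enorm.
Qed.

(** Freezing psi above s gives a weight defined on the whole space; boxes below s do not see the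
    change. *)
Definition weight k (psi : R -> R) (s : R) (x : 'rV[R]_k.+1) : R :=
  expR (ext s (fun y : 'rV[R]_k.+1 => psi (y 0 ord_max)) x).

Lemma weight_id k psi s (x : 'rV[R]_k.+1) : x 0 ord_max <= s -> weight psi s x = expR (psi (x 0 ord_max)).
Proof. by move=> xs; rewrite /weight ext_id. Qed.

Lemma borel_weight k psi s : llip (ext s (fun y : 'rV[R]_k.+1 => psi (y 0 ord_max))) ->
  borel (@weight k psi s).
Proof. by move=> lp; apply: (borel_comp1 (h := expR)); [exact: measurable_expR|exact: llip_borel]. Qed.

Lemma locbd_weight k psi s : llip (ext s (fun y : 'rV[R]_k.+1 => psi (y 0 ord_max))) ->
  locbd (@weight k psi s).
Proof.
move=> lp r; have [M hM] := llip_locbd lp r; exists (expR M) => x /hM xM.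
by rewrite ger0_norm ?expR_ge0 // ler_expR; exact: le_trans (ler_norm _) xM.
Qed.

Lemma iint_indic_ext k (K : set 'rV[R]_k) (F G : 'rV[R]_k -> R) :
  (forall x, K x -> F x = G x) -> iint (fun x => \1_K x * F x) = iint (fun x => \1_K x * G x).
Proof.
move=> FG; apply: eq_iint => x; rewrite indicE; have [xK|xK] := pselect (K x).
  by rewrite FG.
by rewrite memNset // !mul0r.
Qed.

Lemma wtest_weak k psi (u : 'rV[R]_k.+1 -> R) s :
  loc_lipschitz (@below1 R k) (fun y : 'rV[R]_k.+1 => psi (y 0 ord_max)) ->
  weak_weighted_IMCF psi (@below1 R k) u -> s < 1 -> wtest (@weight k psi s) (ext s u) s.
Proof.
move=> lpsi [lu hu] s1 phi a b d d0 lphi bs supp.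
have lU : llip (ext s u) by exact: llip_ext.
have lW : llip (ext s (fun y : 'rV[R]_k.+1 => psi (y 0 ord_max))) by exact: llip_ext.
have bW := borel_weight lW; have mW := locbd_weight lW.
(* A domain is nonempty, so the zero test function is treated separately; otherwise a point of its
   support lies in K. *)
have [[x0 phx0]|nophi] := pselect (exists x, phi x != 0); last first.
  have phi0 x : phi x = 0 by apply/eqP; apply: contraT => h; case: nophi; exists x.
  rewrite (_ : (fun _ => _) = fun=> 0) ?iint0 //; apply/funext => x.
  rewrite /excess phi0 mul0r addr0 (_ : (fun y => ext s u y + phi y) = ext s u).
    by rewrite subrr !mulr0.
  by apply/funext => y; rewrite phi0 addr0.
set K := obox a b.
have suppK x : phi x != 0 -> K x.
  by move=> /supp h i; have /andP[? ?] := h i; apply/andP; split; lra.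
have Kx0 := suppK _ phx0.
have Ks x : K x -> x 0 ord_max < s by move=> /(_ ord_max)/andP[_ h]; exact: lt_le_trans bs.
pose v x := u x + phi x.
have lv : loc_lipschitz (@below1 R k) v by apply: loc_lipschitzD => //; exact: llip_loc_lipschitz.
have dK : domain K by split; [exists x0|split; [exact: open_obox|exact: connected_obox Kx0]].
have cK1 : compactly_contained [set x | @below1 R k x /\ u x <> v x] K.
  (* The margin d provides a closed box between K and the set where u and v differ. *)
  apply: (@compactly_contained_box _ _ (\row_i (a 0 i + d)) (\row_i (b 0 i - d))).
    move=> x [_ uv] i; rewrite !mxE; apply: supp; apply/eqP => ph0; apply: uv.
    by rewrite /v ph0 addr0.
  by move=> x h i; have := h i; rewrite !mxE => /andP[? ?]; apply/andP; split; lra.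
have cK2 : compactly_contained K (@below1 R k).
  apply: (@compactly_contained_box _ _ a b).
    by move=> x h i; have /andP[/ltW -> /ltW ->] := h i.
  by move=> x /(_ ord_max)/andP[_ h]; rewrite /below1 /=; apply: le_lt_trans h _; exact: le_lt_trans s1.
pose gU x := enorm (grad (ext s u) x).
pose gV x := enorm (grad (fun y => ext s u y + phi y) x).
pose F1 x := \1_K x * (weight psi s x * (gU x + ext s u x * gU x)).
pose F2 x := \1_K x * (weight psi s x * (gV x + (ext s u x + phi x) * gU x)).
have lV : llip (fun y => ext s u y + phi y) by exact: llipD.
have bgU : borel gU by exact: borel_enorm_grad.
have bgV : borel gV by exact: borel_enorm_grad.
have mgU : locbd gU by exact: locbd_enorm_grad.
have mgV : locbd gV by exact: locbd_enorm_grad.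
have i1 : integrand F1.
  apply: integrand_obox.
    by apply: (borelM bW); apply: (borelD bgU); apply: (borelM _ bgU); exact: llip_borel.
  by apply: (locbdM mW); apply: (locbdD mgU); apply: (locbdM _ mgU); exact: llip_locbd.
have i2 : integrand F2.
  apply: integrand_obox.
    by apply: (borelM bW); apply: (borelD bgV); apply: (borelM _ bgU); exact: (llip_borel lV).
  by apply: (locbdM mW); apply: (locbdD mgV); apply: (locbdM _ mgU); exact: (llip_locbd lV).
have e1 x : K x -> expR (psi (lastc x)) * (enorm (grad u x) + u x * enorm (grad u x)) =
    weight psi s x * (gU x + ext s u x * gU x).
  move=> /Ks xs; rewrite (weight_id psi (ltW xs)) /gU (grad_ext u xs) (ext_id u (ltW xs)).
  by [].
have e2 x : K x -> expR (psi (lastc x)) * (enorm (grad v x) + v x * enorm (grad u x)) =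
    weight psi s x * (gV x + (ext s u x + phi x) * gU x).
  move=> /Ks xs; rewrite (weight_id psi (ltW xs)) /gU (grad_ext u xs) (ext_id u (ltW xs)).
  have gv : grad (fun y => ext s u y + phi y) x = grad v x.
    by apply: (grad_eq_below xs) => y ys; rewrite (ext_id u (ltW ys)).
  by rewrite /gV gv.
have leE (p q : R) : p = q -> p <= q by move=> ->.
have h12 : iint F1 <= iint F2 := le_trans (leE _ _ (esym (iint_indic_ext e1)))
  (le_trans (hu v K lv dK cK1 cK2) (leE _ _ (iint_indic_ext e2))).
have h : 0 <= iint (fun x => F2 x - F1 x) by rewrite (iintB i2 i1) subr_ge0.
apply: le_trans h _; rewrite le_eqVlt; apply/orP; left; apply/eqP; apply: eq_iint => x.
by rewrite /F1 /F2 /excess -/(gU x) -/(gV x); ring.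
Qed.

Lemma pd_shift k (f : 'rV[R]_k -> R) v i x : pd i (fun y => f (v + y)) x = pd i f (v + x).
Proof.
have E : (fun h : R => h^-1 *: (((fun y => f (v + y)) \o shift x) (h *: delta_mx 0 i) - f (v + x))) =
  (fun h : R => h^-1 *: ((f \o shift (v + x)) (h *: delta_mx 0 i) - f (v + x))).
  by apply/funext => h /=; rewrite addrCA.
by rewrite /pd /derive E.
Qed.

Lemma grad_shift k (f : 'rV[R]_k -> R) v x : grad (fun y => f (v + y)) x = grad f (v + x).
Proof. by apply/rowP => i; rewrite !mxE; apply: pd_shift. Qed.

Lemma llip_shift k (f : 'rV[R]_k -> R) i tau : llip f -> llip (fun x => f (tau *: delta_mx 0 i + x)).
Proof.
move=> lf r; have [L [L0 fL]] := lf (r + `|tau|); exists L; split => // x y xr yr.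
have := fL _ _ (shift_cube i tau xr) (shift_cube i tau yr).
by rewrite opprD addrACA subrr add0r.
Qed.

Lemma indic_iff (T : Type) (A B : set T) x y : (A x <-> B y) -> \1_A x = \1_B y :> R.
Proof.
move=> AB; rewrite !indicE; have [Ax|nAx] := pselect (A x).
  by rewrite !mem_set //; exact/AB.
by rewrite !memNset // => /AB.
Qed.

(** Testing the translate with phi amounts to testing U with phi translated back, because the weight
    is invariant under horizontal translations. *)
Lemma wtest_shift k (W U : 'rV[R]_k.+1 -> R) s i tau : i != ord_max ->
  (forall x, W (tau *: delta_mx 0 i + x) = W x) -> borel W -> locbd W -> llip U ->
  wtest W U s -> wtest W (fun x => U (tau *: delta_mx 0 i + x)) s.
Proof.
move=> im Winv bW mW lU tU phi a b d d0 lphi bs supp.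
pose v : 'rV[R]_k.+1 := tau *: delta_mx 0 i.
pose phi' y := phi ((- tau) *: delta_mx 0 i + y).
have vm : v 0 ord_max = 0 by rewrite !mxE eqxx /= eq_sym (negbTE im) mulr0.
have phiE x : phi' (v + x) = phi x by rewrite /phi' scaleNr addKr.
have lphi' : llip phi' by exact: llip_shift.
have bs' : (v + b) 0 ord_max <= s by rewrite mxE vm add0r.
have supp' x : phi' x != 0 -> forall j, (v + a) 0 j + d <= x 0 j <= (v + b) 0 j - d.
  move=> /supp h j; have := h j; rewrite scaleNr -/v !mxE => /andP[? ?].
  by apply/andP; split; lra.
pose F x := \1_(obox (v + a) (v + b)) x * (W x * excess U phi' x).
have h : 0 <= iint F := tU phi' (v + a) (v + b) d d0 lphi' bs' supp'.
have iF : integrand F.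
  apply: integrand_obox; first exact: (borelM bW (borel_excess lU lphi')).
  exact: (locbdM mW (locbd_excess lU lphi')).
have [_ FE] := iint_translate i tau iF.
have E1 x : \1_(obox (v + a) (v + b)) (v + x) = \1_(obox a b) x :> R.
  have xv j : (v + x) 0 j = v 0 j + x 0 j by rewrite mxE.
  have av j : (v + a) 0 j = v 0 j + a 0 j by rewrite mxE.
  have bv j : (v + b) 0 j = v 0 j + b 0 j by rewrite mxE.
  apply: indic_iff; split => h' j; have := h' j; rewrite xv av bv ?ltrD2l //.
have E2 x : excess U phi' (v + x) = excess (fun x => U (v + x)) phi x.
  rewrite /excess phiE -(grad_shift U v x) -(grad_shift (fun y => U y + phi' y) v x).
  by under [in LHS]eq_fun do rewrite phiE.
have E3 x : F (v + x) = \1_(obox a b) x * (W x * excess (fun x => U (v + x)) phi x).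
  by rewrite /F E1 E2 (Winv x).
have leE (p q : R) : p = q -> p <= q by move=> ->.
exact: (le_trans h (leE _ _ (etrans (esym FE) (eq_iint E3)))).
Qed.

End WeakTest.

(** * The potential as a solution *)

Section Potential.
Variable R : realType.

Lemma llip1_expR : llip1 (@expR R).
Proof.
have h (r x y : R) : `|x| <= r -> expR x - expR y <= expR r * `|x - y|.
  rewrite ler_norml => /andP[_ xr]; have := expR_ge1Dx (y - x).
  move=> /(ler_wpM2l (expR_ge0 x)); rewrite -expRD [x + _]addrC subrK => h.
  apply: (@le_trans _ _ (expR x * (x - y))); first by lra.
  apply: (@le_trans _ _ (expR x * `|x - y|)).
    by apply: ler_wpM2l; [exact: expR_ge0|exact: ler_norm].
  by apply: ler_wpM2r => //; rewrite ler_expR.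
move=> r; exists (expR r); split; first exact: expR_ge0.
move=> x y xr yr; rewrite ler_norml; apply/andP; split; last exact: h.
by have := h r y x yr; rewrite distrC; lra.
Qed.

Lemma iint_pd_ge0 k (i : 'I_k) (Phi : 'rV[R]_k -> R) r : llip Phi -> 0 <= r ->
  (forall x, Phi x != 0 -> in_cube r x) -> 0 <= iint (pd i Phi).
Proof.
move=> lPhi r0 supp; rewrite -(iint0 R k).
apply: (iint_line_le (i := i)); [exact: integrand0|exact: integrand_pd supp|move=> x].
by rewrite (line_ftc0 _ lPhi r0 supp) /Rintegral integral0.
Qed.

Variables (psi : R -> R).
Hypothesis psi_d : forall s : R, s < 1 -> derivable psi s 1.
Hypothesis psi_d2 : forall s : R, s < 1 -> derivable (derive1 psi) s 1.
Hypothesis psi_ge0 : forall s : R, s < 1 -> 0 <= psi s.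
Hypothesis psi_0 : forall s : R, s <= 0 -> psi s = 0.
Hypothesis psi_inc : forall s : R, 0 < s < 1 -> 0 < derive1 psi s.

Lemma psi_deriv_ge0 s : s < 1 -> 0 <= derive1 psi s.
Proof.
move=> s1; have [s0|s0] := ltP 0 s; first by apply: ltW; apply: psi_inc; rewrite s0.
(* For s <= 0 the value psi s = 0 is a minimum, since psi is nonnegative. *)
have := @derive1_at_min R psi (s - 1) 1 s; case.
- by lra.
- by move=> t; rewrite in_itv /= => /andP[_ ?]; exact: psi_d.
- by rewrite in_itv /= s1 andbT; lra.
- by move=> t; rewrite in_itv /= => /andP[_ ?]; rewrite psi_0 //; exact: psi_ge0.
by move=> _; rewrite derive1E => ->.
Qed.

Lemma psi_loc_lipschitz k : loc_lipschitz (@below1 R k) (fun y : 'rV[R]_k.+1 => psi (y 0 ord_max)).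
Proof.
move=> x xO; set s := x 0 ord_max; have s1 : s < 1 by [].
have cd : {for s, continuous (derive1 psi)}.
  by apply: differentiable_continuous; apply/derivable1_diffP; exact: psi_d2.
have [r r0 hr] : exists2 r, 0 < r & forall t, `|s - t| < r -> `|derive1 psi s - derive1 psi t| < 1.
  have := (@cvgr_dist_lt R R^o _ _ _ _ _ cd) 1 ltr01.
  move=> h; have [r r0 hr] := (nbhs_ballP _ _).1 (h (nbhs_filter s)).
  by exists r => // t st; apply: hr.
pose L := `|derive1 psi s| + 1.
pose r' := Num.min r (1 - s); have r'0 : 0 < r' by rewrite lt_min r0 subr_gt0.
exists r', L; split => // y z.
have coord (w : 'rV[R]_k.+1) : enorm (w - x) < r' -> `|w 0 ord_max - s| < r'.
  by apply: le_lt_trans; have := enorm_coord (w - x) ord_max; rewrite !mxE.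
have L0 : 0 <= L by rewrite addr_ge0.
have key a b : a < b -> `|a - s| < r' -> `|b - s| < r' -> `|psi a - psi b| <= L * `|a - b|.
  move=> ab; rewrite !lt_min !ltr_norml => /andP[/andP[? ?] /andP[? ?]] /andP[/andP[? ?] /andP[? ?]].
  have t1 t : a <= t <= b -> t < 1 by move=> /andP[_]; lra.
  have h1 t : t \in `]a, b[%R -> is_derive t 1 psi (derive1 psi t).
    rewrite in_itv /= => /andP[ta tb]; apply: DeriveDef; last by rewrite derive1E.
    by apply: psi_d; apply: t1; rewrite !ltW.
  have h2 : {within `[a, b], continuous psi}.
    apply: derivable_within_continuous => t; rewrite in_itv /= => /andP[ta tb].
    by apply: psi_d; apply: t1; rewrite ta tb.
  have [t tab tE] := MVT ab h1 h2; rewrite [X in X <= _]distrC tE.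
  move: tab; rewrite in_itv /= => /andP[ta tb].
  rewrite normrM [`|a - b|]distrC; apply: ler_wpM2r => //.
  have : `|derive1 psi s - derive1 psi t| < 1 by apply: hr; rewrite ltr_norml; apply/andP; split; lra.
  move=> /ltW h; rewrite /L -[derive1 psi t](subrK (derive1 psi s)) addrC.
  by apply: le_trans (ler_normD _ _) _; rewrite lerD2l distrC.
move=> /coord yx /coord zx _ _.
apply: (@le_trans _ _ (L * `|y 0 ord_max - z 0 ord_max|)).
  have [yz|zy|->] := ltgtP (y 0 ord_max) (z 0 ord_max).
  - exact: key.
  - by rewrite distrC [`|y 0 _ - _|]distrC; exact: key.
  - by rewrite !subrr normr0 mulr0.
by apply: ler_wpM2l => //; have := enorm_coord (y - z) ord_max; rewrite !mxE.
Qed.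

Lemma weight_bounds k s : s < 1 -> exists Wm, forall x : 'rV[R]_k.+1, 1 <= weight psi s x <= Wm.
Proof.
move=> s1; have lp := llip_ext s1 (@psi_loc_lipschitz k).
(* Radius 1 is enough: the weight depends only on min(x_n, s), and psi vanishes unless this lies
   between 0 and 1. *)
have [M hM] := llip_locbd lp 1; exists (expR `|M|) => x.
rewrite /weight; set v := ext _ _ _; have v0 : 0 <= v.
  by rewrite /v /ext updE; apply: psi_ge0; rewrite gt_min s1 orbT.
apply/andP; split; first by rewrite -expR0 ler_expR.
rewrite ler_expR; have [x0|x0] := leP (Num.min (x 0 ord_max) s) 0.
  by rewrite /v /ext updE psi_0.
pose y : 'rV[R]_k.+1 := upd 0 ord_max (Num.min (x 0 ord_max) s).
have : in_cube 1 y.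
  move=> i; rewrite mxE; case: eqP => _; last by rewrite mxE normr0.
  by rewrite gtr0_norm // ge_min (ltW s1) orbT.
move=> /hM; rewrite /ext /y !updE -minA minxx => h.
apply: le_trans (ler_norm _) _; rewrite /v /ext updE; apply: le_trans h (ler_norm _).
Qed.

(** Calibration by the vertical direction: |grad (U + phi)| is at least its last component psi' +
    d_n phi, while |grad U| = psi'. So the weighted excess dominates e^psi (d_n phi + phi psi') =
    d_n (e^psi phi), which integrates to 0 on every vertical line. *)
Lemma wtest_psi k c s : s < 1 ->
  wtest (@weight R k psi s) (ext s (fun y : 'rV[R]_k.+1 => psi (y 0 ord_max) + c)) s.
Proof.
move=> s1 phi a b d d0 lphi bs supp.
pose pl (y : 'rV[R]_k.+1) := psi (y 0 ord_max).
have lpl : loc_lipschitz (@below1 R k) pl by exact: psi_loc_lipschitz.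
have lp : llip (ext s pl) := llip_ext s1 lpl.
pose U := ext s (fun y => pl y + c).
have lU : llip U by apply: llipD => //; exact: llip_cst.
have lW : llip (@weight R k psi s) by exact: (llip_comp llip1_expR lp).
pose Phi x := weight psi s x * phi x.
have lPhi : llip Phi by exact: llipM.
have PhiK x : Phi x != 0 -> forall i, a 0 i + d <= x 0 i <= b 0 i - d.
  by rewrite mulf_eq0 negb_or => /andP[_ /supp].
have cube x : Phi x != 0 -> in_cube (l1 a + l1 b) x.
  by move=> /PhiK h; apply: obox_cube => i; have /andP[? ?] := h i; apply/andP; split; lra.
have r0 : 0 <= l1 a + l1 b by rewrite addr_ge0 ?l1_ge0.
have h0 := iint_pd_ge0 ord_max lPhi r0 cube.
have iP : integrand (pd ord_max Phi) by exact: integrand_pd cube.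
have bW : borel (@weight R k psi s) by exact: borel_weight.
have mW : locbd (@weight R k psi s) by exact: locbd_weight.
pose F x := \1_(obox a b) x * (weight psi s x * excess U phi x).
have iF : integrand F.
  apply: integrand_obox; first exact: (borelM bW (borel_excess lU lphi)).
  exact: (locbdM mW (locbd_excess lU lphi)).
suff key x : ~ [set x | ~ pdable ord_max phi x] x -> pd ord_max Phi x <= F x.
  exact: (le_trans h0 (iint_le_off (nullset_not_pdable ord_max lphi) iP iF key)).
move=> /contrapT dphi; rewrite /F.
have [xK|xK] := pselect (obox a b x); last first.
  have -> : pd ord_max Phi x = 0.
    rewrite /pd (@near_eq_derive _ _ _ _ (cst 0)) ?derive_cst //.
    pose A : 'rV[R]_k.+1 := \row_i (a 0 i + d); pose B : 'rV[R]_k.+1 := \row_i (b 0 i - d).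
    have oC : open (~` box A B) by rewrite openC; exact: closed_box.
    have xC : (~` box A B) x.
      move=> h; apply: xK => i; have := h i; rewrite !mxE => /andP[? ?].
      by apply/andP; split; lra.
    apply: filterS (open_nbhs_nbhs (conj oC xC)) => y yC.
    apply/eqP; apply: contraT => /PhiK h; case: yC => i; rewrite !mxE; exact: h.
  by rewrite indicE memNset // mul0r.
rewrite indicE mem_set // mul1r.
set t := x 0 ord_max; have ts : t < s by have /andP[_ h] := xK ord_max; exact: lt_le_trans bs.
have t1 : t < 1 := lt_trans ts s1.
have Dpsi : is_derive t 1 psi (derive1 psi t).
  by apply: DeriveDef; [exact: psi_d|rewrite derive1E].
have Dphi : is_derive t 1 (fun r => phi (upd x ord_max r)) (pd ord_max phi x).
  apply: DeriveDef; first by rewrite -pdable_line upd_id.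
  by rewrite -pd_line upd_id.
have PhiE : pd ord_max Phi x = expR (psi t) * (pd ord_max phi x + phi x * derive1 psi t).
  rewrite (@pd_eq_below _ _ s _ (fun y => expR (pl y) * phi y) _ x) //; last first.
    by move=> y ys; rewrite /Phi weight_id // ltW.
  rewrite -[x](upd_id x ord_max) pd_line upd_id -/t.
  have De : is_derive t 1 (expR \o psi) (expR (psi t) * derive1 psi t) by exact: is_derive1_comp.
  have := is_deriveM De Dphi; rewrite (_ : _ * _ = (fun r => expR (pl (upd x ord_max r)) * phi (upd x ord_max r))).
    by move=> [_ ->]; rewrite /GRing.scale /= upd_id; ring.
  by apply/funext => r; rewrite /pl updE.
have psip := psi_deriv_ge0 t1.
have gU : enorm (grad U x) = derive1 psi t.
  rewrite (@grad_eq_below _ _ s _ (fun y => pl y + c) x) //; last first.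
    by move=> y ys; rewrite /U ext_id // ltW.
  rewrite (_ : grad _ x = derive1 psi t *: delta_mx 0 ord_max).
    rewrite enormZ ger0_norm // /enorm (bigD1 ord_max) //= big1 => [|i im].
      by rewrite !mxE !eqxx /= expr1n addr0 sqrtr1 mulr1.
    by rewrite !mxE (negbTE im) andbF expr0n.
  apply/rowP => i; rewrite !mxE -/(pd i _ x) -[x](upd_id x i) pd_line eqxx /=.
  have [->|im] := eqVneq i ord_max.
    rewrite -/t mulr1 (_ : (fun r => _) = psi + cst c).
      by have [_ ->] := is_deriveD Dpsi (is_derive_cst c t 1); rewrite addr0.
    by apply/funext => r; rewrite /pl updE.
  rewrite mulr0 (_ : (fun r => _) = cst (psi t + c)) ?derive_cst //.
  by apply/funext => r; rewrite /pl updN // eq_sym.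
have gV : derive1 psi t + pd ord_max phi x <= enorm (grad (fun y => U y + phi y) x).
  apply: le_trans (le_trans (ler_norm _) (enorm_coord _ ord_max)).
  rewrite mxE -/(pd ord_max _ x).
  rewrite (@pd_eq_below _ _ s (fun y => U y + phi y) (fun y => pl y + c + phi y) _ x) //; last first.
    by move=> y ys; rewrite /U ext_id // ltW.
  rewrite -[in X in _ <= X](upd_id x ord_max) pd_line -/t.
  rewrite (_ : (fun r => _) = psi + cst c + (fun r => phi (upd x ord_max r))).
    by have [_ ->] := is_deriveD (is_deriveD Dpsi (is_derive_cst c t 1)) Dphi; rewrite addr0.
  by apply/funext => r; rewrite /pl updE.
rewrite PhiE (weight_id psi (ltW ts)) -/t; apply: ler_wpM2l; first exact: expR_ge0.
by rewrite /excess gU lerD2r; lra.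
Qed.

End Potential.

(** * Comparison and rigidity *)

Section Comparison.
Variable R : realType.

Definition trunc (th t : R) : R := t / (1 + th * t).

Section Trunc.
Variable th : R.
Hypothesis th0 : 0 < th.

Lemma trunc_den t : 1 <= t -> 0 < 1 + th * t.
Proof. by move=> t1; rewrite addr_gt0 // mulr_gt0 //; lra. Qed.

Lemma trunc_lt t : 1 <= t -> trunc th t < th^-1.
Proof.
move=> t1; rewrite /trunc ltr_pdivrMr ?trunc_den // mulrDr mulr1 mulKf ?gt_eqF //.
by rewrite ltrDr invr_gt0.
Qed.

Lemma trunc_le t : 1 <= t -> trunc th t <= t.
Proof.
move=> t1; rewrite /trunc ler_pdivrMr ?trunc_den //; apply: ler_peMr; first by lra.
by rewrite lerDl mulr_ge0 // ?ltW //; lra.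
Qed.

Lemma trunc_lip t s : 1 <= t -> 1 <= s -> `|trunc th t - trunc th s| <= `|t - s|.
Proof.
move=> t1 s1; have dt := trunc_den t1; have ds := trunc_den s1.
have -> : trunc th t - trunc th s = (t - s) / ((1 + th * t) * (1 + th * s)).
  by rewrite /trunc; field; rewrite !gt_eqF.
have d1 : 1 <= (1 + th * t) * (1 + th * s).
  by apply: mulr_ege1; rewrite lerDl mulr_ge0 // ?ltW //; lra.
have d0 : 0 < (1 + th * t) * (1 + th * s) by rewrite mulr_gt0.
by rewrite normrM normfV (gtr0_norm d0) ler_pdivrMr // ler_peMr.
Qed.

Lemma is_derive_trunc (t : R) : 1 <= t -> is_derive t 1 (trunc th) ((1 + th * t) ^- 2).
Proof.
move=> t1; have dt := trunc_den t1.
have D : is_derive t 1 (fun s : R => 1 + th * s) th.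
  have -> : (fun s : R => 1 + th * s) = cst 1 + (th \*: id) by apply/funext.
  have := is_deriveD (is_derive_cst (1 : R) t 1) (is_deriveZ th (is_derive_id t (1 : R))).
  by rewrite add0r /GRing.scale /= mulr1.
have D' := @is_deriveV R (fun s : R => 1 + th * s) t th 1 (lt0r_neq0 dt) D.
have := is_deriveM (is_derive_id t (1 : R)) D'.
move=> [h1 h2]; apply: DeriveDef; first exact: h1.
rewrite -[LHS]/('D_1 (id * (fun s => (1 + th * s)^-1)) t) h2 /GRing.scale /=.
by rewrite mulr1; field; rewrite gt_eqF.
Qed.

End Trunc.

Lemma llip_clamp k b (f : 'rV[R]_k.+1 -> R) : llip f ->
  llip (fun x => f (upd x ord_max (Num.max (x 0 ord_max) b))).
Proof.
move=> lf r; have [L [L0 fL]] := lf (r + `|b|); exists L; split => // x y xr yr.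
have cube (z : 'rV[R]_k.+1) : in_cube r z -> in_cube (r + `|b|) (upd z ord_max (Num.max (z 0 ord_max) b)).
  move=> zr i; rewrite mxE; have b0 := normr_ge0 b; have := zr i.
  have [->|_] := eqVneq i ord_max => zi; last by lra.
  rewrite maxEle; case: ifP => _; last by lra.
  by have := normr_ge0 (z 0 ord_max); lra.
apply: le_trans (fL _ _ (cube _ xr) (cube _ yr)) _; apply: ler_wpM2l => //.
apply: ler_sum => i _; rewrite !mxE; case: eqP => [->|_] //.
exact: max_lip.
Qed.

Lemma llip_near k (f : 'rV[R]_k -> R) x : llip f -> 0 < f x -> nbhs x (fun y => 0 < f y).
Proof.
move=> lf fx; have fx2 : 0 < f x / 2 by rewrite divr_gt0.
have [d /andP[d0 _] hd] := llip_at x lf fx2.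
apply: filterS (near_l1 x d0) => y yd; have : `|f y - f x| <= f x / 2.
  by apply: hd => i; apply: le_trans (ltW yd); have := l1_coord (y - x) i; rewrite !mxE.
by rewrite ler_norml => /andP[h _]; lra.
Qed.

Lemma comparison_trunc k (W U1 U2 : 'rV[R]_k.+1 -> R) (Wm s0 s1 b C c0 th : R) :
  llip U1 -> llip U2 -> borel W -> (forall x, 1 <= W x) -> (forall x, W x <= Wm) ->
  wtest W U1 s1 -> wtest W U2 s1 -> s0 < s1 -> b <= s0 -> 0 < th -> 0 <= c0 ->
  (forall x, - C <= U1 x) -> (forall x, - C <= U2 x) ->
  (forall x : 'rV[R]_k.+1, s0 <= x 0 ord_max -> th^-1 <= U1 x + C + 1) ->
  (forall x : 'rV[R]_k.+1, x 0 ord_max = b -> U2 x <= U1 x + c0) ->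
  forall x : 'rV[R]_k.+1, b <= x 0 ord_max -> trunc th (U2 x + C + 1) <= U1 x + C + 1 + c0.
Proof.
move=> lU1 lU2 bW W1 WWm t1 t2 s01 bs0 th0 c00 U1C U2C U1s Ub x1 bx1.
pose T x := U2 x + C + 1.
have T1 (x : 'rV[R]_k.+1) : 1 <= T x by rewrite /T; have := U2C x; lra.
pose f0 x := trunc th (T x) - (U1 x + C + 1).
suff h : f0 x1 <= c0 by move: h; rewrite /f0 /T; lra.
rewrite leNgt; apply/negP => fx1.
(* The supremum over the half-space above b is finite, because the truncation stays below 1 / th,
   but it need not be attained. *)
pose E : set R := [set z | exists2 x : 'rV[R]_k.+1, b <= x 0 ord_max & f0 x = z].
have Eub z : E z -> z <= th^-1.
  move=> [x _ <-]; have := trunc_lt th0 (T1 x); rewrite /f0; have := U1C x; lra.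
have hE : has_sup E by split; [exists (f0 x1); exists x1|exists th^-1].
have SE (x : 'rV[R]_k.+1) : b <= x 0 ord_max -> f0 x <= sup E.
  by move=> bx; apply: sup_upper_bound => //; exists x.
have Sc0 : c0 < sup E by apply: lt_le_trans fx1 _; exact: SE.
(* An upper bound for the derivative of the truncation along T, since T >= 1. *)
pose q := (1 + th) ^- 2.
have q1 : q < 1.
  rewrite /q invf_lt1 ?exprn_gt0 ?addr_gt0 // exprn_egt1 //; by rewrite ltrDl.
pose sg := Num.min 3%:R^-1 ((1 - q) / 3).
have sg0 : 0 < sg by rewrite lt_min invr_gt0 ltr0n divr_gt0 // subr_gt0.
have sg3 : sg <= 3%:R^-1 by rewrite ge_min lexx.
have sgq : 3 * sg <= 1 - q.
  have : sg <= (1 - q) / 3 by rewrite ge_min lexx orbT.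
  lra.
(* The bound g <= rho gives both smallness conditions, g <= sg and m g <= 1 with m = k + 2. *)
pose rho := Num.min sg k.+2%:R^-1.
have rho0 : 0 < rho by rewrite lt_min sg0 invr_gt0 ltr0n.
have rhosg : rho <= sg by rewrite ge_min lexx.
have rhok : k.+2%:R * rho <= 1.
  by rewrite mulrC -ler_pdivlMr // mul1r ge_min lexx orbT.
(* Three demands: c >= c0, so that g vanishes on the plane at height b; c within rho of the
   supremum, so that g is small; c below the supremum, so that g = 0 is a contradiction. *)
pose c := Num.max c0 (sup E - rho).
have cc0 : c0 <= c by rewrite le_max lexx.
have cS : c < sup E by rewrite gt_max Sc0 ltrBlDr ltrDl.
have cr : sup E - rho <= c by rewrite le_max lexx orbT.
pose f x := f0 x - c.
have lT : llip T by apply: llipD; [apply: llipD => //|]; exact: llip_cst.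
have ltT : llip (fun x => trunc th (T x)).
  move=> r; have [L [L0 TL]] := lT r; exists L; split => // x y xr yr.
  by apply: le_trans (TL _ _ xr yr); exact: trunc_lip.
have lf : llip f.
  apply: llipB; last exact: llip_cst.
  by apply: llipB => //; apply: llipD; [apply: llipD => //|]; exact: llip_cst.
pose pr (x : 'rV[R]_k.+1) := upd x ord_max (Num.max (x 0 ord_max) b).
(* Below b the difference is frozen at its value on the plane, where it is not positive; so g
   extends by 0 and remains locally Lipschitz. *)
pose g x := Num.max (f (pr x)) 0.
have lg : llip g by apply: llip_max0; exact: (llip_clamp b lf).
have prb (x : 'rV[R]_k.+1) : b <= pr x 0 ord_max by rewrite updE le_max lexx orbT.
have prid (x : 'rV[R]_k.+1) : b <= x 0 ord_max -> pr x = x.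
  by move=> bx; rewrite /pr max_l // upd_id.
have fb (x : 'rV[R]_k.+1) : x 0 ord_max = b -> f x <= 0.
  move=> xb; have := Ub x xb; have := trunc_le th0 (T1 x); rewrite /f /f0 /T.
  by move: cc0; lra.
have g_pos (x : 'rV[R]_k.+1) : g x != 0 -> 0 < f (pr x).
  by move=> gx; rewrite ltNge; apply: contraNN gx => /max_r h; rewrite /g h.
have g_b (x : 'rV[R]_k.+1) : g x != 0 -> b < x 0 ord_max /\ 0 < f x.
  move=> /g_pos fp; have [xb|bx] := leP (x 0 ord_max) b.
    by have := @fb (pr x); rewrite updE max_r // => /(_ erefl); rewrite leNgt fp.
  by split => //; rewrite -(prid x) // ltW.
have g0 (x : 'rV[R]_k.+1) : 0 <= g x by rewrite le_max lexx orbT.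
have grho (x : 'rV[R]_k.+1) : g x <= rho.
  by rewrite ge_max (ltW rho0) andbT /f; have := SE (pr x) (prb x); lra.
pose e x := (1 + th * T x) ^- 2.
have eb (x : 'rV[R]_k.+1) : 0 <= e x <= 1 - 3 * sg.
  have dT := trunc_den th0 (T1 x).
  apply/andP; split; first by rewrite invr_ge0 sqr_ge0.
  apply: (@le_trans _ _ q); last by lra.
  have dth : 0 < 1 + th by rewrite addr_gt0.
  rewrite /e /q lef_pV2 ?posrE; [|by rewrite exprn_gt0|by rewrite exprn_gt0].
  apply: lerXn2r; rewrite ?nnegrE; [exact: ltW|exact: ltW|].
  by rewrite lerD2l; apply: ler_peMr => //; exact: ltW.
have gz : forall x, g x = 0.
  apply: (truncated_difference_zero lU1 lU2 lg bW W1 WWm t1 t2 s01 bs0 sg0 sg3 g0 _ _ _ eb).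
  - by move=> x; exact: le_trans (grho x) rhosg.
  - by move=> x; apply: le_trans rhok; apply: ler_wpM2l.
  - move=> x /g_b[bx fx]; rewrite (ltW bx) /= leNgt; apply/negP => sx.
    have := U1s x (ltW sx); have := trunc_lt th0 (T1 x); move: fx cc0; rewrite /f /f0; lra.
  move=> x i /g_b[bx fx] d1 d2.
  apply: (@near_eq_is_derive _ _ _ f).
    have nb : nbhs x (fun y : 'rV[R]_k.+1 => b < y 0 ord_max).
      by apply: (@near_coord _ _ x ord_max (fun t => b < t)); exact: lt_nbhsr.
    apply: filterS2 nb (llip_near lf fx) => y by0 fy.
    by rewrite /g prid ?max_l // ltW.
  have DT : is_derive (x 0 i) 1 (fun t => T (upd x i t)) (pd i U2 x).
    have D2 : is_derive (x 0 i) 1 (fun t => U2 (upd x i t)) (pd i U2 x).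
      by apply: DeriveDef; [rewrite -pdable_line upd_id|rewrite -pd_line upd_id].
    have := is_deriveD (is_deriveD D2 (is_derive_cst C (x 0 i) 1)) (is_derive_cst (1 : R) (x 0 i) 1).
    by rewrite !addr0.
  have T1' : 1 <= T (upd x i (x 0 i)) by [].
  have Dt := @is_derive1_comp R (trunc th) (fun t => T (upd x i t)) (x 0 i) _ _
    (is_derive_trunc th0 T1') DT.
  have Dt' : is_derive x (delta_mx 0 i) (fun y => trunc th (T y)) (e x * pd i U2 x).
    case: Dt => dt1 dt2; apply: DeriveDef.
      by have := dt1; rewrite -(pdable_line i (fun y => trunc th (T y)) x) upd_id.
    by rewrite -[LHS]/(pd i _ x) -[in LHS](upd_id x i) pd_line dt2 upd_id.
  have D1 : is_derive x (delta_mx 0 i) U1 (pd i U1 x) by exact: DeriveDef.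
  have := is_deriveB (is_deriveB Dt' (is_deriveD (is_deriveD D1 (is_derive_cst C x _)) (is_derive_cst (1 : R) x _)))
    (is_derive_cst c x (delta_mx 0 i)).
  by rewrite !addr0 subr0.
have : sup E <= c.
  apply: ge_sup; first by case: hE.
  move=> z [x bx <-]; have := gz x; rewrite /g prid // => h.
  have : f x <= 0 by rewrite -h le_max lexx.
  by rewrite /f; lra.
by rewrite leNgt cS.
Qed.

End Comparison.

(** * Removing the truncation, and the slope along horizontal planes *)

Section Slab.
Variable R : realType.
Local Notation mu := (@lebesgue_measure R).

(** All that the comparison uses of a solution, at every level s. It passes to horizontal translates
    and is checked directly for psi + c by calibration. *)
Definition tested k (psi : R -> R) (u : 'rV[R]_k.+1 -> R) := forall s, s < 1 ->
  llip (ext s u) /\ wtest (weight psi s) (ext s u) s.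

Lemma shift_last k (i : 'I_k.+1) tau (x : 'rV[R]_k.+1) : i != ord_max ->
  (tau *: delta_mx 0 i + x) 0 ord_max = x 0 ord_max.
Proof. by move=> im; rewrite !mxE eqxx /= eq_sym (negbTE im) mulr0 add0r. Qed.

Lemma ext_shift k s (u : 'rV[R]_k.+1 -> R) (i : 'I_k.+1) tau x : i != ord_max ->
  ext s u (tau *: delta_mx 0 i + x) = ext s (fun y => u (tau *: delta_mx 0 i + y)) x.
Proof.
move=> im; rewrite /ext shift_last //; congr u; apply/rowP => j; rewrite !mxE.
case: eqP => // ->; by rewrite eqxx /= eq_sym (negbTE im) mulr0 add0r.
Qed.

Lemma trunc_limit (t v : R) : 1 <= t -> (forall th, 0 < th -> trunc th t <= v) -> t <= v.
Proof.
move=> t1 h; rewrite leNgt; apply/negP => vt.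
have t0 : 0 < t by lra.
have v0 : 0 < v.
  apply: lt_le_trans (h 1 ltr01); rewrite /trunc divr_gt0 //; lra.
(* This th solves v (1 + th t) = (t + v) / 2, which is smaller than t. *)
have d0 : 0 < (t - v) / (2 * v * t) by rewrite divr_gt0 ?subr_gt0 // !mulr_gt0.
have := h _ d0; rewrite /trunc ler_pdivrMr; last by rewrite addr_gt0 // mulr_gt0.
rewrite (_ : v * _ = (t + v) / 2); first by lra.
by field; rewrite !gt_eqF.
Qed.

Lemma llip_cutoff_cube k (rho : R) : exists zeta : 'rV[R]_k -> R, [/\ llip zeta,
  forall x, in_cube rho x -> zeta x = 1 & forall x, zeta x != 0 -> in_cube (rho + 1) x].
Proof.
(* The absolute value, written with positive parts so that [llip_max0] applies. *)
pose a (i : 'I_k) (x : 'rV[R]_k) : R := Num.max (x 0 i) 0 + Num.max (- x 0 i) 0.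
have aE i x : a i x = `|x 0 i|.
  rewrite /a; have [h|h] := leP 0 (x 0 i); first by rewrite max_r ?addr0 ?ger0_norm //; lra.
  by rewrite max_l ?add0r ?ltr0_norm //; lra.
pose m x : R := \sum_i Num.max (a i x - rho) 0.
have mi x i : a i x - rho <= m x.
  rewrite /m (bigD1 i) //=; apply: le_trans (_ : Num.max (a i x - rho) 0 <= _).
    by rewrite le_max lexx.
  by rewrite lerDl sumr_ge0 // => j _; rewrite le_max lexx orbT.
exists (fun x => Num.max (1 - m x) 0); split.
- apply: llip_max0; apply: llipB; first exact: llip_cst.
  apply: llip_sum => i; apply: llip_max0; apply: llipB; last exact: llip_cst.
  apply: llipD; apply: llip_max0; first exact: llip_coord.
  by apply: llipN; exact: llip_coord.
- move=> x xr; rewrite /m big1 ?subr0 ?max_l // => i _.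
  by rewrite max_r // subr_le0 aE.
- move=> x nz i; rewrite -aE; have := mi x i.
  have : 0 < 1 - m x by rewrite ltNge; apply: contraNN nz => /max_r ->.
  lra.
Qed.

Lemma near_bound (v w l e : R) : `|w - v| < e -> `|v| <= l -> e <= 1 -> - (l + 1) < w < l + 1.
Proof.
by rewrite ltr_norml ler_norml => /andP[? ?] /andP[? ?] ?; apply/andP; split; lra.
Qed.

Lemma plane_bound (D e w : R) : e <= D / 2 -> `|w - (- D)| < e -> w < - (D / 2).
Proof. by move=> ?; rewrite ltr_norml => /andP[? ?]; lra. Qed.

(** The gradient bound holds almost everywhere and so may fail all along the given line. Arbitrarily
    close there are parallel lines on which it holds at almost every relevant point; the fundamental
    theorem applies there, and continuity of U at the two endpoints carries the estimate back. *)
Lemma slope_bound k (i : 'I_k.+1) (U : 'rV[R]_k.+1 -> R) (N : set 'rV[R]_k.+1) C : i != ord_max ->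
  llip U -> Rn_null_set N ->
  (forall y : 'rV[R]_k.+1, y 0 ord_max < 0 -> C / `|y 0 ord_max| < `|pd i U y| -> N y) ->
  forall D (x : 'rV[R]_k.+1) p q, 0 < D -> x 0 ord_max = - D -> p <= q ->
    `|U (upd x i q) - U (upd x i p)| <= 2 * `|C| / D * (q - p).
Proof.
move=> im lU nullN hN D x p q D0 xD pq.
pose rho := l1 x + `|p| + `|q| + 1.
have l10 := l1_ge0 x; have p0 := normr_ge0 p; have q0 := normr_ge0 q.
have rho0 : 0 <= rho by rewrite /rho; lra.
set M := 2 * `|C| / D.
have M0 : 0 <= M by rewrite divr_ge0 ?mulr_ge0 // ltW.
pose A : 'rV[R]_k.+1 := const_mx (- rho).
(* In the box |x_n| > D / 2, so C / |x_n| is at most M; this accounts for the factor 2 in M. *)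
pose B : 'rV[R]_k.+1 := \row_j if j == ord_max then - (D / 2) else rho.
(* The part of the partial derivative in excess of M, which can be nonzero only on N. *)
pose f y := \1_(obox A B) y * Num.max (`|pd i U y| - M) 0.
have f0 y : 0 <= f y by rewrite /f indicE mulr_ge0 // le_max lexx orbT.
have iF : integrand f.
  apply: integrand_obox.
    apply: (borel_comp1 (h := fun t : R => Num.max (`|t| - M) 0)); last exact: borel_pd.
    apply: measurable_maxr => //; apply: measurable_funB => //; exact: normr_measurable.
  move=> r; have [M' hM'] := llip_locbd_pd i lU r; exists M' => y /hM' yM.
  rewrite ger0_norm ?le_max ?lexx ?orbT // ge_max; apply/andP; split; last exact: le_trans yM.
  by lra.
have fN y : f y != 0 -> N y.
  rewrite /f indicE; have [yK|yK] := pselect (obox A B y); last by rewrite memNset // mul0r eqxx.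
  rewrite mem_set // mul1r => nz.
  have hy : M < `|pd i U y| by rewrite ltNge; apply: contraNN nz => h; rewrite max_r ?subr_le0.
  have := yK ord_max; rewrite !mxE eqxx => /andP[_ yD].
  have y0 : y 0 ord_max < 0 by lra.
  apply: hN => //; apply: le_lt_trans hy; rewrite ltr0_norm //.
  apply: (@le_trans _ _ (`|C| / - y 0 ord_max)).
    by apply: ler_wpM2r; [rewrite invr_ge0; lra|exact: ler_norm].
  rewrite /M [2 * _]mulrC -mulrA; apply: ler_wpM2l => //.
  rewrite -[2 / D]invrK lef_pV2 ?posrE; [|by lra|by rewrite invr_gt0 divr_gt0].
  by rewrite invf_div; lra.
have if0 := Rn_null_iint0 nullN iF f0 fN.
apply/ler_addgt0Pr => e e0.
have e2 : 0 < e / 2 by rewrite divr_gt0.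
have [dp /andP[dp0 dp1] hdp] := llip_at (upd x i p) lU e2.
have [dq /andP[dq0 dq1] hdq] := llip_at (upd x i q) lU e2.
pose de := Num.min (Num.min dp dq) (D / 2).
have de0 : 0 < de by rewrite !lt_min dp0 dq0 divr_gt0.
have dep : de <= dp by rewrite !ge_min lexx.
have deq : de <= dq by rewrite !ge_min lexx orbT.
have de1 : de <= 1 by exact: le_trans dep dp1.
have deD : de <= D / 2 by rewrite !ge_min lexx !orbT.
have [|x' [x'x ix']] := @iint0_line R _ i f (\row_j (x 0 j - de)) (\row_j (x 0 j + de)) iF f0 if0.
  by move=> j; rewrite !mxE; lra.
have {}x'x j : `|x' 0 j - x 0 j| < de.
  by have := x'x j; rewrite !mxE ltr_norml => /andP[? ?]; apply/andP; split; lra.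
have upd_near t d j : de <= d -> `|upd x' i t 0 j - upd x i t 0 j| <= d.
  move=> h; apply: le_trans h; rewrite !mxE; case: eqP => _; last exact: ltW.
  by rewrite subrr normr0 ltW.
have cube t : `|t| + 1 <= rho -> in_cube rho (upd x' i t).
  move=> tr; apply: upd_cube; last by apply: le_trans tr; rewrite lerDl.
  apply: in_cubeW (in_cube_near (fun j => ltW (x'x j))).
  by apply: (@le_trans _ _ (l1 x + 1)); rewrite ?lerD2l // /rho lerD2r -addrA lerDl addr_ge0.
have ep := hdp _ (fun j => upd_near p dp j dep); have eq_ := hdq _ (fun j => upd_near q dq j deq).
have [zeta [lz z1 zs]] := llip_cutoff_cube k.+1 rho.
(* [line_ftc] asks for bounded support; zeta equals 1 on the cube in which U is evaluated. *)
pose Phi y := zeta y * U y.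
have lPhi : llip Phi by exact: llipM.
have suppPhi y : Phi y != 0 -> in_cube (rho + 1) y by rewrite mulf_eq0 negb_or => /andP[/zs].
have r10 : 0 <= rho + 1 by lra.
have pr : `|p| + 1 <= rho by rewrite /rho; lra.
have qr : `|q| + 1 <= rho by rewrite /rho; lra.
have cp := cube p pr; have cq := cube q qr.
have key : `|U (upd x' i q) - U (upd x' i p)| <= M * (q - p).
  have PhiU t : in_cube rho (upd x' i t) -> Phi (upd x' i t) = U (upd x' i t).
    by move=> h; rewrite /Phi z1 // mul1r.
  rewrite -(PhiU q) // -(PhiU p) //.
  rewrite -(line_ftc i lPhi r10 suppPhi x' q) -(line_ftc i lPhi r10 suppPhi x' p).
  have [M' hD] := line_pd_bounded_compact i lPhi suppPhi x'.
  have hDs t := bounded_compact_lt t hD.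
  have jq := bounded_compact_integrable (hDs q); have jp := bounded_compact_integrable (hDs p).
  rewrite -RintegralB //; apply: le_trans (le_normr_Rintegral measurableT (integrableB measurableT jq jp)) _.
  have hI : bounded_compact (fun s => \1_(`[p, q]%classic) s : R) 1 rho.
    by apply: itv_bounded_compact; [apply: le_trans pr|apply: le_trans qr]; rewrite lerDl.
  have hMI := bounded_compactZ M hI.
  have [Mf [rf [Mf0 rf0 bf fM fr]]] := iF.
  have hf : bounded_compact (fun s => f (upd x' i s)) Mf rf.
    split.
    - by apply: (bf _ _ (fun s => upd x' i s)) => j; exact: measurable_upd.
    - by move=> s; exact: fM.
    - by move=> s /fr/(_ i); rewrite updE.
  have jI := bounded_compact_integrable hMI; have jf := bounded_compact_integrable hf.
  apply: (@le_trans _ _ (Rintegral mu setT (fun s => M * \1_(`[p, q]%classic) s + f (upd x' i s)))).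
    apply: le_Rintegral => //.
    - exact: (integrable_norm (integrableB measurableT jq jp)).
    - exact: (integrableD measurableT jI jf).
    move=> s _ /=; have fs := f0 (upd x' i s); rewrite -mulrBr.
    have [sp|ps] := ltP s p.
      by rewrite (lt_le_trans sp pq) subrr mulr0 normr0 addr_ge0 // mulr_ge0 // indicE.
    rewrite indicE mem_setE in_itv /= ps /=; have [sq|qs] := ltP s q; last first.
      by rewrite subrr mulr0 normr0 addr_ge0 // mulr_ge0.
    rewrite (ltW sq) subr0 !mulr1.
    have ys : obox A B (upd x' i s).
      move=> j; rewrite !mxE; have [->|ji] := eqVneq j i.
        rewrite (negbTE im); apply/andP; split.
          by apply: lt_le_trans ps; rewrite ltrNl; apply: lt_le_trans pr; rewrite -normrN ltr_pwDr // ler_norm.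
        by apply: lt_le_trans sq _; apply: le_trans (ler_norm _) _; apply: le_trans qr; rewrite lerDl.
      have /andP[h1 h2] := near_bound (x'x j) (l1_coord x j) de1.
      have rl : l1 x + 1 <= rho by rewrite /rho lerD2r -addrA lerDl addr_ge0.
      rewrite (le_lt_trans _ h1) ?lerN2 //=.
      have [jm|_] := eqVneq j ord_max; last exact: lt_le_trans rl.
      by have := x'x j; rewrite jm xD; exact: plane_bound deD.
    have -> : pd i Phi (upd x' i s) = pd i U (upd x' i s).
      have nE : \forall y \near upd x' i s, Phi y = U y.
        apply: filterS (open_nbhs_nbhs (conj (@open_obox R _ A B) ys)) => y yK.
        rewrite /Phi z1 ?mul1r // => j; have := yK j; rewrite !mxE ler_norml => /andP[/ltW -> h] /=.
        by apply: le_trans (ltW h) _; case: eqP => _ //; apply: le_trans rho0; rewrite oppr_le0 ltW // divr_gt0.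
      exact: near_eq_derive nE.
    rewrite /f indicE mem_set // mul1r; have : `|pd i U (upd x' i s)| - M <= Num.max (`|pd i U (upd x' i s)| - M) 0 by rewrite le_max lexx.
    by lra.
  by rewrite RintegralD // ix' addr0 (Rintegral_bounded_compactZ _ hI) Rintegral_itv.
have -> : U (upd x i q) - U (upd x i p) = (U (upd x' i q) - U (upd x' i p)) -
   (U (upd x' i q) - U (upd x i q)) + (U (upd x' i p) - U (upd x i p)) by ring.
apply: le_trans (ler_normD _ _) _; have := ler_normB (U (upd x' i q) - U (upd x' i p)) (U (upd x' i q) - U (upd x i q)).
by lra.
Qed.

End Slab.

(** * Independence of the horizontal variables, and identification with psi *)

Section Rigidity.
Variable R : realType.
Variables (k : nat) (psi : R -> R).
Hypothesis psi_d : forall s : R, s < 1 -> derivable psi s 1.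
Hypothesis psi_d2 : forall s : R, s < 1 -> derivable (derive1 psi) s 1.
Hypothesis psi_ge0 : forall s : R, s < 1 -> 0 <= psi s.
Hypothesis psi_0 : forall s : R, s <= 0 -> psi s = 0.
Hypothesis psi_inc : forall s : R, 0 < s < 1 -> 0 < derive1 psi s.
Hypothesis psi_oo : psi s @[s --> 1^'-] --> +oo.

Lemma llip_ext_psi s : s < 1 -> llip (ext s (fun y : 'rV[R]_k.+1 => psi (y 0 ord_max))).
Proof. by move=> s1; apply: llip_ext s1 _; exact: psi_loc_lipschitz. Qed.

Lemma tested_weak (u : 'rV[R]_k.+1 -> R) : weak_weighted_IMCF psi (@below1 R k) u -> tested psi u.
Proof.
move=> wu s s1; split; first by apply: llip_ext s1 _; case: wu.
by apply: wtest_weak => //; exact: psi_loc_lipschitz.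
Qed.

Lemma tested_shift (u : 'rV[R]_k.+1 -> R) (i : 'I_k.+1) tau : i != ord_max -> tested psi u ->
  tested psi (fun x => u (tau *: delta_mx 0 i + x)).
Proof.
move=> im tu s s1; have [lu wu] := tu s s1.
rewrite (_ : ext s _ = fun x => ext s u (tau *: delta_mx 0 i + x)); last first.
  by apply/funext => x; rewrite ext_shift.
split; first exact: llip_shift.
have lp := llip_ext_psi s1.
apply: wtest_shift => //; [|exact: borel_weight|exact: locbd_weight].
by move=> x; rewrite /weight ext_shift // /ext shift_last // updE.
Qed.

Lemma tested_psi c : tested psi (fun y : 'rV[R]_k.+1 => psi (y 0 ord_max) + c).
Proof.
move=> s s1; split; last exact: wtest_psi.
by apply: llipD; [exact: llip_ext_psi|exact: llip_cst].
Qed.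

Lemma psi_large A : exists2 s : R, s < 1 & forall t, s <= t < 1 -> A <= psi t.
Proof.
have h : \forall t \near 1^'-, A <= psi t by exact: (cvgry_ge psi_oo).
rewrite near_withinE in h.
have [r r0 hr] := (nbhs_ballP _ _).1 h.
have r0' : (0 : R) < r by [].
exists (1 - r / 2); first by rewrite ltrBlDr ltrDl divr_gt0.
move=> t /andP[st t1]; apply: hr => //.
by rewrite /ball /= ltr_norml; apply/andP; split; lra.
Qed.

Lemma comparison (u1 u2 : 'rV[R]_k.+1 -> R) (b c0 C : R) : tested psi u1 -> tested psi u2 -> b < 1 ->
  0 <= c0 -> (forall x, below1 x -> psi (x 0 ord_max) - C <= u1 x) -> (forall x, below1 x -> - C <= u2 x) ->
  (forall x : 'rV[R]_k.+1, x 0 ord_max = b -> u2 x <= u1 x + c0) ->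
  forall x : 'rV[R]_k.+1, b <= x 0 ord_max < 1 -> u2 x <= u1 x + c0.
Proof.
move=> tu1 tu2 b1 c00 u1C u2C ub x /andP[bx x1].
suff : u2 x + C + 1 <= u1 x + C + 1 + c0 by lra.
apply: trunc_limit; first by have := u2C x x1; lra.
move=> th th0; have [sA sA1 hA] := psi_large th^-1.
(* Beyond sA the potential is at least 1 / th, and s0 must also lie above b and above x. The level
   s1, halfway from s0 to 1, leaves room for the test boxes. *)
pose s0 := Num.max (Num.max b (x 0 ord_max)) sA.
have s01 : s0 < 1 by rewrite !gt_max b1 x1.
have bs0 : b <= s0 by rewrite !le_max lexx.
have xs0 : x 0 ord_max <= s0 by rewrite !le_max lexx orbT.
have As0 : sA <= s0 by rewrite !le_max lexx orbT.
pose s1 := (1 + s0) / 2; have s0s1 : s0 < s1 by rewrite /s1; lra.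
have s11 : s1 < 1 by rewrite /s1; lra.
have [l1' w1] := tu1 s1 s11; have [l2 w2] := tu2 s1 s11.
have [Wm hW] := weight_bounds psi_d psi_d2 psi_ge0 psi_0 k s11.
have bW : borel (@weight R k psi s1) by apply: borel_weight; exact: llip_ext_psi.
have pr_lt (y : 'rV[R]_k.+1) : below1 (upd y ord_max (Num.min (y 0 ord_max) s1)).
  by rewrite /below1 /= updE gt_min s11 orbT.
have U1C y : - C <= ext s1 u1 y.
  by have := u1C _ (pr_lt y); have := psi_ge0 (pr_lt y); rewrite /ext; lra.
have U2C y : - C <= ext s1 u2 y by exact: u2C (pr_lt y).
rewrite -[u1 x](@ext_id R k s1); last by apply: le_trans xs0 (ltW s0s1).
rewrite -[u2 x](@ext_id R k s1); last by apply: le_trans xs0 (ltW s0s1).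
have W1 (y : 'rV[R]_k.+1) : 1 <= weight psi s1 y by have /andP[] := hW y.
have WWm (y : 'rV[R]_k.+1) : weight psi s1 y <= Wm by have /andP[] := hW y.
apply: (comparison_trunc l1' l2 bW W1 WWm w1 w2 s0s1 bs0 th0 c00 U1C U2C _ _ bx).
- move=> y ys; have := u1C _ (pr_lt y); rewrite updE.
  set t := Num.min _ _ => h; have : th^-1 <= psi t.
    apply: hA; rewrite /t gt_min s11 orbT andbT le_min (le_trans As0 ys) /=.
    exact: le_trans As0 (ltW s0s1).
  by rewrite /ext -/t; lra.
- by move=> y yb; rewrite !ext_id ?yb ?(le_trans bs0 (ltW s0s1)) //; exact: ub.
Qed.

Lemma eq_horizontal (u : 'rV[R]_k.+1 -> R) :
  (forall i t x, i != ord_max -> below1 x -> u (upd x i t) = u x) ->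
  forall x y : 'rV[R]_k.+1, below1 x -> x 0 ord_max = y 0 ord_max -> u x = u y.
Proof.
move=> inv x y xO xy.
(* The coordinates of x are exchanged for those of y one at a time; the last one already agrees. *)
pose z m : 'rV[R]_k.+1 := \row_j if (j < m)%N then y 0 j else x 0 j.
have zl m : z m 0 ord_max = x 0 ord_max by rewrite mxE -xy; case: ifP.
have zm m : u (z m) = u x.
  elim: m => [|m <-]; first by congr u; apply/rowP => j; rewrite mxE.
  have [mk|km] := ltnP m k.+1; last first.
    congr u; apply/rowP => j; rewrite !mxE; have jm := leq_trans (ltn_ord j) km.
    by rewrite jm (ltn_trans jm).
  pose i := Ordinal mk; have zE : z m.+1 = upd (z m) i (y 0 i).
    apply/rowP => j; rewrite !mxE; have [->|ji] := eqVneq j i; first by rewrite ltnSn.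
    rewrite ltnS leq_eqVlt (_ : (nat_of_ord j == m) = false) //.
    by apply/negbTE; apply: contraNneq ji => jm; apply/eqP/val_inj.
  have [im|im] := eqVneq i ord_max; last by rewrite zE inv //= /below1 /= zl.
  by rewrite zE im -xy -(zl m) upd_id.
rewrite -(zm k.+1); congr u; apply/rowP => j; by rewrite mxE ltn_ord.
Qed.

Variables (u : 'rV[R]_k.+1 -> R) (C : R).
Hypothesis weak_u : weak_weighted_IMCF psi (@below1 R k) u.
Hypothesis u_ge : forall x, below1 x -> psi (x 0 ord_max) - C <= u x.
Hypothesis grad_u : Rn_null_set [set x : 'rV[R]_k.+1 |
  x 0 ord_max < 0 /\ ~ (enorm (grad u x) <= C / `|x 0 ord_max|)].

Lemma u_geC x : below1 x -> - C <= u x.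
Proof. by move=> xO; have := u_ge xO; have := psi_ge0 xO; lra. Qed.

Lemma shift_le (i : 'I_k.+1) tau x : i != ord_max -> below1 x -> u (tau *: delta_mx 0 i + x) <= u x.
Proof.
move=> im xO; have h01 : (0 : R) < 1 by [].
(* The planes compared here have negative height, so freezing at height 0 does not affect them. *)
have lU : llip (ext 0 u) by apply: llip_ext => //; case: weak_u.
have slope := @slope_bound R k i (ext 0 u) _ C im lU grad_u.
have plane D (y : 'rV[R]_k.+1) : 0 < D -> y 0 ord_max = - D ->
    u (tau *: delta_mx 0 i + y) <= u y + 2 * `|C| / D * `|tau|.
  move=> D0 yD; have y0 : y 0 ord_max <= 0 by rewrite yD oppr_le0 ltW.
  have sl p q : p <= q -> `|ext 0 u (upd y i q) - ext 0 u (upd y i p)| <= 2 * `|C| / D * (q - p).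
    apply: slope => // z z0 hz; split => //= hz'.
    move: hz; rewrite (pd_ext u i z0) ltNge => /negP; apply.
    apply: le_trans hz'; have := enorm_coord (grad u z) i.
    by rewrite mxE.
  rewrite -[u _](@ext_id R k 0); last by rewrite shift_last.
  rewrite -[u y](@ext_id R k 0) // -upd_addE -[in X in _ <= X + _](upd_id y i).
  have [t0|t0] := leP 0 tau.
    have := sl (y 0 i) (y 0 i + tau); rewrite lerDl => /(_ t0).
    rewrite (_ : y 0 i + tau - y 0 i = tau); last by ring.
    by rewrite ler_norml => /andP[_]; rewrite (ger0_norm t0); lra.
  have := sl (y 0 i + tau) (y 0 i); rewrite gerDl => /(_ (ltW t0)).
  rewrite (_ : y 0 i - (y 0 i + tau) = - tau); last by ring.
  by rewrite ler_norml (ltr0_norm t0) => /andP[+ _]; lra.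
have cmp D : 0 < D -> - D <= x 0 ord_max ->
    u (tau *: delta_mx 0 i + x) <= u x + 2 * `|C| / D * `|tau|.
  move=> D0 Dx; have tu := tested_weak weak_u.
  pose v := fun y : 'rV[R]_k.+1 => u (tau *: delta_mx 0 i + y).
  have tv : tested psi v by exact: tested_shift.
  have D1 : - D < 1 by lra.
  have c00 : 0 <= 2 * `|C| / D * `|tau| by rewrite mulr_ge0 // divr_ge0 ?mulr_ge0 // ltW.
  have vC y : below1 y -> - C <= v y by move=> yO; apply: u_geC; rewrite /below1 /= shift_last.
  apply: (comparison tu tv D1 c00 u_ge vC (fun y => plane D y D0)).
  by rewrite Dx.
apply/ler_addgt0Pr => e e0.
(* Deep enough for x to lie above the plane and for the error 2 |C| |tau| / D to be at most e. *)
pose D := 1 + `|x 0 ord_max| + 2 * `|C| * `|tau| / e.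
have h0 : 0 <= 2 * `|C| * `|tau| / e by rewrite divr_ge0 ?mulr_ge0 // ltW.
have x0 := normr_ge0 (x 0 ord_max); have x0' := ler_norm (- x 0 ord_max); rewrite normrN in x0'.
have D0 : 0 < D by rewrite /D; lra.
apply: le_trans (cmp D D0 _) _; first by rewrite /D; lra.
rewrite lerD2l mulrAC ler_pdivrMr //.
have : 2 * `|C| * `|tau| / e <= D by rewrite /D; lra.
by rewrite ler_pdivrMr // [D * e]mulrC.
Qed.

(** The inequality holds for every translation, hence also for the inverse one. *)
Lemma shift_eq (i : 'I_k.+1) t x : i != ord_max -> below1 x -> u (upd x i t) = u x.
Proof.
move=> im xO; have le (y : 'rV[R]_k.+1) tau : below1 y -> u (upd y i (y 0 i + tau)) <= u y.
  by move=> yO; rewrite upd_addE; exact: shift_le.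
apply/eqP; rewrite eq_le; apply/andP; split.
  by have := le x (t - x 0 i) xO; rewrite addrC subrK.
have yO : below1 (upd x i t) by rewrite /below1 /= updN // eq_sym.
have := le _ (x 0 i - t) yO; rewrite updE addrC subrK upd_upd upd_id //.
Qed.

Lemma u_rigid x : below1 x -> u x = psi (x 0 ord_max) + u 0.
Proof.
move=> xO; pose D := 1 + `|x 0 ord_max|; pose o : 'rV[R]_k.+1 := upd 0 ord_max (- D).
have x0 := normr_ge0 (x 0 ord_max); have x0' := ler_norm (- x 0 ord_max); rewrite normrN in x0'.
have D0 : 0 < D by rewrite /D; lra.
have D1 : - D < 1 by lra.
have oO : below1 o by rewrite /below1 /= updE.
pose c := u o; pose w (y : 'rV[R]_k.+1) := psi (y 0 ord_max) + c.
(* One constant serves for the lower bounds of both u and w, so each can play either role in the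
   comparison. *)
pose C' := Num.max C (- c).
have tu := tested_weak weak_u; have tw : tested psi w := tested_psi c.
have CC : C <= C' by rewrite le_max lexx.
have Cc : - c <= C' by rewrite le_max lexx orbT.
have psi_D : psi (- D) = 0 by apply: psi_0; lra.
have on_plane (y : 'rV[R]_k.+1) : y 0 ord_max = - D -> u y = w y.
  move=> yD; rewrite /w yD psi_D add0r; apply: (eq_horizontal shift_eq).
    by rewrite /below1 /= yD.
  by rewrite yD updE.
have uC y : below1 y -> psi (y 0 ord_max) - C' <= u y by move=> /u_ge; lra.
have uC0 y : below1 y -> - C' <= u y by move=> /u_geC; lra.
have wC y : below1 y -> psi (y 0 ord_max) - C' <= w y by move=> _; rewrite /w; lra.
have wC0 y : below1 y -> - C' <= w y by move=> yO; rewrite /w; have := psi_ge0 yO; lra.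
have uw_plane (y : 'rV[R]_k.+1) : y 0 ord_max = - D -> u y <= w y + 0.
  by move=> /on_plane ->; rewrite addr0.
have wu_plane (y : 'rV[R]_k.+1) : y 0 ord_max = - D -> w y <= u y + 0.
  by move=> /on_plane ->; rewrite addr0.
have uw (y : 'rV[R]_k.+1) : - D <= y 0 ord_max < 1 -> u y = w y.
  move=> yD; have h1 := comparison tw tu D1 (lexx 0) wC uC0 uw_plane yD.
  have h2 := comparison tu tw D1 (lexx 0) uC wC0 wu_plane yD.
  by apply/eqP; rewrite eq_le -[X in _ <= X]addr0 h1 -[X in _ <= X]addr0 h2.
(* The origin lies in the slab and psi vanishes there, so c, which came from the plane at depth D,
   equals [u 0] for every D. *)
have h0 : - D <= (0 : 'rV[R]_k.+1) 0 ord_max < 1 by rewrite mxE ltr01 andbT; lra.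
rewrite (uw 0 h0) uw; last by rewrite xO andbT /D; lra.
by rewrite /w mxE (psi_0 (lexx 0)) add0r.
Qed.

End Rigidity.

Theorem theorem4p3 (R : realType) (n : nat) (psi : R -> R)
  (u : 'rV[R]_n -> R) (C : R) :
  (2 <= n)%N ->
  (* psi smooth on (-oo,1) *)
  (forall (k : nat) (s : R), s < 1 -> derivable (derive1n k psi) s 1) ->
  (forall s : R, s < 1 -> 0 <= psi s) ->
  (forall s : R, s <= 0 -> psi s = 0) ->
  (forall s : R, 0 < s < 1 ->
     0 < psi s /\ 0 < derive1 psi s /\ 0 < derive1n 2 psi s /\ 0 < derive1n 3 psi s) ->
  psi s @[s --> 1^'-] --> +oo ->
  weak_weighted_IMCF psi [set x | lastc x < 1] u ->
  (forall x, lastc x < 1 -> psi (lastc x) - C <= u x) ->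
  Rn_null_set [set x | lastc x < 0 /\ ~ (enorm (grad u x) <= C / `|lastc x|)] ->
  exists C' : R, forall x, lastc x < 1 -> u x = psi (lastc x) - C'.
Proof.
case: n u => [//|k] u _ psi_smooth psi_ge0 psi_0 psi_pos psi_oo weak_u u_ge grad_u.
exists (- u 0) => x xO; rewrite opprK.
apply: (u_rigid (psi_smooth 0%N) (psi_smooth 1%N) psi_ge0 psi_0 _ psi_oo weak_u u_ge grad_u xO).
by move=> s /psi_pos[_ []].
Qed.
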